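(* There exists a universal constant $c_0>0$ such that, for all $n\ge2$, $p\ge1$, $\sigma>0$, $\delta\in(0,1)$ and every $\Theta\in\mathbb R^{p\times n}$, in the Gaussian model, with probability higher than $1-6\delta$ the estimator $\hat\tau$ described in the context satisfies (NoSp) and detects all $c_0$-high-energy change-points $\tau_k$, in the sense that $$d_{H,1}(\hat\tau,\tau_k)<\frac{r_k^*}{2}\le\frac{r_k}{2}.$$ Here $\tau_k$ is a $c_0$-high-energy change-point if $$r_k\Delta_k^2\ge c_0\sigma^2\Big[s_k\log\Big(1+\frac{\sqrt p}{s_k}\sqrt{\log\big(\tfrac{n}{r_k\delta}\big)}\Big)+\log\big(\tfrac{n}{r_k\delta}\big)\Big],$$ and $r_k^*$ is the smallest real $r>0$ such that $r\Delta_k^2\ge c_0\sigma^2\big[s_k\log\big(1+\frac{\sqrt p}{s_k}\sqrt{\log(\frac n{r\delta})}\big)+\log(\frac n{r\delta})\big]$.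
   Context: Gaussian model. $y_t=\theta_t+\varepsilon_t\in\mathbb R^p$, $t=1,\dots,n$, with $\Theta=(\theta_1,\dots,\theta_n)$ deterministic and $\varepsilon_t$ i.i.d. $\mathcal N(0,\sigma^2 I_p)$, $\sigma$ known. The change-points $1=\tau_0<\tau_1<\dots<\tau_K<\tau_{K+1}=n+1$ are such that $\theta_t=\mu_k$ for $\tau_k\le t<\tau_{k+1}$ with $\mu_k\ne\mu_{k-1}$. Put $\Delta_k=\|\mu_k-\mu_{k-1}\|$ (Euclidean norm), $r_k=\min(\tau_{k+1}-\tau_k,\tau_k-\tau_{k-1})$, $s_k=\|\mu_k-\mu_{k-1}\|_0$ (number of nonzero coordinates). Dyadic grid $\mathcal G_D$: scales $\mathcal R=\{1,2,4,\dots,2^{\lfloor\log_2 n\rfloor-1}\}$; locations $\mathcal D_1=\{2,\dots,n\}$ and, for $r\in\mathcal R$, $r\ge2$, $\mathcal D_r=\{m\frac r2+1: m\in\mathbb N,\ 2\le m\le\lfloor 2n/r\rfloor-2\}\cup\{n-r+1\}$; $\mathcal G_D=\{(l,r):r\in\mathcal R,l\in\mathcal D_r\}$. Tests. CUSUM: $\mathbf C_{l,r}=\sqrt{\frac r{2\sigma^2}}\big(\frac1r\sum_{i=l}^{l+r-1}y_i-\frac1r\sum_{i=l-r}^{l-1}y_i\big)\in\mathbb R^p$, with coordinates $\mathbf C_{l,r,i}$, and $|\mathbf C_{l,r,(1)}|\ge\dots\ge|\mathbf C_{l,r,(p)}|$ its reordered entries. - Dense test: $T^{(d)}_{l,r}=\mathbf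 1\{\|\mathbf C_{l,r}\|^2-p>4(\sqrt{p\log(\frac{2n}{r\delta})}+\log(\frac{2n}{r\delta}))\}$. - Berk–Jones test: with $N_{x,l,r}=\sum_{i=1}^p\mathbf 1\{|\mathbf C_{l,r,i}|>x\}$, $\delta_{x,r}=\frac{6\delta r}{\pi^2x^2|\mathcal D_r|n}$, $\overline\Phi(x)=\mathbb P(\mathcal N(0,1)>x)$, and $\overline Q^{-1}(a,p_0,q_0)=\inf\{u:\mathbb P[\mathrm{Bin}(p_0,q_0)>u]\le a\}$, set $T^{(BJ)}_{l,r}=\max_{x\in\{1,2,\dots\}}\mathbf 1\{N_{x,l,r}>\overline Q^{-1}(\delta_{x,r},p,2\overline\Phi(x))\}$. - Partial norm test: with $\mathcal Z=\{1,2,2^2,\dots,2^{\lfloor\log_2 p\rfloor}\}$, $T^{(p)}_{l,r}=\max_{s\in\mathcal Z}\mathbf 1\{\sum_{i=1}^s\mathbf C_{l,r,(i)}^2>4s\log(\frac{2ep}s)+4\log(\frac n{r\delta})\}$. The combined test is $T_{l,r}=\max(T^{(d)}_{l,r},T^{(BJ)}_{l,r},T^{(p)}_{l,r})$, $(l,r)\in\mathcal G_D$. Estimator (bottom-up aggregation). For $r\in\mathcal R$ increasing define (closed real intervals) $\mathcal T_r=\{l\in\mathcal D_r:T_{l,r}=1,\ [l-r+1,l+r-1]\cap\bigcup_{r'<r,r'\in\mathcal R}\mathcal S_{r'}=\emptyset\}$ and $\mathcal S_r=\bigcup_{l\in\mathcal T_r}[l-r+1,l+r-1]$. Let $C_1,\dots,C_{\hat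 K}$ be the connected components of $\bigcup_{r}\mathcal S_r$ in increasing order, and $\hat\tau_k=\frac12(\min C_k+\max C_k)$. (NoSp): for all $1\le k\le K$ the interval $[\tau_k-\frac{\tau_k-\tau_{k-1}}2,\tau_k+\frac{\tau_{k+1}-\tau_k}2]$ contains at most one $\hat\tau_{k'}$, and all $\hat\tau_{k'}$ lie in $[\tau_1-\frac{\tau_1-1}2,\tau_K+\frac{n+1-\tau_K}2]$; for $K=0$ it means $\hat K=0$. Localization error: $d_{H,1}(\hat\tau,\tau_k)=\min_{l\le\hat K}|\hat\tau_l-\tau_k|$ ($+\infty$ if $\hat K=0$). *)

(* Defs.v *)
From HB Require Import structures.
From mathcomp Require Import all_boot all_order all_algebra.
From mathcomp Require Import all_classical all_reals all_analysis.

Set Implicit Arguments.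
Unset Strict Implicit.
Unset Printing Implicit Defensive.

Import Order.TTheory GRing.Theory Num.Theory.
Import numFieldNormedType.Exports.

Local Open Scope classical_set_scope.
Local Open Scope ring_scope.

(* Convention: a column [t : 'I_n] of a [p] x [n] matrix holds the observation
   at time [t.+1], so that times run from 1 to n. *)

Section Model.
Context {R : realType}.

(* The library norm on matrices is the sup norm. *)
Definition euclidean_norm p (v : 'cV[R]_p) : R :=
  Num.sqrt (\sum_(i < p) v i 0 ^+ 2).

Definition sparsity p (v : 'cV[R]_p) : nat := #|[pred i : 'I_p | v i 0 != 0]|.

Definition mutually_independent d (T : measurableType d) (P : probability T R)
    (I : finType) (X : I -> {RV P >-> R}) : Prop :=
  forall (J : {set I}) (B : I -> set R), (forall i, measurable (B i)) ->
    fine (P [set w | forall i, i \in J -> B i (X i w)]) =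
    \prod_(i in J) fine (P (X i @^-1` B i)).

(* The columns of [eps] are i.i.d. N(0, sigma^2 I_p): all the n * p entries are
   independent and N(0, sigma^2). The second argument of [normal_prob] is the
   standard deviation. *)
Definition gaussian_noise d (T : measurableType d) (P : probability T R)
    n p (sigma : R) (eps : 'I_p -> 'I_n -> {RV P >-> R}) : Prop :=
  (forall i t (B : set R), measurable B ->
     distribution P (eps i t) B = normal_prob 0 sigma B) /\
  mutually_independent (fun it : 'I_p * 'I_n => eps it.1 it.2).

Definition observation d (T : measurableType d) (P : probability T R)
    n p (Theta : 'M[R]_(p, n)) (eps : 'I_p -> 'I_n -> {RV P >-> R})
    (w : T) : 'M[R]_(p, n) :=
  Theta + \matrix_(i, t) eps i t w.

(* Only the values [tau k], k <= K.+1, and [mu k], k <= K, are meaningful; they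
   are determined by [Theta]. *)
Definition change_points n p (Theta : 'M[R]_(p, n)) (K : nat)
    (tau : nat -> nat) (mu : nat -> 'cV[R]_p) : Prop :=
  [/\ tau 0%N = 1%N,
      tau K.+1 = n.+1,
      (forall k, (k <= K)%N -> (tau k < tau k.+1)%N),
      (forall k (t : 'I_n), (k <= K)%N -> (tau k <= t.+1 < tau k.+1)%N ->
         col t Theta = mu k) &
      (forall k, (1 <= k <= K)%N -> mu k != mu k.-1)].

Definition jump p (mu : nat -> 'cV[R]_p) (k : nat) : 'cV[R]_p :=
  mu k - mu k.-1.

Definition spacing (tau : nat -> nat) (k : nat) : nat :=
  minn (tau k.+1 - tau k) (tau k - tau k.-1).

(* [high_energy] at [r = r_k] says that tau_k is a c0-high-energy change-point;
   r_k^* is the smallest real r > 0 at which it holds. *)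
Definition high_energy n p (c0 sigma delta : R) (v : 'cV[R]_p) (r : R) : Prop :=
  c0 * sigma ^+ 2 *
    ((sparsity v)%:R *
       ln (1 + Num.sqrt p%:R / (sparsity v)%:R *
               Num.sqrt (ln (n%:R / (r * delta)))) +
     ln (n%:R / (r * delta)))
  <= r * euclidean_norm v ^+ 2.

Definition is_least (A : set R) (x : R) : Prop := A x /\ lbound A x.

End Model.

Definition scale_count (n : nat) : nat := trunc_log 2 n.

(* The scales are [2 ^ j] for [j < scale_count n]. For [r = 2 ^ j], j >= 1, the
   locations are m * r / 2 + 1 for 2 <= m <= |_2 n / r_| - 2, and n - r + 1. *)
Definition locations (n r : nat) : seq nat :=
  if r == 1%N then index_iota 2 n.+1
  else undup (rcons [seq (m * (r %/ 2) + 1)%N |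
                       m <- index_iota 2 ((2 * n) %/ r - 1)]
                    (n - r + 1)%N).

Section Procedure.
Context {R : realType} (n p : nat) (sigma delta : R).
Implicit Types (Y : 'M[R]_(p, n)) (l r : nat).

Definition cusum Y l r : 'cV[R]_p :=
  Num.sqrt (r%:R / (2 * sigma ^+ 2)) *:
    (r%:R^-1 *: (\sum_(t < n | (l <= t.+1 <= l + r - 1)%N) col t Y) -
     r%:R^-1 *: (\sum_(t < n | (l - r <= t.+1 <= l - 1)%N) col t Y)).

Definition dense_test Y l r : Prop :=
  euclidean_norm (cusum Y l r) ^+ 2 - p%:R >
    4 * (Num.sqrt (p%:R * ln (2 * n%:R / (r%:R * delta))) +
         ln (2 * n%:R / (r%:R * delta))).

Definition normal_tail (x : R) : R := fine (normal_prob 0 1 `]x, +oo[).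

Definition binomial_quantile (a : R) (p0 : nat) (q0 : R) : R :=
  inf [set u : R |
         fine (binomial_prob p0 q0 [set k : nat | u < k%:R]) <= a].

Definition exceedances Y (x : R) l r : nat :=
  #|[pred i : 'I_p | x < `|cusum Y l r i 0|]|.

Definition bj_level (x r : nat) : R :=
  6 * delta * r%:R / (pi ^+ 2 * x%:R ^+ 2 * (size (locations n r))%:R * n%:R).

Definition berk_jones_test Y l r : Prop :=
  exists2 x : nat, (1 <= x)%N &
    (exceedances Y x%:R l r)%:R >
      binomial_quantile (bj_level x r) p (2 * normal_tail x%:R).

Definition ordered_abs (v : 'cV[R]_p) : seq R :=
  sort (fun a b => b <= a) [seq `|v i 0| | i <- enum 'I_p].

(* The sparsities s are the powers [2 ^ j], j <= |_log_2 p_|. *)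
Definition partial_norm_test Y l r : Prop :=
  exists2 j : nat, (j <= trunc_log 2 p)%N &
    let s := (2 ^ j)%N in
    \sum_(i < s) nth 0 (ordered_abs (cusum Y l r)) i ^+ 2 >
      4 * s%:R * ln (2 * expR 1 * p%:R / s%:R) +
      4 * ln (n%:R / (r%:R * delta)).

Definition combined_test Y l r : Prop :=
  [\/ dense_test Y l r, berk_jones_test Y l r | partial_norm_test Y l r].

Definition window l r : set R :=
  `[l%:R - r%:R + 1, l%:R + r%:R - 1]%classic.

(* [U] stands for the union of the S_{r'} over the smaller scales r' < r. *)
Definition selected Y r (U : set R) : set nat :=
  [set l | [/\ l \in locations n r, combined_test Y l r &
               window l r `&` U = set0]].

(* The union of the S_r over the scales r = 2 ^ i, i < j. *)
Fixpoint covered Y (j : nat) : set R :=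
  if j is i.+1 then
    covered Y i `|`
      \bigcup_(l in selected Y (2 ^ i) (covered Y i)) window l (2 ^ i)
  else set0.

(* The sets C_1, ..., C_{\hat K}, as a (finite) set of sets; hence indices k'
   of estimated change-points correspond to members C of this set. *)
Definition estimated_components Y : set (set R) :=
  let U := covered Y (scale_count n) in connected_component U @` U.

Definition midpoint (C : set R) : R := (inf C + sup C) / 2.

End Procedure.

Section Criteria.
Context {R : realType}.

Definition no_spurious (n K : nat) (tau : nat -> nat) (Cs : set (set R)) :
    Prop :=
  if K == 0%N then Cs = set0
  else
    (forall k, (1 <= k <= K)%N ->
       is_subset1 [set C | Cs C /\
         midpoint C \in
           `[(tau k)%:R - ((tau k)%:R - (tau k.-1)%:R) / 2,
             (tau k)%:R + ((tau k.+1)%:R - (tau k)%:R) / 2]]) /\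
    (forall C, Cs C ->
       midpoint C \in
         `[(tau 1)%:R - ((tau 1)%:R - 1) / 2,
           (tau K)%:R + (n%:R + 1 - (tau K)%:R) / 2]).

(* It is +oo when [Cs] is empty. *)
Definition localization_error (Cs : set (set R)) (t : nat) : \bar R :=
  ereal_inf [set (`|midpoint C - t%:R|)%:E | C in Cs].

End Criteria.

(* Main.v *)
Require Import Defs.
From HB Require Import structures.
From mathcomp Require Import all_boot all_order all_algebra.
From mathcomp Require Import all_classical all_reals all_analysis.
From mathcomp Require Import measurable_realfun lra.
From mathcomp Require Import ring zify.

Set Implicit Arguments.
Unset Strict Implicit.
Unset Printing Implicit Defensive.

Import Order.TTheory GRing.Theory Num.Theory.
Import numFieldNormedType.Exports.

Local Open Scope classical_set_scope.
Local Open Scope ring_scope.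

(** The estimator is a function of the finitely many test outcomes over the grid,
so the geometry of the windows can be separated from the probability of two
bad events.

Geometry.  Suppose that no test fires on a window that misses every
change-point.  Each selected window, hence each component of the covered set,
then contains a change-point.  A component is a closed interval, so if its
midpoint lies in the cell of tau_k it contains tau_k itself; two components
with midpoints in the same cell therefore coincide, which is (NoSp)
([no_spurious_of]).  Suppose moreover that a test of scale r fires on a window
around tau_k and that 4 (r - 1) is smaller than the distance from tau_k to the
other change-points.  Either that window is selected, or it meets a selected
window of a smaller scale, which contains a change-point that can only be
tau_k.  In both cases some window of scale r' <= r around tau_k is selected.
The selected windows around tau_k all have scale r' and are separated from all
the others, so the component of tau_k stays within 2 (r' - 1) of tau_k and its
midpoint within r' - 1 ([localization]).

False alarms.  A CUSUM statistic is its mean plus a standard Gaussian vector,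
because the weights of the observations have unit Euclidean norm.  Where the
mean of the observations is constant, the levels of the three tests follow
from the Laurent-Massart inequality ([null_dense]), from the definition of
binomial quantiles ([null_bj]), and from a Chernoff bound with a union over
the subsets of coordinates ([null_partial]).  There are at most 2 n / r
locations of scale r, and the sum over the grid is at most (29 / 6) delta
([false_alarms]).

Detection.  For a high-energy change-point put rho = max(r*, 1) and
L = log(n / (rho delta)).  A dyadic scale r of the order of rho and a location
at distance less than r / 2 from tau_k give a CUSUM whose mean has squared norm
at least rho Delta^2 / (64 sigma^2).  By [combined_power] the test misses it
with probability at most exp(-L) = rho delta / n <= r_k delta / n.  Since the
r_k sum up to at most n, all the misses together cost delta.  As
29 / 6 + 1 < 6, the bound 1 - 6 delta is strict.

Power of the combined test.  With s nonzero means and y = sqrt(p L) / s, the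
energy is at least a large multiple of s log(1 + y) + L.  If y <= 1, this
exceeds sqrt(p L) + L and the dense test fires.  If log(1 + y) is at least
log(2 e p / s) / 4, it exceeds s log(2 e p / s) + L and the partial norm test
fires on the support.  Otherwise let X = 8 sqrt(log(2 e p / s)).  If the
coordinates above X carry enough energy, the partial norm test fires on them.
If not, decompose the energy of the others over the integer levels x: if at
every x the number of coordinates above 2 x were too small for the Berk-Jones
test, summing these numbers against x would contradict the lower bound on the
energy, because the Gaussian factors exp(- x^2 / 4) are summable and
L log(2 e p / s)^2 is at most a multiple of s in this regime. *)

(** * Affine images of Lebesgue measure and of the normal law *)

Section LebesgueAffine.
Context {R : realType}.
Notation leb := (@lebesgue_measure R).

Lemma measurable_affine (m t : R) : measurable_fun setT (fun x : R => m + t * x).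
Proof. by apply: measurable_funD => //; exact: measurable_funM. Qed.

(** Both sides are measures that agree on half-open intervals, and these determine
Lebesgue measure. *)
Lemma lebesgue_affine (m t : R) (A : set (measurableTypeR R)) : t != 0 ->
  measurable A -> leb A = (`|t|%:E * leb ((fun x : R => m + t * x)%R @^-1` A))%E.
Proof.
move=> t0 mA.
pose f := (fun x : R => m + t * x)%R : measurableTypeR R -> measurableTypeR R.
have mf : measurable_fun setT f by exact: measurable_affine.

pose mu0 := mscale (NngNum (normr_ge0 t)) (pushforward leb f) : {measure set (measurableTypeR R) -> \bar R}.
pose mu' := mu0 mf.
have -> : leb A = mu' A; last by rewrite /mu' /mu0 /mscale /=.
apply: lebesgue_measure_unique => // _ [[a b] _ <-].
change (leb `]a, b] = (`|t|%:E * leb (f @^-1` `]a, b]))%E).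
have [tp|tn|t00] := ltgtP 0 t.
- have -> : f @^-1` `]a, b] = `](a - m)/t, (b - m)/t]%classic.
    by apply/seteqP; split => x /=; rewrite !in_itv /f /= ltr_pdivrMr// ler_pdivlMr// ltrBlDl lerBrDl (mulrC x).
  rewrite !lebesgue_measure_itv/= !lte_fin ltr_pM2r ?invr_gt0// ltrD2r.
  case: ifP; last by rewrite mule0.
  by rewrite gtr0_norm// -!EFinB -EFinM => _; congr EFin; field.
- have -> : f @^-1` `]a, b] = `[(b - m)/t, (a - m)/t[%classic.
    by apply/seteqP; split => x /=; rewrite !in_itv /f /= ler_ndivrMr// ltr_ndivlMr// lerBrDl ltrBlDl (mulrC x) andbC.
  rewrite !lebesgue_measure_itv/= !lte_fin ltr_nM2r ?invr_lt0// ltrD2r.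
  case: ifP; last by rewrite mule0.
  by rewrite ltr0_norm// -!EFinB -EFinM => _; congr EFin; field.
- by rewrite -t00 eqxx in t0.
Qed.

Lemma integral_affine (m t : R) (f : R -> \bar R) : t != 0 ->
  measurable_fun setT f -> (forall x, (0 <= f x)%E) ->
  (\int[leb]_z f z = `|t|%:E * \int[leb]_x f (m + t * x)%R)%E.
Proof.
move=> t0 mf f0.
pose g := (fun x : R => m + t * x)%R : measurableTypeR R -> measurableTypeR R.
have mg : measurable_fun setT g by exact: measurable_affine.

pose mu0 := mscale (NngNum (normr_ge0 t)) (pushforward leb g) : {measure set (measurableTypeR R) -> \bar R}.
pose mu' := mu0 mg.
transitivity (\int[mu']_z f z)%E.
  apply: eq_measure_integral => A mA _.
  change (leb A = (`|t|%:E * leb (g @^-1` A))%E); exact: (lebesgue_affine m t0 mA).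
rewrite /mu' /mu0 ge0_integral_mscale//= ge0_integral_pushforward//=.
Qed.

(** The density is the Radon-Nikodym derivative of the law almost everywhere, which
turns the change of variables for dominated measures into this formula. *)
Lemma integral_normal_prob (m s : R) (f : R -> \bar R) :
  measurable_fun setT f -> (forall x, (0 <= f x)%E) ->
  (\int[normal_prob m s]_x f x = \int[leb]_x (f x * (normal_pdf m s x)%:E))%E.
Proof.
move=> mf f0.
have dom := @normal_prob_dominates R m s.
rewrite -(Radon_Nikodym_SigmaFinite.change_of_variables dom) //.
apply: ae_eq_integral => //.
- apply: emeasurable_funM => //.
  exact: measurable_int (Radon_Nikodym_SigmaFinite.f_integrable dom).
- by apply: emeasurable_funM => //; apply/measurable_EFinP; exact: measurable_normal_pdf.
- apply: ae_eqe_mul2l; apply: integral_ae_eq => //.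
  + exact: Radon_Nikodym_SigmaFinite.f_integrable.
  + by apply/measurable_EFinP; exact: measurable_normal_pdf.
  + by move=> A _ mA; rewrite -Radon_Nikodym_SigmaFinite.f_integral.
Qed.

End LebesgueAffine.

Section NormalLaw.
Context {R : realType}.
Notation leb := (@lebesgue_measure R).
Notation N01 := (@normal_prob R 0 1).

Lemma normal_probE (m s : R) (D : set R) : measurable D ->
  normal_prob m s D = (\int[leb]_x ((\1_D x)%:E * (normal_pdf m s x)%:E))%E.
Proof.
move=> mD; rewrite -integral_normal_prob ?integral_indic ?setIT//.
  by apply/measurable_EFinP; exact: measurable_indic.
Qed.

Lemma normal_pdf_affine (m t x : R) : t != 0 ->
  `|t| * normal_pdf m `|t| (m + t * x) = normal_pdf 0 1 x.
Proof.
move=> t0; have nt0 : `|t| != 0 by rewrite normr_eq0.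
rewrite !normal_pdfE ?oner_eq0// mulrA; congr (_ * _).
  rewrite /normal_peak -(mulrnAr _ pi) sqrtrM ?sqr_ge0// sqrtr_sqr normr_id.
  by rewrite expr1n mul1r invfM mulrA divff// mul1r.
rewrite /normal_fun; congr expR.
rewrite real_normK ?num_real// subr0 expr1n; field.
by rewrite t0.
Qed.

Lemma normal_prob_affine (m t : R) (D : set R) : t != 0 -> measurable D ->
  N01 ((fun x => m + t * x) @^-1` D) = normal_prob m `|t| D.
Proof.
move=> t0 mD.
have mE : measurable ((fun x => m + t * x) @^-1` D).
  by rewrite -[_ @^-1` _]setTI; exact: (measurable_affine m t).
rewrite (normal_probE 0 1 mE) (normal_probE m `|t| mD).
apply: etrans (esym (integral_affine m t0 _ _)).
- rewrite -ge0_integralZl//.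
  + apply: eq_integral => x _; by rewrite [RHS]muleCA -[X in _ = (_ * X)%E]EFinM normal_pdf_affine.
  + apply: emeasurable_funM; apply/measurable_EFinP.
      apply: (@measurableT_comp _ _ _ _ _ _ (\1_D : R -> R)) => //; exact: measurable_affine.
    by apply: measurableT_comp; [exact: measurable_normal_pdf|exact: measurable_affine].
  + by move=> x _; rewrite mule_ge0// lee_fin ?normal_pdf_ge0.
- apply: emeasurable_funM; apply/measurable_EFinP; first exact: measurable_indic.
  exact: measurable_normal_pdf.
- by move=> x; rewrite mule_ge0// lee_fin normal_pdf_ge0.
Qed.

(** Completing the square in x: the joint density of a standard x and of an
N(s x, t^2) variable z is the marginal density of z times the conditional
density of x given z. *)
Lemma normal_pdf_mul (s t x z : R) : t != 0 ->
  normal_pdf (s * x) `|t| z * normal_pdf 0 1 x =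
  normal_pdf 0 (Num.sqrt (s ^+ 2 + t ^+ 2)) z *
  normal_pdf (s * z / (s ^+ 2 + t ^+ 2)) (`|t| / Num.sqrt (s ^+ 2 + t ^+ 2)) x.
Proof.
move=> t0; have nt0 : `|t| != 0 by rewrite normr_eq0.
have q0 : 0 < s ^+ 2 + t ^+ 2.
  by rewrite ltr_wpDl ?sqr_ge0// exprn_even_gt0.
set q := s ^+ 2 + t ^+ 2 in q0 *.
have r0 : Num.sqrt q != 0 by rewrite gt_eqF// sqrtr_gt0.
rewrite !normal_pdfE ?oner_eq0 ?mulf_neq0 ?invr_eq0//.
rewrite mulrACA [RHS]mulrACA; congr (_ * _).
  rewrite /normal_peak -!(mulrnAr _ pi) !(sqrtrM (pi *+ 2)) ?sqr_ge0// !sqrtr_sqr.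
  rewrite normr_id normr1 mul1r normrM normfV normr_id (ger0_norm (sqrtr_ge0 _)).
  field; rewrite nt0 r0 /= gt_eqF// sqrtr_gt0 mulrn_wgt0//; exact: pi_gt0.
rewrite /normal_fun -!expRD; congr expR.
rewrite expr_div_n real_normK ?num_real// sqr_sqrtr ?ltW// expr1n !subr0.
have qE : q = s ^+ 2 + t ^+ 2 by [].
rewrite qE; field.
by rewrite t0 -qE gt_eqF.
Qed.

Lemma normal_pdf_center (m s x : R) : s != 0 ->
  normal_pdf m s x = normal_pdf 0 s (x - m).
Proof. by move=> s0; rewrite !normal_pdfE// /normal_fun subr0. Qed.

(** Integrating [normal_pdf_mul] over x by Fubini leaves the marginal density of z.
The hypothesis on t is what gives z a density. *)
Lemma normal_convolution (s t : R) (D : set R) : t != 0 -> measurable D ->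
  (N01 \x N01)%E [set xy | D (s * xy.1 + t * xy.2)] =
  normal_prob 0 (Num.sqrt (s ^+ 2 + t ^+ 2)) D.
Proof.
move=> t0 mD; have nt0 : `|t| != 0 by rewrite normr_eq0.
set r := Num.sqrt _.
have -> : (N01 \x N01)%E [set xy | D (s * xy.1 + t * xy.2)] =
    (\int[N01]_x normal_prob (s * x) `|t| D)%E.
  rewrite /product_measure1; apply: eq_integral => x _ /=.
  rewrite -normal_prob_affine//; congr (N01 _).
  by apply/seteqP; split=> y /=; rewrite /xsection /= inE.
have m2 : measurable_fun setT (fun xz : R * R => (\1_D xz.2 * normal_pdf (s * xz.1) `|t| xz.2)).
  apply: measurable_funM.
    by apply: (@measurableT_comp _ _ _ _ _ _ (\1_D : R -> R)) => //.
  rewrite [X in measurable_fun _ X](_ : _ = normal_pdf 0 `|t| \o (fun xz : R * R => xz.2 - s * xz.1)).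
    apply: measurableT_comp; first exact: measurable_normal_pdf.
    by apply: measurable_funB => //; exact: measurable_funM.
  by apply/funext => xz /=; rewrite normal_pdf_center.
have m2' : measurable_fun setT (fun xz : R * R => ((\1_D xz.2 * normal_pdf (s * xz.1) `|t| xz.2) * normal_pdf 0 1 xz.1)%:E).
  apply/measurable_EFinP; apply: measurable_funM => //.
  by apply: measurableT_comp => //; exact: measurable_normal_pdf.
have ge0 (xz : R * R) : (0 <= ((\1_D xz.2 * normal_pdf (s * xz.1) `|t| xz.2) * normal_pdf 0 1 xz.1)%:E)%E.
  by rewrite lee_fin !mulr_ge0 ?normal_pdf_ge0.
transitivity (\int[leb]_x \int[leb]_z ((\1_D z * normal_pdf (s * x) `|t| z) * normal_pdf 0 1 x)%:E)%E.
  have mF : measurable_fun setT (fun x => normal_prob (s * x) `|t| D).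
    under eq_fun do rewrite normal_probE//.
    under eq_fun do under eq_integral do rewrite -EFinM.
    apply: (@measurable_fun_fubini_tonelli_F _ _ _ _ R leb (fun xz : R * R => (\1_D xz.2 * normal_pdf (s * xz.1) `|t| xz.2)%:E)).
      by apply/measurable_EFinP.
    by move=> xz; rewrite lee_fin mulr_ge0 ?normal_pdf_ge0.
  rewrite integral_normal_prob//.
  apply: eq_integral => x _; rewrite normal_probE// -ge0_integralZr//.
  - apply: emeasurable_funM; apply/measurable_EFinP; first exact: measurable_indic.
    exact: measurable_normal_pdf.
  - by move=> z _; rewrite mule_ge0// lee_fin normal_pdf_ge0.
  - by rewrite lee_fin normal_pdf_ge0.
etransitivity; first exact: (fubini_tonelli (m1 := leb) (m2 := leb) _ m2' ge0).
rewrite normal_probE//; apply: eq_integral => z _.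
under eq_integral do rewrite /= -mulrA normal_pdf_mul// mulrA EFinM.
rewrite ge0_integralZl// ?integral_normal_pdf ?mule1//.
- by apply/measurable_EFinP; exact: measurable_normal_pdf.
- by move=> x _; rewrite lee_fin normal_pdf_ge0.
- by rewrite lee_fin mulr_ge0// normal_pdf_ge0.
Qed.

(** The degenerate coefficients are included, so that sums of Gaussian variables can
be built one term at a time. *)
Lemma normal_linear_law (s t : R) (D : set R) : measurable D ->
  (N01 \x N01)%E [set xy | D (s * xy.1 + t * xy.2)] =
  N01 [set x | D (Num.sqrt (s ^+ 2 + t ^+ 2) * x)].
Proof.
move=> mD.
have aff0 u : u != 0 -> N01 [set x | D (u * x)] = normal_prob 0 `|u| D.
  move=> u0; rewrite -(normal_prob_affine _ u0)//; congr (N01 _).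
  by apply/seteqP; split=> x /=; rewrite add0r.
have [->|t0] := eqVneq t 0; last first.
  have q0 : Num.sqrt (s ^+ 2 + t ^+ 2) != 0.
    by rewrite gt_eqF// sqrtr_gt0 ltr_wpDl ?sqr_ge0// exprn_even_gt0.
  by rewrite (normal_convolution s t0 mD) (aff0 _ q0) (ger0_norm (sqrtr_ge0 _)).
rewrite expr0n addr0 sqrtr_sqr.
have mE : measurable [set x | D (s * x)].
  rewrite (_ : [set _ | _] = (fun x => 0 + s * x) @^-1` D); last first.
    by apply/seteqP; split=> x /=; rewrite add0r.
  by rewrite -[_ @^-1` _]setTI; exact: (measurable_affine 0 s).
rewrite (_ : [set xy : R * R | _] = [set x | D (s * x)] `*` setT); last first.
  by apply/seteqP; split=> -[x y] /=; rewrite mul0r addr0; [by []|by case].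
rewrite product_measure1E//= probability_setT mule1.
have [->|s0] := eqVneq s 0; first by rewrite normr0.
by rewrite !aff0 ?normr_eq0 ?normr_id.
Qed.

End NormalLaw.

(** * Independent standard Gaussian variables *)

(** Rectangles form a pi-system that generates the product sigma-algebra. *)
Lemma measure_unique_prod d1 d2 (T1 : measurableType d1) (T2 : measurableType d2)
    (R : realType) (m1 m2 : {measure set (T1 * T2) -> \bar R}) :
  (m1 setT < +oo)%E ->
  (forall A B, measurable A -> measurable B -> m1 (A `*` B) = m2 (A `*` B)) ->
  forall X : set (T1 * T2), measurable X -> m1 X = m2 X.
Proof.
move=> m1oo m12 X mX.
pose C : set (set (T1 * T2)) :=
  [set A `*` B | A in measurable & B in measurable].
apply: (measure_unique C (fun=> setT)) => //.
- by rewrite measurable_prod_measurableType.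
- move=> _ _ [A1 mA1 [B1 mB1 <-]] [A2 mA2 [B2 mB2 <-]]; rewrite -setXI.
  by exists (A1 `&` A2); [exact: measurableI|exists (B1 `&` B2); [exact: measurableI|]].
- by move=> _; exists setT => //; exists setT => //; rewrite setXTT.
- by rewrite bigcup_const//; exists 0%N.
- by move=> _ [A mA [B mB <-]]; exact: m12.
Qed.

Lemma measurable_preim d1 d2 (T1 : measurableType d1) (T2 : measurableType d2)
    (f : T1 -> T2) C : measurable_fun setT f -> measurable C ->
  measurable (f @^-1` C).
Proof. by move=> mf mC; rewrite -[_ @^-1` _]setTI; exact: mf. Qed.

Section Independence.
Context {R : realType} d (T : measurableType d) (P : probability T R).
Context (I : finType) (X : I -> T -> R).
Hypothesis mX : forall i, measurable_fun setT (X i).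
Notation N01 := (@normal_prob R 0 1).
Notation g := (fun B : set R => fine (N01 B)).

Definition rect (J : {set I}) (B : I -> set R) : set T :=
  [set w | forall i, i \in J -> B i (X i w)].

Lemma measurable_rect J B : (forall i, measurable (B i)) -> measurable (rect J B).
Proof.
move=> mB; apply: fin_bigcap_measurable => [|i _]; last exact: measurable_preim.
exact: finite_finset.
Qed.

(** On the event E, the variable Y has the law of k under Q and is independent of
the standard Gaussian variables X_j, j in J.  Writing the law of Y as an image
of an auxiliary probability Q allows Q to grow by one normal factor at each
step. *)
Definition indep_of d' (T' : measurableType d') (E : set T) (Y : T -> R)
    (Q : probability T' R) (k : T' -> R) (J : {set I}) : Prop :=
  forall C B, measurable C -> (forall i, measurable (B i)) ->
  P (E `&` Y @^-1` C `&` rect J B) =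
  (P E * Q (k @^-1` C) * (\prod_(i in J) g (B i))%:E)%E.

(** One of the remaining variables X_i is merged into Y.  The pair (Y, X_i) has a
product law on the event in question by uniqueness of product measures, and the
law of h (Y, X_i) is an image of it. *)
Lemma indep_of_merge d' (T' : measurableType d') (E : set T) (Y : T -> R)
    (Q : probability T' R) (k : T' -> R) (J : {set I}) (i : I) (h : R * R -> R) :
  measurable E -> measurable_fun setT Y -> measurable_fun setT k ->
  measurable_fun setT h -> i \in J ->
  indep_of E Y Q k J ->
  indep_of E (fun w => h (Y w, X i w)) (Q \x N01)%E
    (fun zx => h (k zx.1, zx.2)) (J :\ i).
Proof.
move=> mE mY mk mh iJ ind C B mC mB.
have mE' : measurable (E `&` rect (J :\ i) B).
  by apply: measurableI => //; exact: measurable_rect.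
have mYX : measurable_fun setT (fun w => (Y w, X i w)) by exact: measurable_fun_pair.
have mkx : measurable_fun setT (fun zx : T' * R => (k zx.1, zx.2)).
  by apply: measurable_fun_pair => //; exact: measurableT_comp.
pose c := fine (P E) * \prod_(j in J :\ i) g (B j).
have c0 : 0 <= c.
  by rewrite mulr_ge0 ?fine_ge0//; apply: prodr_ge0 => j _; rewrite fine_ge0.
(* c is the mass of the variables left aside; m1 and m2 are the two candidate
   joint laws of (Y, X_i) on the event E /\ rect *)
pose m1 := pushforward (mrestr P mE') (fun w => (Y w, X i w)) : {measure set (R * R) -> \bar R}.
pose m2 := mscale (NngNum c0) (pushforward (Q \x N01)%E (fun zx : T' * R => (k zx.1, zx.2))) : {measure set (R * R) -> \bar R}.
have m12 A : measurable A -> m1 mYX A = m2 mkx A.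
  apply: measure_unique_prod.
    rewrite /m1 /pushforward /= /mrestr (le_lt_trans (probability_le1 _ _)) ?ltry//.
    by apply: measurableI => //; exact: (measurable_preim mYX).
  move=> A1 A2 mA1 mA2.
  change (P ((fun w => (Y w, X i w)) @^-1` (A1 `*` A2) `&` (E `&` rect (J :\ i) B)) =
    c%:E * (Q \x N01) ((fun zx : T' * R => (k zx.1, zx.2)) @^-1` (A1 `*` A2)))%E.
  pose B' j := if j == i then A2 else B j.
  have mB' j : measurable (B' j) by rewrite /B'; case: ifP.
  rewrite [X in P X](_ : _ = E `&` Y @^-1` A1 `&` rect J B'); last first.
    apply/seteqP; split => w /=.
      move=> [[Yw Xw] [Ew rw]]; split => // j jJ; rewrite /B'.
      by case: eqVneq => [->//|ji]; apply: rw; rewrite !inE ji.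
    move=> [[Ew Yw] rw]; split; last split => //.
      by split => //; have := rw i iJ; rewrite /B' eqxx.
    by move=> j; rewrite !inE => /andP[ji jJ]; have := rw j jJ; rewrite /B' (negbTE ji).
  rewrite ind// (big_setD1 i)//= {1}/B' eqxx.
  have -> : \prod_(j in J :\ i) fine (N01 (B' j)) = \prod_(j in J :\ i) fine (N01 (B j)).
    by apply: eq_bigr => j; rewrite !inE => /andP[ji _]; rewrite /B' (negbTE ji).
  rewrite (_ : _ @^-1` _ = (k @^-1` A1) `*` A2)//.
  rewrite product_measure1E//; last exact: measurable_preim.
  rewrite -(fineK (fin_num_measure P _ mE)).
  rewrite -(fineK (fin_num_measure Q _ (measurable_preim mk mA1))).
  rewrite -[X in _ = (c%:E * (X * _))%E]fineK ?(fin_num_measure Q)//;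
    last exact: measurable_preim.
  rewrite -[X in _ = (c%:E * (_ * X))%E]fineK ?(fin_num_measure N01)//.
  rewrite -!EFinM; congr EFin.
  by rewrite /c /=; ring.
have : (P ((fun w => (Y w, X i w)) @^-1` (h @^-1` C) `&` (E `&` rect (J :\ i) B)) =
    c%:E * (Q \x N01) ((fun zx : T' * R => (k zx.1, zx.2)) @^-1` (h @^-1` C)))%E.
  exact: m12 _ (measurable_preim mh mC).
rewrite [X in P X](_ : _ = E `&` (fun w => h (Y w, X i w)) @^-1` C `&` rect (J :\ i) B); last first.
  by rewrite setIC -!setIA; congr (_ `&` _); rewrite setIC.
move=> ->; rewrite /c EFinM fineK ?fin_num_measure//.
by rewrite -!muleA; congr (_ * _)%E; rewrite muleC.
Qed.
End Independence.

Section GaussianFamily.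
Context {R : realType} d (T : measurableType d) (P : probability T R).
Notation N01 := (@normal_prob R 0 1).
Notation g := (fun B : set R => fine (N01 B)).

Lemma rect_setT (I : finType) (X : I -> T -> R) (J : {set I}) :
  rect X J (fun=> setT) = setT.
Proof. by apply/seteqP; split. Qed.

Lemma prod_setT (I : finType) (J : {set I}) :
  \prod_(i in J) g ((fun=> setT) i) = 1.
Proof. by rewrite big1// => i _; rewrite probability_setT. Qed.

(** The product rule on full rectangles suffices: rectangles over a subfamily are
obtained with the whole line for the other coordinates. *)
Definition std_gaussian (I : finType) (X : I -> T -> R) : Prop :=
  (forall i, measurable_fun setT (X i)) /\
  forall B, (forall i, measurable (B i)) ->
    P (rect X [set: I]%SET B) = (\prod_i g (B i))%:E.

Section LinearForm.
Context (I : finType) (X : I -> T -> R).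
Hypothesis mX : forall i, measurable_fun setT (X i).

Lemma measurable_linear_form (s : seq I) (a : I -> R) :
  measurable_fun setT (fun w => \sum_(i <- s) a i * X i w).
Proof. by apply: measurable_sum => i; exact: measurable_funM. Qed.

(** The terms are merged one by one; [normal_linear_law] keeps track of the
variance. *)
Lemma indep_of_linear_form (s : seq I) (a : I -> R) (E : set T) (J : {set I}) :
  measurable E -> uniq s -> {subset s <= J} ->
  (forall B, (forall i, measurable (B i)) ->
    P (E `&` rect X J B) = (P E * (\prod_(i in J) g (B i))%:E)%E) ->
  indep_of P X E (fun w => \sum_(i <- s) a i * X i w) N01
    (fun z => Num.sqrt (\sum_(i <- s) a i ^+ 2) * z) (J :\: [set i in s]).
Proof.
move=> mE + + indJ; elim: s => [_ _|i s IH /= /andP[nis us] sJ].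
  move=> C B mC mB; rewrite (_ : _ :\: _ = J); last first.
    by apply/setP => j; rewrite !inE.
  have [C0|C0] := pselect (C 0).
    rewrite (_ : _ @^-1` C = setT); last first.
      by apply/seteqP; split=> // w _ /=; rewrite big_nil.
    rewrite (_ : _ @^-1` C = setT); last first.
      by apply/seteqP; split=> // w _ /=; rewrite big_nil sqrtr0 mul0r.
    by rewrite setIT probability_setT mule1 indJ.
  rewrite (_ : _ @^-1` C = set0); last first.
    by apply/seteqP; split=> // w /=; rewrite big_nil.
  rewrite (_ : _ @^-1` C = set0); last first.
    by apply/seteqP; split=> // w /=; rewrite big_nil sqrtr0 mul0r.
  by rewrite setI0 set0I !measure0 mule0 mul0e.
have iJ' : i \in J :\: [set i in s] by rewrite !inE nis sJ// mem_head.
have {}IH := IH us (fun j js => sJ j (@mem_behead _ (i :: s) j js)).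
have mh : measurable_fun setT (fun yx : R * R => a i * yx.2 + yx.1).
  by apply: measurable_funD => //; exact: measurable_funM.
have mk : measurable_fun setT (fun z : R => Num.sqrt (\sum_(j <- s) a j ^+ 2) * z).
  exact: measurable_funM.
have ind := indep_of_merge (Q := N01) mX mE (measurable_linear_form s a) mk mh iJ' IH.
move=> C B mC mB.
rewrite (_ : _ :\: _ = (J :\: [set i in s]) :\ i); last first.
  by apply/setP => j; rewrite !inE negb_or andbA.
under [in LHS]eq_fun do rewrite big_cons.
rewrite ind//; congr (_ * _ * _)%E.
rewrite big_cons.
have q0 : 0 <= \sum_(j <- s) a j ^+ 2 by apply: sumr_ge0 => j _; exact: sqr_ge0.
have := normal_linear_law (Num.sqrt (\sum_(j <- s) a j ^+ 2)) (a i) mC.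
rewrite sqr_sqrtr// [\sum_(j <- s) _ + _]addrC => E1; apply: etrans E1; congr ((_ \x _)%E _).
by apply/seteqP; split => zx /=; rewrite addrC.
Qed.
End LinearForm.

(** The rows are treated one after the other: the event E s fixes the outcome of
the rows already treated, while the entries in J s are still free.  A linear
form with unit norm of the entries of the next row is standard normal and
independent of both. *)
Lemma std_gaussian_rows p n (X : 'I_p * 'I_n -> T -> R) (a : 'I_n -> R) :
  std_gaussian X -> \sum_t a t ^+ 2 = 1 ->
  std_gaussian (fun i w => \sum_t a t * X (i, t) w).
Proof.
move=> [mX indX] a1.
pose Z i w := \sum_t a t * X (i, t) w.
have mZ i : measurable_fun setT (Z i).
  by apply: measurable_sum => t; exact: measurable_funM.
split=> // B mB.
pose J (s : seq 'I_p) := [set it : 'I_p * 'I_n | it.1 \notin s]%SET.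
pose E (s : seq 'I_p) : set T := [set w | forall i, i \in s -> B i (Z i w)].
have mE s : measurable (E s).
  rewrite (_ : E s = \bigcap_(i in [set i | i \in s]) (Z i @^-1` B i))//.
  apply: fin_bigcap_measurable => [|i _]; last exact: measurable_preim.
  exact: finite_finset.
have PE s : uniq s -> forall C, (forall it, measurable (C it)) ->
    P (E s `&` rect X (J s) C) =
    ((\prod_(i <- s) g (B i))%:E * (\prod_(it in J s) g (C it))%:E)%E.
  elim: s => [_|i s IH /= /andP[nis us]] C mC.
    rewrite big_nil mul1e (_ : E [::] = setT); last by apply/seteqP; split.
    have JT : J [::] = [set: 'I_p * 'I_n]%SET by apply/setP => it; rewrite !inE.
    rewrite setTI JT indX//; congr EFin.
    by apply: eq_bigl => it; rewrite inE.
  have {}IH := IH us.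
  have PEs : P (E s) = (\prod_(i <- s) g (B i))%:E.
    have := IH (fun=> setT) (fun=> measurableT).
    by rewrite rect_setT// setIT prod_setT mule1.
  pose r := [seq (i, t) | t <- enum 'I_n].
  have ur : uniq r by rewrite map_inj_uniq ?enum_uniq// => t t' [].
  have rJ : {subset r <= J s} by move=> it /mapP[t _ ->]; rewrite inE.
  have := @indep_of_linear_form _ X mX r (fun it => a it.2) (E s) (J s) (mE s) ur rJ.
  move=> /(_ _)/(_ (B i) C (mB i) mC).
  rewrite (_ : J s :\: _ = J (i :: s)); last first.
    apply/setP => -[j t]; rewrite !inE /= negb_or; congr (_ && _); congr negb.
    apply/mapP/idP => [[t' _ [-> _]]|/eqP ->]; first by rewrite eqxx.
    by exists t => //; rewrite mem_enum.
  rewrite (_ : _ `&` _ = E (i :: s) `&` rect X (J (i :: s)) C); last first.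
    congr (_ `&` _); apply/seteqP; split => w /=.
      move=> [Es Bi] j; rewrite inE => /orP[/eqP ->|/Es//].
      by move: Bi; rewrite /Z big_map big_enum.
    move=> Eis; split; first by move=> j js; apply: Eis; rewrite inE js orbT.
    by rewrite big_map big_enum; apply: Eis; rewrite mem_head.
  move=> ->; last by move=> C' mC'; rewrite IH// PEs.
  rewrite PEs big_map big_enum/= a1 sqrtr1 big_cons; congr (_ * _)%E.
  rewrite [X in N01 X](_ : _ = B i); last by apply/seteqP; split => z /=; rewrite mul1r.
  have FN : N01 (B i) \is a fin_num by exact: (fin_num_measure N01 _ (mB i)).
  by rewrite EFinM (fineK FN) muleC.
have := PE (enum 'I_p) (enum_uniq _) (fun=> setT) (fun=> measurableT).
rewrite rect_setT// setIT prod_setT mule1 big_enum/= => PEE.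
rewrite -PEE; congr (P _).
by apply/seteqP; split => w /= h i _; apply: h; rewrite ?inE ?mem_enum.
Qed.

Section ExpectationProduct.
Context (I : finType) (X : I -> T -> R).
Hypothesis indX : std_gaussian X.

(** Stated as an inequality for nonnegative functions, as needed for exponential
moments.  The partial product is merged with one variable at a time, and the
double integral is split by Fubini. *)
Lemma expectation_prod (f : I -> R -> R) (m : I -> R) :
  (forall i, measurable_fun setT (f i)) -> (forall i x, 0 <= f i x) ->
  (forall i, (\int[N01]_x (f i x)%:E <= (m i)%:E)%E) ->
  (\int[P]_w (\prod_i f i (X i w))%:E <= (\prod_i m i)%:E)%E.
Proof.
have [mX indX'] := indX.
move=> mf f0 fm.
have m0 i : 0 <= m i.
  by rewrite -lee_fin; apply: le_trans (fm i); apply: integral_ge0 => x _; rewrite lee_fin.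
pose Y (s : seq I) w := \prod_(i <- s) f i (X i w).
have mY s : measurable_fun setT (Y s).
  by apply: measurable_prod => i _; exact: measurableT_comp.
have Y0 s w : 0 <= Y s w by apply: prodr_ge0.
have main s : uniq s -> indep_of P X setT (Y s) P (Y s) (~: [set i in s])%SET /\
    (\int[P]_w (Y s w)%:E <= (\prod_(i <- s) m i)%:E)%E.
  elim: s => [_|i s IH /= /andP[nis /IH [ind ints]]].
    split; last first.
      under eq_integral do rewrite /Y big_nil.
      by rewrite big_nil integral_cst// mul1e; exact: probability_le1.
    move=> C B mC mB; rewrite (_ : (~: _)%SET = [set: I]%SET); last first.
      by apply/setP => i; rewrite !inE.
    rewrite probability_setT mul1e setTI.
    have [C1|C1] := pselect (C 1).
      rewrite (_ : _ @^-1` C = setT); last first.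
        by apply/seteqP; split=> // w _ /=; rewrite /Y big_nil.
      rewrite setTI probability_setT mul1e indX'//; congr EFin.
      by apply: eq_bigl => i; rewrite inE.
    rewrite (_ : _ @^-1` C = set0); last first.
      by apply/seteqP; split=> // w /=; rewrite /Y big_nil.
    by rewrite set0I !measure0 mul0e.
  have mh : measurable_fun setT (fun yx : R * R => f i yx.2 * yx.1).
    by apply: measurable_funM => //; exact: measurableT_comp.
  have iJ : i \in (~: [set i in s])%SET by rewrite !inE.
  have ind' := indep_of_merge mX measurableT (mY s) (mY s) mh iJ ind.
  have YE : Y (i :: s) = (fun w => f i (X i w) * Y s w).
    by apply/funext => w; rewrite /Y big_cons.
  pose H := (fun zx : T * R => f i zx.2 * Y s zx.1).
  have mH : measurable_fun setT H.
    by apply: measurable_funM => //; exact: measurableT_comp.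
  have law C : measurable C -> P (Y (i :: s) @^-1` C) = (P \x N01)%E (H @^-1` C).
    move=> mC; have := ind' C (fun=> setT) mC (fun=> measurableT).
    rewrite rect_setT// setIT prod_setT mule1 setTI probability_setT mul1e => <-.
    by rewrite YE.
  split.
    move=> C B mC mB.
    rewrite (_ : (~: _)%SET = (~: [set i in s] :\ i)%SET); last first.
      by apply/setP => j; rewrite !inE negb_or.
    rewrite {1}YE ind'//; congr (_ * _ * _)%E.
    by apply/esym; exact: law.
  have -> : (\int[P]_w (Y (i :: s) w)%:E = \int[(P \x N01)%E]_zx (H zx)%:E)%E.
    pose mu1 := pushforward P (Y (i :: s)) : {measure set R -> \bar R}.
    pose mu2 := pushforward (P \x N01)%E H : {measure set R -> \bar R}.
    have mabs : measurable_fun setT (fun y : R => `|y|%:E).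
      by apply/measurable_EFinP; exact: measurableT_comp (@normr_measurable _ _) (@measurable_id _ _ _).
    (* the absolute value makes the integrand nonnegative on the whole line *)
    transitivity (\int[mu1 (mY (i :: s))]_y `|y|%:E)%E.
      rewrite ge0_integral_pushforward//=.
      by apply: eq_integral => w _ /=; rewrite ger0_norm.
    transitivity (\int[mu2 mH]_y `|y|%:E)%E.
      by apply: eq_measure_integral => A mA _; exact: law.
    rewrite ge0_integral_pushforward//=.
    by apply: eq_integral => w _ /=; rewrite ger0_norm// mulr_ge0.
  rewrite fubini_tonelli1//; last 2 first.
    by apply/measurable_EFinP.
    by move=> x; rewrite lee_fin mulr_ge0.
  rewrite /fubini_F /=.
  apply: (@le_trans _ _ (\int[P]_w ((m i)%:E * (Y s w)%:E))%E).
    apply: ge0_le_integral => //.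
    - by move=> w _; apply: integral_ge0 => x _; rewrite lee_fin mulr_ge0.
    - apply: (@measurable_fun_fubini_tonelli_F _ _ _ _ R N01 (fun zx => (H zx)%:E)).
        exact/measurable_EFinP.
      by move=> zx; rewrite lee_fin mulr_ge0.
    - by apply: emeasurable_funM => //; apply/measurable_EFinP.
    move=> w _; rewrite /H /=; under eq_integral do rewrite EFinM.
    rewrite ge0_integralZr//.
    - by apply: lee_wpmul2r; rewrite ?lee_fin//; exact: fm.
    - by apply/measurable_EFinP; exact: mf.
    - by move=> x _; rewrite lee_fin.
    - by rewrite lee_fin.
  rewrite ge0_integralZl//; last 3 first.
  - exact/measurable_EFinP.
  - by move=> w _; rewrite lee_fin.
  - by rewrite lee_fin.
  by rewrite big_cons EFinM; apply: lee_wpmul2l => //; rewrite lee_fin.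
have [_] := main (enum I) (enum_uniq _).
rewrite big_enum/=; apply: le_trans.
by under eq_integral do rewrite -big_enum/=.
Qed.

End ExpectationProduct.
End GaussianFamily.

(** * Moments and tails of the normal law *)

Section GaussianMoments.
Context {R : realType}.
Notation leb := (@lebesgue_measure R).
Notation N01 := (@normal_prob R 0 1).

(** Completing the square: the integrand times the standard density is a multiple
of the density of a normal law with variance 1 / (1 + 2 lam). *)
Lemma gauss_square_mgf (lam u : R) : 0 < 1 + 2 * lam ->
  (\int[N01]_x (expR (- lam * (u + x) ^+ 2))%:E =
   ((Num.sqrt (1 + 2 * lam))^-1 * expR (- (lam * u ^+ 2 / (1 + 2 * lam))))%:E)%E.
Proof.
move=> q0; set q := 1 + 2 * lam in q0 *.
have r0 : Num.sqrt q != 0 by rewrite gt_eqF// sqrtr_gt0.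
have mE : measurable_fun setT (fun x : R => expR (- lam * (u + x) ^+ 2)).
  apply: measurableT_comp => //; apply: measurable_funM => //.
  by apply: measurable_funX; exact: measurable_funD.
have mE' : measurable_fun setT (fun x : R => (expR (- lam * (u + x) ^+ 2))%:E).
  exact/measurable_EFinP.
rewrite (integral_normal_prob 0 1 mE'); last by move=> x; rewrite lee_fin expR_ge0.
set c := (Num.sqrt q)^-1 * _.
transitivity (\int[leb]_x (c%:E * (normal_pdf (- (2 * lam * u / q)) (Num.sqrt q)^-1 x)%:E))%E; last first.
  rewrite ge0_integralZl// ?integral_normal_pdf ?mule1//.
  - by apply/measurable_EFinP; exact: measurable_normal_pdf.
  - by move=> x _; rewrite lee_fin normal_pdf_ge0.
  - by rewrite lee_fin mulr_ge0 ?expR_ge0// invr_ge0 sqrtr_ge0.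
apply: eq_integral => x _; rewrite -!EFinM; congr EFin.
rewrite !normal_pdfE ?oner_eq0 ?invr_eq0// /c mulrCA [RHS]mulrACA; congr (_ * _).
  rewrite /normal_peak -!(mulrnAr _ pi) !(sqrtrM (pi *+ 2)) ?sqr_ge0// !sqrtr_sqr.
  by rewrite normr1 mul1r normfV ger0_norm ?sqrtr_ge0// invfM invrK mulrA mulVf ?mul1r.
rewrite /normal_fun -!expRD; congr expR.
rewrite exprVn sqr_sqrtr ?ltW// expr1n subr0.
have qE : q = 1 + 2 * lam by [].
rewrite qE; field.
by rewrite -qE gt_eqF.
Qed.

Lemma fine_N01_le (A B : set R) : measurable A -> measurable B -> A `<=` B ->
  fine (N01 A) <= fine (N01 B).
Proof.
move=> mA mB AB; rewrite fine_le ?fin_num_measure//.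
by apply: le_measure; rewrite ?inE.
Qed.

Lemma fine_N01_ge0 (A : set R) : 0 <= fine (N01 A).
Proof. by rewrite fine_ge0. Qed.

Lemma fine_N01_le1 (A : set R) : measurable A -> fine (N01 A) <= 1.
Proof.
move=> mA; rewrite -[leRHS]/(fine 1%E) fine_le ?fin_num_measure//.
exact: probability_le1.
Qed.

Lemma fine_N01U (A B : set R) : measurable A -> measurable B ->
  A `&` B = set0 -> fine (N01 (A `|` B)) = fine (N01 A) + fine (N01 B).
Proof.
by move=> mA mB AB; rewrite measureU// fineD ?fin_num_measure.
Qed.

Lemma fine_N01_opp (A : set R) : measurable A ->
  fine (N01 (-%R @^-1` A)) = fine (N01 A).
Proof.
move=> mA; congr fine.
have := @normal_prob_affine R 0 (-1) A; rewrite normrN1 => <- //.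
  by congr (N01 _); apply/seteqP; split=> x /=; rewrite add0r mulN1r.
Qed.

Lemma normal_tailN (x : R) : fine (N01 `]-oo, x[) = normal_tail (- x).
Proof.
rewrite /normal_tail -fine_N01_opp//; congr (fine (N01 _)).
by apply/seteqP; split=> y /=; rewrite !in_itv /= andbT ltrNl.
Qed.

Lemma normal_tail_ge0 (x : R) : 0 <= normal_tail x. Proof. exact: fine_N01_ge0. Qed.

Lemma normal_tail_le (x y : R) : x <= y -> normal_tail y <= normal_tail x.
Proof.
move=> xy; apply: fine_N01_le => // z /=; rewrite !in_itv /= !andbT.
exact: le_lt_trans.
Qed.

Lemma two_sidedE (u x : R) : 0 <= x ->
  fine (N01 [set z | x < `|u + z|]) = normal_tail (x - u) + normal_tail (x + u).
Proof.
move=> x0; rewrite (_ : [set z | _] = `]x - u, +oo[ `|` `]-oo, - x - u[); last first.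
  apply/seteqP; split => z /=; rewrite !in_itv /= andbT real_ltr_normr ?num_real//.
    by move=> /orP[h|h]; [left|right]; lra.
  by move=> h; apply/orP; case: h => h; [left|right]; lra.
have dis : `]x - u, +oo[ `&` `]-oo, - x - u[ = set0 :> set R.
  by apply/seteqP; split => z //=; rewrite !in_itv /= andbT => -[h1 h2]; lra.
rewrite (fine_N01U (measurable_itv _) (measurable_itv _) dis) (normal_tailN (- x - u)) (_ : - (- x - u) = x + u); first by [].
by rewrite opprB opprK addrC.
Qed.

(** Reflecting the interval to the right of x onto the interval to its left only
increases the density. *)
Lemma normal_tail_convex (x u : R) : 0 <= x -> 0 <= u ->
  2 * normal_tail x <= normal_tail (x - u) + normal_tail (x + u).
Proof.
move=> x0 u0.
have split1 a b : a <= b -> normal_tail a = fine (N01 `]a, b]) + normal_tail b.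
  move=> ab; rewrite /normal_tail -fine_N01U//.
    congr (fine (N01 _)); apply/seteqP; split => z /=; rewrite !in_itv /= !andbT.
      by move=> az; case: (leP z b) => zb; [left|right]; rewrite ?az.
    by move=> [/andP[]//|]; apply: le_lt_trans.
  by apply/seteqP; split => z //=; rewrite !in_itv /= andbT => -[/andP[_ h1] h2]; lra.
rewrite (split1 (x - u) x) ?(split1 x (x + u)); [|lra|lra].
suff h : fine (N01 `]x, (x + u)]) <= fine (N01 `](x - u), x]) by lra.
have N0 : N01 [set (x - u)] = 0%E.
  have /null_content_dominatesP := @normal_prob_dominates R 0 1.
  by apply => //; exact: lebesgue_measure_set1.
have -> : fine (N01 `](x - u), x]) = fine (N01 ([set (x - u)] `|` `](x - u), x])).
  rewrite fine_N01U// ?N0 ?add0r//.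
  by apply/seteqP; split => z //=; rewrite !in_itv /= => -[-> /andP[h1 h2]]; lra.
rewrite fine_le ?fin_num_measure//; first exact: measurableU.
apply: (@le_trans _ _ (N01 `[(x - u), x[)); last first.
  apply: le_measure; rewrite ?inE//; first exact: measurableU.
  move=> z /=; rewrite !in_itv /= => /andP[h1 h2].
  by move: h1; rewrite le_eqVlt => /orP[/eqP ->|->]; [left|right; rewrite ltW].
have mf (a : set R) : measurable a ->
    measurable_fun setT (fun z : R => ((\1_a z)%:E * (normal_pdf 0 1 z)%:E)%E).
  move=> ma; apply: emeasurable_funM; apply/measurable_EFinP => //.
  exact: measurable_normal_pdf.
have f0 (a : set R) z : (0 <= (\1_a z)%:E * (normal_pdf 0 1 z)%:E :> \bar R)%E.
  by rewrite -EFinM lee_fin mulr_ge0// normal_pdf_ge0.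
have m1 : (-1 : R) != 0 by rewrite oppr_eq0 oner_eq0.
rewrite !normal_probE// (integral_affine (2 * x) m1 (mf _ _))// normrN1 mul1e.
apply: ge0_le_integral => //.
- by have := measurableT_comp (mf `]x, (x + u)]%classic (measurable_itv _)) (measurable_affine (2 * x) (-1)).
- exact: mf.
move=> z _; rewrite -!EFinM lee_fin !indicE.
rewrite [_ \in `[(x - u), x[%classic](_ : _ = (2 * x + -1 * z \in `]x, (x + u)]%classic)); last first.
  by apply/idP/idP; rewrite !inE /= !in_itv /= => /andP[h1 h2]; apply/andP; split; lra.
have [|_] := boolP (_ \in _); last by rewrite !mul0r.
rewrite inE /= in_itv /= => /andP[h1 h2]; rewrite !mul1r.
rewrite !normal_pdfE ?oner_eq0//; apply: ler_wpM2l; first exact: normal_peak_ge0.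
rewrite /normal_fun ler_expR !subr0 expr1n.
rewrite ler_pM2r ?invr_gt0//; nra.
Qed.

(** A shift never makes a symmetric exceedance less likely. *)
Lemma two_sided_mono (u x : R) : 0 <= x ->
  2 * normal_tail x <= fine (N01 [set z | x < `|u + z|]).
Proof.
move=> x0; rewrite two_sidedE//.
have [u0|u0] := leP 0 u; first exact: normal_tail_convex.
have := @normal_tail_convex x (- u) x0; rewrite opprK oppr_ge0 => /(_ (ltW u0)).
lra.
Qed.

Lemma two_sided0 (x : R) : 0 <= x -> fine (N01 [set z | x < `|z|]) = 2 * normal_tail x.
Proof.
move=> x0; have := two_sidedE 0 x0; rewrite subr0 addr0.
under eq_set do rewrite add0r.
by move=> ->; lra.
Qed.

(** On the half-line, the standard density is at most exp(- x^2 / 2) times the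
density shifted by x. *)
Lemma normal_tail_chernoff (x : R) : 0 <= x -> normal_tail x <= expR (- (x ^+ 2 / 2)).
Proof.
move=> x0; have mray : measurable (`]x, +oo[ : set R) by [].
have -> : expR (- (x ^+ 2 / 2)) = fine ((expR (- (x ^+ 2 / 2)))%:E) by [].
have mf : measurable_fun setT (fun z : R => ((\1_(`]x, +oo[ : set R) z)%:E * (normal_pdf 0 1 z)%:E)%E).
  apply: emeasurable_funM; apply/measurable_EFinP => //.
  exact: measurable_normal_pdf.
have mp : measurable_fun setT (fun z : R => (normal_pdf x 1 z)%:E).
  by apply/measurable_EFinP; exact: measurable_normal_pdf.
rewrite /normal_tail fine_le ?fin_num_measure// normal_probE//.
apply: (@le_trans _ _ (\int[leb]_z ((expR (- (x ^+ 2 / 2)))%:E * (normal_pdf x 1 z)%:E))%E).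
  apply: ge0_le_integral => //.
  - by move=> z _; rewrite -EFinM lee_fin mulr_ge0// normal_pdf_ge0.
  - by apply: emeasurable_funM.
  move=> z _; rewrite -!EFinM lee_fin indicE.
  case: (boolP (_ \in _)) => [|_]; last by rewrite mul0r mulr_ge0 ?expR_ge0 ?normal_pdf_ge0.
  rewrite inE /= in_itv /= andbT mul1r => xz.
  rewrite !normal_pdfE ?oner_eq0// mulrCA; apply: ler_wpM2l; first exact: normal_peak_ge0.
  rewrite /normal_fun -expRD ler_expR expr1n subr0; nra.
rewrite ge0_integralZl// ?integral_normal_pdf ?mule1//.
- by move=> z _; rewrite lee_fin normal_pdf_ge0.
Qed.

Lemma expRN1_ge : 1 / 3 <= expR (-1) :> R.
Proof.
have -> : -1 = 8%:R * (- (1 / 8)) :> R by lra.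
rewrite expRM_natl.
have := @expR_ge1Dx R (- (1 / 8)) => h.
apply: (@le_trans _ _ ((7 / 8) ^+ 8)); last by rewrite ler_pXn2r ?nnegrE ?expR_ge0//; lra.
rewrite !exprS expr0; lra.
Qed.

(** The density at 1, hence on the whole interval, is at least 1 / 5: pi < 4 and
exp(-1) >= 1 / 3. *)
Lemma N01_center : 2 / 5 <= fine (N01 `]-1, 1]).
Proof.
have pi4 : pi < 4 :> R by have := @pihalf_lt2 R; lra.
have pi0 : 0 < pi :> R := pi_gt0 R.
have h : 1 / 5 <= normal_pdf 0 1 (1 : R).
  rewrite normal_pdfE ?oner_eq0//.
  have p0 : 0 <= normal_peak (1 : R) * normal_fun 0 1 (1 : R).
    by rewrite mulr_ge0 ?normal_peak_ge0 ?normal_fun_ge0.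
  have h15 : 0 <= 1 / 5 :> R by lra.
  rewrite -ler_sqr ?nnegrE//.
  rewrite [in leRHS]exprMn /normal_peak [in leRHS]exprVn sqr_sqrtr; last by rewrite mulrn_wge0// mulr_ge0 ?sqr_ge0// ltW.
  rewrite /normal_fun -expRM_natl.
  rewrite (_ : 2%:R * _ = -1); last by rewrite subr0 !expr1n; lra.
  rewrite expr1n mul1r mulr2n [leRHS]mulrC ler_pdivlMr; last by lra.
  have := expRN1_ge; lra.
have -> : 2 / 5 = fine (((2 / 5)%:E : \bar R)) by [].
rewrite fine_le ?fin_num_measure// normal_probE//.
have mI : measurable (`]-1, 1] : set R) by [].
apply: (@le_trans _ _ (\int[leb]_z ((1 / 5)%:E * (\1_(`]-1, 1] : set R) z)%:E))%E).
  rewrite ge0_integralZl//; try by [apply/measurable_EFinP|rewrite lee_fin; lra].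
  rewrite integral_indic//= setIT lebesgue_measure_itv /= lte_fin.
  rewrite (_ : -1 < 1 = true); last by apply/idP; lra.
  rewrite -EFinB -EFinM lee_fin; lra.
apply: ge0_le_integral => //.
- apply: emeasurable_funM => //; exact/measurable_EFinP.
- apply: emeasurable_funM; apply/measurable_EFinP => //; exact: measurable_normal_pdf.
move=> z _; rewrite -!EFinM lee_fin indicE [leLHS]mulrC.
case: (boolP (_ \in _)) => [|_]; last by rewrite !mul0r.
rewrite inE /= in_itv /= => /andP[z1 z2]; rewrite mul1r [leRHS]mul1r.
apply: (le_trans h); rewrite !normal_pdfE ?oner_eq0//.
apply: ler_wpM2l; first exact: normal_peak_ge0.
rewrite /normal_fun ler_expR expr1n !subr0; nra.
Qed.

(** By [N01_center], the half-line above -1 has mass at least 7 / 10, and it is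
contained in the exceedance set up to a reflection, while twice the tail at
x >= 1 is at most 6 / 10. *)
Lemma two_sided_shift (u x : R) : 1 <= x -> 2 * x <= `|u| ->
  2 * normal_tail x + 1 / 10 <= fine (N01 [set z | x < `|u + z|]).
Proof.
move=> x1 xu; rewrite two_sidedE//; last by lra.
have m0 : measurable (`]-oo, -1] : set R) by [].
have m1 : measurable (`]-1, 1] : set R) by [].
have m2 : measurable (`]1, +oo[ : set R) by [].
have E : fine (N01 `]-oo, -1]) + fine (N01 `]-1, 1]) + normal_tail 1 = 1.
  have d1 : `]-oo, -1] `&` `]-1, 1] = set0 :> set R.
    by apply/seteqP; split => z //=; rewrite !in_itv /=; lra.
  have d2 : (`]-oo, -1] `|` `]-1, 1]) `&` `]1, +oo[ = set0 :> set R.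
    by apply/seteqP; split => z //=; rewrite !in_itv /= andbT => -[[h|/andP[h1 h2]] h3]; lra.
  have m01 : measurable (`]-oo, -1] `|` `]-1, 1] : set R) by exact: measurableU.
  rewrite /normal_tail -(fine_N01U m0 m1 d1) -(fine_N01U m01 m2 d2).
  rewrite (_ : _ `|` _ = setT) ?probability_setT//.
  apply/seteqP; split => // z _ /=; rewrite !in_itv /= andbT.
  case: (leP z (-1)) => ?; first by left; left.
  by case: (leP z 1) => ?; [left; right|right].
have E2 : normal_tail (-1) = fine (N01 `]-1, 1]) + normal_tail 1.
  have d1 : `]-1, 1] `&` `]1, +oo[ = set0 :> set R.
    by apply/seteqP; split => z //=; rewrite !in_itv /= andbT => -[/andP[h1 h2] h3]; lra.
  rewrite /normal_tail -(fine_N01U m1 m2 d1).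
  congr (fine (N01 _)); apply/seteqP; split => z /=; rewrite !in_itv /= !andbT.
    by move=> ->; case: (leP z 1) => ?; [left|right].
  by move=> [/andP[]//|]; lra.
have E3 : normal_tail 1 <= fine (N01 `]-oo, -1]).
  rewrite -[1 in leLHS]opprK -normal_tailN; apply: fine_N01_le => //.
  by move=> z /=; rewrite !in_itv /=; lra.
have C := N01_center.
have G1 : normal_tail x <= normal_tail 1 by exact: normal_tail_le.
have G2 := normal_tail_ge0.
have [u0|u0] := leP 0 u.
  have : normal_tail (-1) <= normal_tail (x - u) by apply: normal_tail_le; move: xu; rewrite ger0_norm; lra.
  have := G2 (x + u); lra.
have : normal_tail (-1) <= normal_tail (x + u) by apply: normal_tail_le; move: xu; rewrite ltr0_norm; lra.
have := G2 (x - u); lra.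
Qed.

Lemma two_normal_tail_le1 (x : R) : 0 <= x -> 2 * normal_tail x <= 1.
Proof.
move=> x0; rewrite -two_sided0//; apply: fine_N01_le1.
rewrite (_ : [set z | _] = (fun z : R => `|z|) @^-1` `]x, +oo[); last first.
  by apply/seteqP; split => z /=; rewrite in_itv /= andbT.
by rewrite -[_ @^-1` _]setTI; exact: normr_measurable.
Qed.

(** From exp(- x) >= 1 - x. *)
Lemma expR_le_quad (x : R) : x <= 1 / 2 -> expR x <= 1 + x + 2 * x ^+ 2.
Proof.
move=> x2; have := @expR_ge1Dx R (- x); rewrite expRN => h.
have e0 := expR_gt0 x.
have : (1 - x) * expR x <= 1 by rewrite -ler_pdivlMr// div1r.
nra.
Qed.

Lemma bernoulli_mgf (A : set R) (l : R) : measurable A -> l <= 1 / 2 ->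
  (\int[N01]_x (expR (l * \1_A x))%:E <=
   (expR (fine (N01 A) * (l + 2 * l ^+ 2)))%:E)%E.
Proof.
move=> mA l2; set q := fine (N01 A).
have q0 : 0 <= q := fine_N01_ge0 A.
have mC : measurable (~` A) by exact: measurableC.
have -> : (\int[N01]_x (expR (l * \1_A x))%:E = (1 + q * (expR l - 1))%:E)%E.
  transitivity (\int[N01]_x ((expR l)%:E * (\1_A x)%:E + (\1_(~` A) x)%:E))%E.
    apply: eq_integral => x _; rewrite -EFinM -EFinD; congr EFin.
    rewrite !indicE in_setC; case: (x \in A) => /=.
      by rewrite !mulr1 addr0.
    by rewrite !mulr0 expR0 add0r.
  rewrite ge0_integralD//; try by [apply/measurable_EFinP|
    move=> x _; rewrite -EFinM lee_fin mulr_ge0// expR_ge0|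
    apply: emeasurable_funM => //; exact/measurable_EFinP].
  rewrite ge0_integralZl//; try by [apply/measurable_EFinP|rewrite lee_fin expR_ge0].
  rewrite !integral_indic// !setIT.
  transitivity ((expR l)%:E * q%:E + (1 - q)%:E)%E.
    congr (_ * _ + _)%E; first by rewrite fineK// (fin_num_measure N01).
    by apply: etrans (probability_setC N01 mA) _; rewrite EFinB fineK// (fin_num_measure N01).
  by rewrite -EFinM -EFinD; congr EFin; ring.
rewrite lee_fin; apply: le_trans (expR_ge1Dx _).
rewrite lerD2l ler_wpM2l//; have := expR_le_quad l2; lra.
Qed.

End GaussianMoments.

(** * Scalar inequalities *)

Section ScalarInequalities.
Context {R : realType}.
Implicit Types x y z w : R.

(** The difference vanishes at 0 and its derivative is 2 cosh - 2. *)
Lemma two_le_sinh z : 0 <= z -> 2 * z <= expR z - expR (- z).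
Proof.
move=> z0; pose f x : R := expR x - expR (- x) - 2 * x.
have df x : is_derive x 1 f (expR x + expR (- x) - 2).
  rewrite /f; apply: is_derive_eq; rewrite !scaler1 /GRing.scale /=; ring.
have cf : continuous f.
  move=> x; apply: differentiable_continuous; apply/derivable1_diffP.
  by have [] := df x.
have [c _] := MVT_segment z0 (fun x _ => df x) (continuous_subspaceT cf).
rewrite /f oppr0 expR0 mulr0 !subr0 subrr subr0 => E.
suff : 0 <= expR c + expR (- c) - 2 by nra.
rewrite expRN; have c0 := expR_gt0 c.
have : expR c * (expR c)^-1 = 1 by rewrite divff// gt_eqF.
have : 0 < (expR c)^-1 by rewrite invr_gt0.
set a := expR c in c0 *; set b := a^-1 => b0 ab.
have := sqr_ge0 (a - b); nra.
Qed.

Lemma le_expR_half w : 1 <= w -> w <= expR ((w - w^-1) / 2).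
Proof.
move=> w1; have w0 : 0 < w by lra.
have := two_le_sinh (ln_ge0 w1); rewrite expRN lnK ?posrE// => h.
by rewrite -[leLHS]lnK ?posrE// ler_expR; lra.
Qed.

Lemma sqrtV_le x : 0 <= x -> (Num.sqrt (1 + 2 * x))^-1 <= expR (- x + 2 * x ^+ 2).
Proof.
move=> x0; have q0 : 0 < 1 + 2 * x by lra.
rewrite -ler_sqr ?nnegrE ?invr_ge0 ?sqrtr_ge0 ?expR_ge0//.
rewrite exprVn sqr_sqrtr; last exact: ltW.
rewrite -expRM_natl.
apply: le_trans (expR_ge1Dx _); rewrite -div1r ler_pdivrMr//; nra.
Qed.

Lemma ln_ge x : 0 < x -> 1 - x^-1 <= ln x.
Proof.
move=> x0; have := @le_ln1Dx R (x^-1 - 1).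
have -> : 1 + (x^-1 - 1) = x^-1 by ring.
rewrite lnV ?posrE//; have : 0 < x^-1 by rewrite invr_gt0.
move=> h /(_ _); lra.
Qed.

Lemma ln2_ge : 1 / 2 <= ln 2 :> R.
Proof. by have := @ln_ge 2 ltac:(by []); lra. Qed.

Lemma sin_le x : 0 <= x -> sin x <= x.
Proof.
move=> x0.
have [c _] := MVT_segment x0 (fun x _ => is_derive_sin x)
  (continuous_subspaceT (@continuous_sin R)).
rewrite sin0 !subr0 => ->; have := cos_le1 c; nra.
Qed.

Lemma sin_ge_oppr x : 0 <= x -> - x <= sin x.
Proof.
move=> x0.
have [c _] := MVT_segment x0 (fun x _ => is_derive_sin x)
  (continuous_subspaceT (@continuous_sin R)).
rewrite sin0 !subr0 => ->; have := cos_geN1 c; nra.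
Qed.

Lemma cos_ge x : 0 <= x -> 1 - x ^+ 2 / 2 <= cos x.
Proof.
move=> x0; have -> : cos x = 1 - 2 * sin (x / 2) ^+ 2.
  have := cosD (x / 2) (x / 2); rewrite -splitr -!expr2 => ->; have := cos2Dsin2 (x / 2); lra.
have h1 : sin (x / 2) <= x / 2 by apply: sin_le; lra.
have h2 : - (x / 2) <= sin (x / 2) by apply: sin_ge_oppr; lra.
have : sin (x / 2) ^+ 2 <= (x / 2) ^+ 2 by nra.
nra.
Qed.

(** If pi < 3, the cosine would be smaller at 3 / 2 than at pi / 2, while
cos(3 / 2) = 2 cos(3 / 4)^2 - 1 is positive by a quadratic bound. *)
Lemma pi_ge3 : 3 <= pi :> R.
Proof.
rewrite leNgt; apply/negP => pi3.
have p2 := @pi_ge2 R.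
have c1 : 23 / 32 <= cos (3 / 4) :> R.
  by apply: le_trans (cos_ge _); lra.
have c2 : 0 < cos (3 / 2) :> R.
  have -> : 3 / 2 = 3 / 4 + 3 / 4 :> R by lra.
  rewrite cosD -!expr2; have := cos2Dsin2 (3 / 4 : R); nra.
have : cos (3 / 2) < cos (pi / 2) :> R.
  by rewrite ltr_cos ?in_itv /=; apply/andP || idtac; lra.
rewrite cos_pihalf; lra.
Qed.

Lemma exprn_le_fact_expR (n : nat) x : 0 <= x -> x ^+ n <= n`!%:R * expR x.
Proof.
case: n => [|n] x0; first by rewrite expr0 mul1r -expR0 ler_expR.
have := expR_ge1Dxn n x0.
rewrite -ler_pdivrMl ?ltr0n ?fact_gt0//; lra.
Qed.

(** This is the bound (e n / k)^k on the binomial coefficient, from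
k^k <= k! e^k. *)
Lemma bin_le_expR (n k : nat) : (0 < k <= n)%N ->
  'C(n, k)%:R <= expR (k%:R * (1 + ln (n%:R / k%:R))) :> R.
Proof.
move=> /andP[k0 kn].
have k0' : 0 < k%:R :> R by rewrite ltr0n.
have n0' : 0 < n%:R :> R by rewrite ltr0n (leq_trans k0).
rewrite mulrDr mulr1 expRD expRM_natl lnK ?posrE ?divr_gt0// expr_div_n.
have h := @exprn_le_fact_expR k k%:R (ltW k0').
have f0 : 0 < k`!%:R :> R by rewrite ltr0n fact_gt0.
have kk0 : 0 < k%:R ^+ k :> R by rewrite exprn_gt0.
have nk : 'C(n, k)%:R * k`!%:R <= n%:R ^+ k :> R.
  rewrite -natrM -natrX ler_nat bin_ffact ffact_prod.
  rewrite -[X in (_ <= n ^ X)%N]card_ord -prod_nat_const.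
  by apply: leq_prod => i _; exact: leq_subr.
rewrite mulrA ler_pdivlMr//.
rewrite -(ler_pM2r f0) mulrAC.
apply: (@le_trans _ _ (n%:R ^+ k * k%:R ^+ k)).
  by rewrite ler_pM2r.
rewrite [leRHS](_ : _ = n%:R ^+ k * (k`!%:R * expR k%:R)); last by ring.
by rewrite ler_pM2l// exprn_gt0.
Qed.

(** Comparison with a telescoping sum. *)
Lemma sum_inv_squares N : \sum_(0 <= k < N) (k.+1%:R ^+ 2)^-1 <= 2 :> R.
Proof.
case: N => [|N]; first by rewrite big_geq.
suff h : \sum_(0 <= k < N.+1) (k.+1%:R ^+ 2)^-1 <= 2 - N.+1%:R^-1 :> R.
  by apply: le_trans h _; rewrite gerBl invr_ge0.
elim: N => [|N IH]; first by rewrite big_nat1 expr1n invr1; lra.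
rewrite big_nat_recr //=; apply: le_trans (lerD IH (lexx _)) _.
have a0 : 0 < N.+1%:R :> R by rewrite ltr0n.
have E : N.+2%:R = N.+1%:R + 1 :> R by rewrite natr1.
rewrite E; move: (N.+1%:R) a0 => a a0.
have h : ((a + 1) ^+ 2)^-1 <= a^-1 - (a + 1)^-1.
  rewrite (_ : a^-1 - (a + 1)^-1 = (a * (a + 1))^-1); last by field; lra.
  rewrite lef_pV2 ?posrE ?mulr_gt0 ?exprn_gt0//; nra.
lra.
Qed.

(** The exponent sqrt(M / S) / 2 balances the two terms when S >= M, and 1 / 2 does
otherwise. *)
Lemma chernoff_exponent (S M : R) : 0 <= S -> 0 < M -> exists2 l : R, 0 < l <= 1 / 2 &
  2 * l ^+ 2 * S - l * (3 * Num.sqrt (S * M) + 3 * M) <= - M.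
Proof.
move=> S0 M0; have sM : 0 <= Num.sqrt (S * M) by exact: sqrtr_ge0.
have [MS|SM] := leP M S; last by exists (1 / 2); lra.
have S1 : 0 < S by lra.
pose a := Num.sqrt S; pose b := Num.sqrt M.
have a0 : 0 < a by rewrite sqrtr_gt0.
have b0 : 0 < b by rewrite sqrtr_gt0.
have aE : a ^+ 2 = S by rewrite sqr_sqrtr.
have bE : b ^+ 2 = M by rewrite sqr_sqrtr// ltW.
have ab : b <= a by rewrite /a /b ler_sqrt.
exists (1 / 2 * (b / a)).
  have h1 : b / a <= 1 by rewrite ler_pdivrMr// mul1r.
  have h2 : 0 < b / a by rewrite divr_gt0.
  lra.
rewrite sqrtrM// -/a -/b -{1}aE -bE.
rewrite [X in X <= _](_ : _ = - b ^+ 2 - 3 / 2 * b ^+ 3 / a); last by field; rewrite gt_eqF.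
rewrite gerBl mulr_ge0 ?invr_ge0 ?(ltW a0)// mulr_ge0 ?exprn_ge0 ?(ltW b0)//; lra.
Qed.

End ScalarInequalities.

(** * Concentration for independent Gaussian variables *)

Section Tails.
Context {R : realType} d (T : measurableType d) (P : probability T R).
Notation N01 := (@normal_prob R 0 1).
Context (I : finType) (Z : I -> T -> R).
Hypothesis indZ : std_gaussian P Z.

Let mZ i : measurable_fun setT (Z i). Proof. by have [] := indZ. Qed.

Lemma measurable_fun_sumZ (g : I -> R -> R) :
  (forall i, measurable_fun setT (g i)) ->
  measurable_fun setT (fun w => \sum_i g i (Z i w)).
Proof.
by move=> mg; apply: measurable_sum => i; exact: measurableT_comp.
Qed.

Lemma measurable_ge_fun (f : T -> R) (t : R) :
  measurable_fun setT f -> measurable [set w | t <= f w].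
Proof.
move=> mf; rewrite (_ : [set w | _] = f @^-1` `[t, +oo[); last first.
  by apply/seteqP; split => w /=; rewrite in_itv /= andbT.
exact: measurable_preim.
Qed.

Lemma measurable_le_fun (f : T -> R) (t : R) :
  measurable_fun setT f -> measurable [set w | f w <= t].
Proof.
move=> mf; rewrite (_ : [set w | _] = f @^-1` `]-oo, t]); last first.
  by apply/seteqP; split => w /=; rewrite in_itv /=.
exact: measurable_preim.
Qed.

Lemma measurable_gt_fun (f : T -> R) (t : R) :
  measurable_fun setT f -> measurable [set w | t < f w].
Proof.
move=> mf; rewrite (_ : [set w | _] = f @^-1` `]t, +oo[); last first.
  by apply/seteqP; split => w /=; rewrite in_itv /= andbT.
exact: measurable_preim.
Qed.

(** Markov's inequality for the exponential of the sum. *)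
Lemma chernoff_sum (g : I -> R -> R) (m : I -> R) (t : R) :
  (forall i, measurable_fun setT (g i)) ->
  (forall i, (\int[N01]_x (expR (g i x))%:E <= (m i)%:E)%E) ->
  (P [set w | (t <= \sum_i g i (Z i w))%R] <= (expR (- t) * \prod_i m i)%:E)%E.
Proof.
move=> mg hm.
have ms := measurable_fun_sumZ mg.
have mS := measurable_ge_fun t ms.
have p0 w : 0 <= \prod_i expR (g i (Z i w)) by apply: prodr_ge0 => i _; exact: expR_ge0.
set S := [set w | _] in mS *.
have -> : P S = (\int[P]_w (\1_S w)%:E)%E by rewrite integral_indic ?setIT.
have mexp i : measurable_fun setT (fun x => expR (g i x)) by exact: measurableT_comp.
have mprod : measurable_fun setT (fun w => (\prod_i expR (g i (Z i w)))%:E).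
  by apply/measurable_EFinP; apply: measurable_prod => i _; exact: (measurableT_comp (mexp i) (mZ i)).
apply: (@le_trans _ _ (\int[P]_w ((expR (- t))%:E * (\prod_i expR (g i (Z i w)))%:E))%E).
  apply: ge0_le_integral => //.
  - exact/measurable_EFinP.
  - by apply: emeasurable_funM.
  move=> w _; rewrite indicE; case: (boolP (w \in S)) => [|_]; last first.
    by rewrite -EFinM lee_fin mulr_ge0 ?expR_ge0.
  rewrite inE /S /= => h; rewrite -EFinM lee_fin -expR_sum -expRD -expR0 ler_expR; lra.
rewrite ge0_integralZl//; try by [rewrite lee_fin expR_ge0|
  move=> w _; rewrite lee_fin].
rewrite EFinM; apply: lee_wpmul2l; first by rewrite lee_fin expR_ge0.
by apply: (expectation_prod indZ (f := fun i x => expR (g i x))) => //.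
Qed.

Lemma measurable_sqr_shift (c u : R) :
  measurable_fun setT (fun x : R => c * (u + x) ^+ 2).
Proof.
by apply: measurable_funM => //; apply: measurable_funX; exact: measurable_funD.
Qed.

(** A noncentral chi-square variable. *)
Definition sq_norm (J : {set I}) (u : I -> R) (w : T) : R :=
  \sum_(i in J) (u i + Z i w) ^+ 2.

Lemma sq_norm_chernoff (J : {set I}) (u : I -> R) (lam t : R) : 0 < 1 + 2 * lam ->
  (P [set w | (t <= - lam * sq_norm J u w)%R] <=
    (expR (- t) * \prod_(i in J) ((Num.sqrt (1 + 2 * lam))^-1 *
       expR (- (lam * u i ^+ 2 / (1 + 2 * lam)))))%:E)%E.
Proof.
move=> q0.
pose g i x : R := if i \in J then - lam * (u i + x) ^+ 2 else 0.
pose m i : R := if i \in J then (Num.sqrt (1 + 2 * lam))^-1 *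
       expR (- (lam * u i ^+ 2 / (1 + 2 * lam))) else 1.
have mg i : measurable_fun setT (g i).
  by rewrite /g; case: (i \in J); [exact: measurable_sqr_shift|exact: measurable_cst].
have hm i : (\int[N01]_x (expR (g i x))%:E <= (m i)%:E)%E.
  rewrite /g /m; case: (i \in J); first by rewrite (gauss_square_mgf (u i) q0).
  under eq_integral do rewrite expR0.
  by rewrite integral_cst// mul1e; exact: probability_le1.
have := chernoff_sum t mg hm.
rewrite (_ : [set w | _] = [set w | (t <= - lam * sq_norm J u w)%R]); last first.
  have E w : \sum_i g i (Z i w) = - lam * sq_norm J u w.
    rewrite /sq_norm mulr_sumr [RHS]big_mkcond /=; apply: eq_bigr => i _.
    by rewrite /g; case: ifP.
  by apply: eq_set => w; rewrite E.
by rewrite /m -big_mkcond.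
Qed.

Lemma measurable_sq_norm J u : measurable_fun setT (sq_norm J u).
Proof.
rewrite /sq_norm; under eq_fun do rewrite big_mkcond.
apply: measurable_sum => i; case: (i \in J); last exact: measurable_cst.
by apply: measurable_funX; exact: measurable_funD.
Qed.

(** The dependence on the means survives as a factor exp(- (lam / 2) sum u_i^2),
which is what makes the tests powerful. *)
Lemma sq_norm_lower (J : {set I}) (u : I -> R) (lam A : R) : 0 < lam <= 1 / 2 ->
  (P [set w | (sq_norm J u w <= A)%R] <=
   (expR (lam * A + #|J|%:R * (- lam + 2 * lam ^+ 2)
      - lam / 2 * \sum_(i in J) u i ^+ 2))%:E)%E.
Proof.
move=> /andP[l0 l2]; have q0 : 0 < 1 + 2 * lam by lra.
have := @sq_norm_chernoff J u lam (- lam * A) q0.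
rewrite (_ : [set w | (- lam * A <= _)%R] = [set w | (sq_norm J u w <= A)%R]); last first.
  by apply: eq_set => w; rewrite !mulNr lerN2 ler_pM2l.
move/le_trans; apply; rewrite lee_fin.
rewrite mulNr opprK -addrA expRD ler_pM2l ?expR_gt0//.
rewrite expRD expRM_natl.
apply: (@le_trans _ _ (\prod_(i in J) (expR (- lam + 2 * lam ^+ 2) * expR (- (lam / 2 * u i ^+ 2))))).
  apply: ler_prod => i _; rewrite mulr_ge0 ?invr_ge0 ?sqrtr_ge0 ?expR_ge0//=.
  apply: ler_pM; rewrite ?invr_ge0 ?sqrtr_ge0 ?expR_ge0//.
    by apply: sqrtV_le; exact: ltW.
  rewrite ler_expR lerN2.
  have q1 : 2^-1 <= (1 + 2 * lam)^-1 by rewrite lef_pV2 ?posrE//; lra.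
  have := ler_wpM2l (mulr_ge0 (ltW l0) (sqr_ge0 (u i))) q1; lra.
by rewrite big_split /= prodr_const -expR_sum sumrN -mulr_sumr.
Qed.

(** The exponent 7 / 16 is below 1 / 2, so the moment is finite, but close enough
for the partial norm threshold to beat the number of subsets of a given size. *)
Lemma sq_norm_upper (J : {set I}) (t : R) :
  (P [set w | (t <= sq_norm J (fun=> 0%R) w)%R] <=
   (expR (- (7 / 16 * t)) * Num.sqrt 8 ^+ #|J|)%:E)%E.
Proof.
have q0 : 0 < 1 + 2 * (- (7 / 16)) :> R by lra.
have := @sq_norm_chernoff J (fun=> 0) (- (7 / 16)) (7 / 16 * t) q0.
rewrite (_ : [set w | (7 / 16 * t <= _)%R] = [set w | (t <= sq_norm J (fun=> 0%R) w)%R]); last first.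
  by apply: eq_set => w; rewrite opprK ler_pM2l//; lra.
move/le_trans; apply; rewrite lee_fin.
under eq_bigr do rewrite expr0n mulr0 mul0r oppr0 expR0 mulr1.
rewrite prodr_const (_ : 1 + 2 * - (7 / 16) = 8^-1 :> R); last by lra.
by rewrite sqrtrV// invrK.
Qed.

(** With a = sqrt #|I| and b = sqrt t, the exponent b / (a + 2 b) makes the bound
exact once sqrt W <= exp((W - 1 / W) / 4) is used. *)
Lemma sq_norm_laurent_massart (t : R) : 0 < t -> (0 < #|I|)%N ->
  (P [set w | (#|I|%:R + 2 * Num.sqrt (#|I|%:R * t) + 2 * t <=
      sq_norm [set: I]%SET (fun=> 0) w)%R] <= (expR (- t))%:E)%E.
Proof.
move=> t0 I0; set p := #|I|%:R : R.
have p0 : 0 < p by rewrite ltr0n.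
set a := Num.sqrt p; set b := Num.sqrt t.
have a0 : 0 < a by rewrite sqrtr_gt0.
have b0 : 0 < b by rewrite sqrtr_gt0.
have pa : p = a ^+ 2 by rewrite sqr_sqrtr// ltW.
have tb : t = b ^+ 2 by rewrite sqr_sqrtr// ltW.
rewrite (sqrtrM _ (ltW p0)) -/a -/b.
pose l := b / (a + 2 * b).
have l0 : 0 < l by rewrite divr_gt0//; lra.
have vE : 1 + 2 * - l = a / (a + 2 * b) by rewrite /l; field; lra.
have q0 : 0 < 1 + 2 * - l by rewrite vE divr_gt0//; lra.
have := @sq_norm_chernoff [set: I]%SET (fun=> 0) (- l) (l * (p + 2 * (a * b) + 2 * t)) q0.
rewrite (_ : [set w | (l * _ <= _)%R] = [set w | (p + 2 * (a * b) + 2 * t <= sq_norm [set: I]%SET (fun=> 0%R) w)%R]); last first.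
  by apply: eq_set => w; rewrite opprK ler_pM2l.
move/le_trans; apply; rewrite lee_fin.
under eq_bigr do rewrite expr0n mulr0 mul0r oppr0 expR0 mulr1.
rewrite prodr_const cardsT vE.
set W := (a + 2 * b) / a.
have W1 : 1 <= W by rewrite /W ler_pdivlMr// mul1r; lra.
have -> : a / (a + 2 * b) = W^-1 by rewrite /W invf_div.
rewrite sqrtrV; last by lra.
rewrite invrK.
have sW : Num.sqrt W <= expR ((W - W^-1) / 4).
  rewrite -ler_sqr ?nnegrE ?sqrtr_ge0 ?expR_ge0// sqr_sqrtr; last by lra.
  rewrite -expRM_natl (_ : 2%:R * _ = (W - W^-1) / 2); last by lra.
  exact: le_expR_half.
apply: (@le_trans _ _ (expR (- (l * (p + 2 * (a * b) + 2 * t))) * expR ((W - W^-1) / 4) ^+ #|I|)).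
  by rewrite ler_pM2l ?expR_gt0// lerXn2r ?nnegrE ?sqrtr_ge0 ?expR_ge0.
rewrite -expRM_natl -expRD ler_expR -/p pa tb /l /W le_eqVlt; apply/orP; left.
by apply/eqP; field; rewrite ?gt_eqF//; lra.
Qed.

Definition hit_count (A : I -> set R) (w : T) : R := \sum_i \1_(A i) (Z i w).

Lemma measurable_hit_count (A : I -> set R) : (forall i, measurable (A i)) ->
  measurable_fun setT (hit_count A).
Proof.
by move=> mA; apply: (@measurable_fun_sumZ (fun i => \1_(A i) : R -> R)) => i; exact: measurable_indic.
Qed.

Lemma hit_count_lower (A : I -> set R) (S M : R) : (forall i, measurable (A i)) ->
  0 < M -> S = \sum_i fine (N01 (A i)) ->
  (P [set w | (hit_count A w <= S - 3 * Num.sqrt (S * M) - 3 * M)%R] <= (expR (- M))%:E)%E.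
Proof.
move=> mA M0 SE.
have S0 : 0 <= S by rewrite SE; apply: sumr_ge0 => i _; exact: fine_N01_ge0.
have [l /andP[l0 l2] hl] := chernoff_exponent S0 M0.
set t := S - 3 * Num.sqrt (S * M) - 3 * M.
have mg i : measurable_fun setT (fun x : R => - l * \1_(A i) x : R).
  by apply: measurable_funM => //; exact: measurable_indic.
have hm i : (\int[N01]_x (expR (- l * \1_(A i) x))%:E <=
    (expR (fine (N01 (A i)) * (- l + 2 * (- l) ^+ 2)))%:E)%E.
  by apply: bernoulli_mgf => //; lra.
have := chernoff_sum (- l * t) mg hm.
rewrite (_ : [set w | _] = [set w | (hit_count A w <= t)%R]); last first.
  by apply: eq_set => w; rewrite -mulr_sumr !mulNr lerN2 ler_pM2l.
move/le_trans; apply; rewrite lee_fin -expR_sum -mulr_suml -expRD ler_expR -SE.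
rewrite sqrrN /t; move: hl; lra.
Qed.

End Tails.

(** * Union bound and binomial quantiles *)

Section UnionBound.
Context {R : realType} d (T : measurableType d) (P : probability T R).

Lemma measurable_exists (I : choiceType) (s : seq I) (A : I -> set T) :
  (forall i, i \in s -> measurable (A i)) ->
  measurable [set w | exists2 i, i \in s & A i w].
Proof.
move=> mA; rewrite (_ : [set w | _] = \bigcup_(i in [set i | i \in s]) A i); last first.
  by apply/seteqP; split => w /= [i]; exists i.
apply: fin_bigcup_measurable => //; exact: finite_seq.
Qed.

Lemma union_bound (I : choiceType) (s : seq I) (A : I -> set T) (b : I -> R) :
  (forall i, i \in s -> measurable (A i)) ->
  (forall i, i \in s -> (P (A i) <= (b i)%:E)%E) ->
  (P [set w | exists2 i, i \in s & A i w] <= (\sum_(i <- s) b i)%:E)%E.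
Proof.
elim: s => [|i s IH] mA hb.
  rewrite (_ : [set w | _] = set0) ?measure0 ?big_nil//.
  by apply/seteqP; split => w //= [].
have mA' j : j \in s -> measurable (A j) by move=> js; apply: mA; rewrite inE js orbT.
have hb' j : j \in s -> (P (A j) <= (b j)%:E)%E by move=> js; apply: hb; rewrite inE js orbT.
rewrite (_ : [set w | _] = A i `|` [set w | exists2 i, i \in s & A i w]); last first.
  apply/seteqP; split => w /=.
    by move=> [j]; rewrite inE => /orP[/eqP ->|js Aj]; [left|right; exists j].
  by move=> [Ai|[j js Aj]]; [exists i; rewrite ?mem_head|exists j => //; rewrite inE js orbT].
apply: (le_trans (measureU2 _ _ _)).
- by apply: mA; rewrite mem_head.
- exact: measurable_exists.
- by rewrite big_cons EFinD; apply: leeD; [apply: hb; rewrite mem_head|exact: IH].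
Qed.
End UnionBound.

Section Binomial.
Context {R : realType}.
Implicit Types (q v a M : R) (p : nat).

Lemma binomial_tailE p q v : 0 <= q <= 1 ->
  binomial_prob p q [set k : nat | v < k%:R] =
  (\sum_(k < p.+1 | v < k%:R) q ^+ k * (1 - q) ^+ (p - k) *+ 'C(p, k))%:E.
Proof.
move=> /andP[q0 q1]; rewrite (@binomial_probE _ p q q0 q1) -sumEFin [RHS]big_mkcond/=.
apply: eq_bigr => k _; rewrite diracE /=.
case: ifP => h; first by rewrite mem_set ?mule1.
by rewrite memNset ?mule0//= h.
Qed.

Section Quantile.
Context (p : nat) (q a : R).
Hypothesis a01 : 0 <= a < 1.
Let A := [set u : R | fine (binomial_prob p q [set k : nat | u < k%:R]) <= a].

Let Alb : lbound A 0.
Proof.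
move=> u Au; rewrite leNgt; apply/negP => u0; move: Au; rewrite /A /=.
rewrite (_ : [set k : nat | _] = setT); last first.
  by apply/seteqP; split => // k _ /=; exact: lt_le_trans u0 _.
by rewrite probability_setT /=; case/andP: a01; lra.
Qed.

Lemma binomial_quantile_le v :
  fine (binomial_prob p q [set k : nat | v < k%:R]) <= a ->
  binomial_quantile a p q <= v.
Proof. by move=> h; apply: ge_inf => //; exists 0. Qed.

(** The infimum is attained: the tail only depends on the integer part of the
threshold, so it is the same just to the right of the infimum. *)
Lemma binomial_quantileP : 0 <= q <= 1 ->
  fine (binomial_prob p q [set k : nat | binomial_quantile a p q < k%:R]) <= a.
Proof.
move=> q01.
have hA : has_inf A.
  split; last by exists 0.
  exists p%:R; rewrite /A /= binomial_tailE// big1 /=; first by case/andP: a01.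
  by move=> k; rewrite ltr_nat => /leq_trans/(_ (leq_ord k)); rewrite ltnn.
set Q := binomial_quantile a p q.
have Q0 : 0 <= Q by apply: lb_le_inf => //; exact: hA.1.
pose k0 := (Num.trunc Q).+1.
have Qk0 : Q < k0%:R by rewrite /k0; apply: truncnS_gt.
have [u Au uk0] : exists2 u, A u & u < k0%:R.
  have [u Au] := inf_adherent (eps := k0%:R - Q) ltac:(by rewrite subr_gt0) hA.
  by move=> h; exists u => //; apply: lt_le_trans h _; rewrite addrC subrK.
rewrite (_ : [set k : nat | Q < k%:R] = [set k : nat | u < k%:R])//.
apply/seteqP; split => k /= h; last first.
  by apply: le_lt_trans h; apply: ge_inf => //; exists 0.
have : (Num.trunc Q)%:R < k%:R :> R by apply: le_lt_trans h; have /andP[] := truncn_itv Q0.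
by rewrite ltr_nat => hk; apply: (lt_le_trans uk0); rewrite ler_nat.
Qed.
End Quantile.

(** The binomial theorem gives the exponential moment. *)
Lemma binomial_chernoff p q M : 0 <= q <= 1 -> 0 < M ->
  fine (binomial_prob p q
    [set k : nat | p%:R * q + 3 * Num.sqrt (p%:R * q * M) + 3 * M < k%:R]) <= expR (- M).
Proof.
move=> q01 M0; have /andP[q0 q1] := q01.
rewrite binomial_tailE//=; set S := p%:R * q; set v := S + _ + _.
have S0 : 0 <= S by rewrite mulr_ge0.
have [l /andP[l0 l2] hl] := chernoff_exponent S0 M0.
apply: (@le_trans _ _ (\sum_(k < p.+1) expR (- (l * v)) * ((1 - q) ^+ (p - k) * (q * expR l) ^+ k *+ 'C(p, k)))).
  rewrite big_mkcond; apply: ler_sum => k _.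
  have t0 : 0 <= q ^+ k * (1 - q) ^+ (p - k) *+ 'C(p, k).
    by rewrite mulrn_wge0// mulr_ge0 ?exprn_ge0//; lra.
  rewrite (_ : expR _ * _ = (q ^+ k * (1 - q) ^+ (p - k) *+ 'C(p, k)) * expR (l * (k%:R - v))); last first.
    rewrite mulrBr expRD (mulrC l k%:R) expRM_natl exprMn -[in LHS]mulr_natr -[in RHS]mulr_natr; ring.
  case: ifP => h; last by rewrite mulr_ge0 ?expR_ge0.
  have hk : 0 <= l * (k%:R - v) by apply: mulr_ge0; [exact: ltW|rewrite subr_ge0; exact: ltW].
  rewrite -[leLHS]mulr1; apply: ler_wpM2l => //.
  by have := @expR_ge1Dx R (l * (k%:R - v)); lra.
rewrite -mulr_sumr -exprDn.
have h1 : 0 <= 1 - q + q * expR l by rewrite addr_ge0 ?mulr_ge0 ?expR_ge0//; lra.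
have h2 : 1 - q + q * expR l <= expR (q * (l + 2 * l ^+ 2)).
  apply: le_trans (expR_ge1Dx _).
  have := expR_le_quad l2; nra.
apply: (@le_trans _ _ (expR (- (l * v)) * expR (q * (l + 2 * l ^+ 2)) ^+ p)).
  by rewrite ler_pM2l ?expR_gt0// lerXn2r ?nnegrE ?expR_ge0.
rewrite -expRM_natl -expRD ler_expR mulrA -/S /v; move: hl; lra.
Qed.

End Binomial.

Section ExceedanceCount.
Context {R : realType} d (T : measurableType d) (P : probability T R).
Notation N01 := (@normal_prob R 0 1).
Context (I : finType) (Z : I -> T -> R).
Hypothesis indZ : std_gaussian P Z.

(** Summing over the possible sets S of exceeding coordinates, each of which has
probability q^|S| (1 - q)^(|I| - |S|). *)
Lemma hit_count_binomial (A : set R) (u : R) : measurable A ->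
  (P [set w | exists2 S : {set I}, (u < #|S|%:R)%R & forall i, (i \in S) = (Z i w \in A)]
   <= binomial_prob #|I| (fine (N01 A)) [set k : nat | (u < k%:R)%R])%E.
Proof.
move=> mA; set q := fine (N01 A).
have [mZ indZ'] := indZ.
have q0 : 0 <= q := fine_N01_ge0 A.
have q1 : q <= 1 := fine_N01_le1 mA.
have mCA : measurable (~` A) by exact: measurableC.
pose B (S : {set I}) i := if i \in S then A else ~` A.
have mB S i : measurable (B S i) by rewrite /B; case: ifP.
pose s := [seq S : {set I} <- enum {: {set I}} | u < #|S|%:R].
have qC : fine (N01 (~` A)) = 1 - q.
  by rewrite (probability_setC N01 mA) fineB ?(fin_num_measure N01).
rewrite (_ : [set w | _] = [set w | exists2 S, S \in s & rect Z [set: I]%SET (B S) w]); last first.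
  apply/seteqP; split => w /= [S].
    move=> uS h; exists S; first by rewrite mem_filter uS mem_enum.
    move=> i _; rewrite /B h; case: ifP => [/set_mem//|/negbT].
    by rewrite notin_setE.
  rewrite mem_filter => /andP[uS _] h; exists S => // i.
  have := h i (finset.in_setT i); rewrite /B; case: (i \in S) => hi; apply/esym.
    exact/mem_set.
  by apply/negbTE; rewrite notin_setE.
apply: (@le_trans _ _ (\sum_(S <- s) q ^+ #|S| * (1 - q) ^+ (#|I| - #|S|))%:E).
  apply: union_bound => S _; first exact: measurable_rect.
  rewrite indZ'// lee_fin le_eqVlt; apply/orP; left; apply/eqP.
  rewrite (bigID (mem S)) /=; congr (_ * _).
    rewrite (eq_bigr (fun=> q)) ?prodr_const// => i iS; by rewrite /B iS.
  rewrite (eq_bigr (fun=> 1 - q)); last by move=> i iS; rewrite /B (negbTE iS).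
  rewrite prodr_const; congr (_ ^+ _).
  by rewrite -(cardC (mem S)) addKn; apply: eq_card => i; rewrite !inE.
rewrite binomial_tailE ?q0// lee_fin big_filter big_enum_cond /=.
rewrite (partition_big (fun S : {set I} => inord #|S| : 'I_(#|I|.+1)) (fun k => u < k%:R)) /=; last first.
  by move=> S uS; rewrite inordK// ltnS max_card.
apply: ler_sum => k uk.
rewrite (eq_bigr (fun=> q ^+ k * (1 - q) ^+ (#|I| - k))); last first.
  by move=> S /andP[_ /eqP <-]; rewrite inordK// ltnS max_card.
rewrite sumr_const -card_draws.
have t0 : 0 <= q ^+ k * (1 - q) ^+ (#|I| - k).
  by rewrite mulr_ge0 ?exprn_ge0//; lra.
rewrite ler_wpMn2l//; apply: subset_leq_card. apply/fintype.subsetP => S.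
rewrite !inE => /andP[_ /eqP Sk]; apply/eqP.
by rewrite -Sk inordK// ltnS max_card.
Qed.
End ExceedanceCount.

(** * The law of the CUSUM statistic *)

Section CusumLaw.
Context {R : realType}.
Notation N01 := (@normal_prob R 0 1).

(** The index t stands for time t.+1. *)
Definition cusum_weight n (l r : nat) (t : 'I_n) : R :=
  Num.sqrt (r%:R / 2) / r%:R *
  ((l <= t.+1 <= l + r - 1)%N%:R - (l - r <= t.+1 <= l - 1)%N%:R).

Lemma cusumE n p (sigma : R) (Y : 'M[R]_(p, n)) l r i : 0 < sigma ->
  cusum sigma Y l r i 0 = \sum_t cusum_weight l r t * (Y i t / sigma).
Proof.
move=> s0; rewrite /cusum !mxE !summxE.
have -> : Num.sqrt (r%:R / (2 * sigma ^+ 2)) = Num.sqrt (r%:R / 2) / sigma.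
  rewrite invfM mulrA sqrtrM ?divr_ge0//.
  by rewrite sqrtrV ?sqr_ge0// sqrtr_sqr gtr0_norm.
rewrite (eq_bigr (fun t => Y i t)) => [|t _]; last by rewrite mxE.
rewrite [X in _ - _ * X](eq_bigr (fun t => Y i t)) => [|t _]; last by rewrite mxE.
rewrite big_mkcond [X in _ - _ * X]big_mkcond /= -mulrBr -sumrB !mulr_sumr.
apply: eq_bigr => t _; rewrite /cusum_weight.
by do 2 case: ifP => _; rewrite /=; ring.
Qed.

Lemma sum_interval n a b : (1 <= a)%N ->
  (\sum_(t < n) (a <= t.+1 <= b)%N)%N = ((minn b n).+1 - a)%N.
Proof.
move=> a1; elim: n => [|n IH]; first by rewrite big_ord0; lia.
rewrite big_ord_recr /= IH; case: (boolP (a <= n.+1 <= b)%N) => h /=; lia.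
Qed.

(** There are r positive and r negative weights, all equal to 1 / sqrt(2 r) in
absolute value. *)
Lemma cusum_weight_norm n l r : (1 <= r)%N -> (r < l)%N -> (l + r - 1 <= n)%N ->
  \sum_(t < n) cusum_weight l r t ^+ 2 = 1.
Proof.
move=> r1 rl ln.
have r0 : 0 < r%:R :> R by rewrite ltr0n.
transitivity (\sum_(t < n) (r%:R / 2 / r%:R ^+ 2) *
   ((l <= t.+1 <= l + r - 1)%N%:R + (l - r <= t.+1 <= l - 1)%N%:R) : R).
  apply: eq_bigr => t _; rewrite /cusum_weight exprMn exprMn sqr_sqrtr ?divr_ge0//.
  rewrite exprVn; congr (_ * _).
  have [h1|_] := boolP (l <= t.+1 <= l + r - 1)%N; have [h2|_] := boolP (l - r <= t.+1 <= l - 1)%N.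
  - by exfalso; lia.
  - by rewrite subr0 addr0 expr1n.
  - by rewrite sub0r add0r sqrrN expr1n.
  - by rewrite subr0 addr0 expr0n.
rewrite -mulr_sumr big_split /= -!natr_sum !sum_interval; try lia.
rewrite (_ : ((minn (l + r - 1) n).+1 - l)%N = r); last by lia.
rewrite (_ : ((minn (l - 1) n).+1 - (l - r))%N = r); last by lia.
by field; rewrite gt_eqF.
Qed.

Section Model.
Context d (T : measurableType d) (P : probability T R) (n p : nat) (sigma : R)
  (Theta : 'M[R]_(p, n)) (eps : 'I_p -> 'I_n -> {RV P >-> R}).
Hypothesis s0 : 0 < sigma.
Hypothesis noise : gaussian_noise sigma eps.

Definition cusum_noise (l r : nat) (i : 'I_p) (w : T) : R :=
  \sum_t cusum_weight l r t * (eps i t w / sigma).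

Lemma cusum_observation l r i w :
  cusum sigma (observation Theta eps w) l r i 0 =
  cusum sigma Theta l r i 0 + cusum_noise l r i w.
Proof.
rewrite !cusumE// -big_split /=; apply: eq_bigr => t _.
by rewrite -mulrDr -mulrDl !mxE.
Qed.

Lemma std_gaussian_noise :
  std_gaussian P (fun it : 'I_p * 'I_n => fun w => eps it.1 it.2 w / sigma).
Proof.
have [law indep] := noise.
split=> [it|B mB]; first exact: measurable_funM.
pose B' it := [set x | B it (x / sigma)] : set R.
have E it : B' it = (fun x : R => x / sigma) @^-1` B it by [].
have mB' it : measurable (B' it).
  by rewrite E; apply: measurable_preim => //; exact: measurable_funM.
have := indep [set: 'I_p * 'I_n]%SET B' mB'.
rewrite (_ : [set w | _] = rect (fun it w => eps it.1 it.2 w / sigma) [set: 'I_p * 'I_n]%SET B)//.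
move=> h; have mr : measurable (rect (fun it w => eps it.1 it.2 w / sigma) [set: 'I_p * 'I_n]%SET B).
  by apply: measurable_rect => // it; exact: measurable_funM.
rewrite -[LHS]fineK ?fin_num_measure// h; congr EFin.
rewrite (eq_bigl xpredT); last by move=> it; rewrite inE.
apply: eq_bigr => it _.
have := law it.1 it.2 (B' it) (mB' it); rewrite /distribution /pushforward => ->.
have sn0 : sigma != 0 by rewrite gt_eqF.
rewrite -[in normal_prob 0 sigma _](gtr0_norm s0) -(normal_prob_affine _ sn0)//.
congr (fine (N01 _)); apply/seteqP; split => x /=; rewrite /B' /= add0r mulrAC divff// mul1r//.
Qed.

Lemma std_gaussian_cusum_noise l r : (1 <= r)%N -> (r < l)%N -> (l + r - 1 <= n)%N ->
  std_gaussian P (cusum_noise l r).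
Proof.
move=> r1 rl ln.
exact: (std_gaussian_rows (a := cusum_weight l r) std_gaussian_noise (cusum_weight_norm r1 rl ln)).
Qed.

End Model.

(** A single change-point t0 at distance t0 - l from the centre of the window
attenuates the jump linearly. *)
Lemma cusum_mean n p (sigma : R) (Theta : 'M[R]_(p, n)) (l r t0 : nat) (m0 m1 : 'cV[R]_p) i :
  0 < sigma -> (1 <= r)%N -> (r < l)%N -> (l + r - 1 <= n)%N ->
  (l <= t0 <= l + r)%N ->
  (forall t : 'I_n, (l - r <= t.+1 < t0)%N -> col t Theta = m0) ->
  (forall t : 'I_n, (t0 <= t.+1 <= l + r - 1)%N -> col t Theta = m1) ->
  cusum sigma Theta l r i 0 =
  Num.sqrt (r%:R / 2) * (1 - (t0 - l)%:R / r%:R) / sigma * (m1 - m0) i 0.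
Proof.
move=> s0 r1 rl ln lt hm0 hm1; rewrite cusumE//.
have r0 : 0 < r%:R :> R by rewrite ltr0n.
transitivity (\sum_(t < n) Num.sqrt (r%:R / 2) / r%:R / sigma *
   ((t0 <= t.+1 <= l + r - 1)%N%:R * m1 i 0 + (l <= t.+1 <= t0 - 1)%N%:R * m0 i 0
     - (l - r <= t.+1 <= l - 1)%N%:R * m0 i 0) : R).
  apply: eq_bigr => t _; rewrite /cusum_weight.
  have [h0|h0] := boolP (l - r <= t.+1 < t0)%N.
    have -> : Theta i t = m0 i 0 by rewrite -(hm0 t h0) mxE.
    rewrite [(t0 <= _ <= _)%N](_ : _ = false); last by lia.
    rewrite [(l <= _ <= l + r - 1)%N](_ : _ = (l <= t.+1 <= t0 - 1)%N); last by lia.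
    rewrite /= mul0r add0r; ring.
  rewrite [(l - r <= _ <= _)%N](_ : _ = false); last by lia.
  rewrite [(l <= _ <= t0 - 1)%N](_ : _ = false); last by lia.
  rewrite [(l <= _ <= l + r - 1)%N](_ : _ = (t0 <= t.+1 <= l + r - 1)%N); last by lia.
  case: (boolP (t0 <= t.+1 <= l + r - 1)%N) => h1 /=; last by ring.
  have -> : Theta i t = m1 i 0 by rewrite -(hm1 t h1) mxE.
  ring.
rewrite -mulr_sumr sumrB big_split /= -!mulr_suml -!natr_sum !sum_interval; try lia.
rewrite (_ : ((minn (l + r - 1) n).+1 - t0)%N = (r - (t0 - l))%N); last by lia.
rewrite (_ : ((minn (t0 - 1) n).+1 - l)%N = (t0 - l)%N); last by lia.
rewrite (_ : ((minn (l - 1) n).+1 - (l - r))%N = r); last by lia.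
rewrite natrB; last by lia.
rewrite !mxE; field; by rewrite !gt_eqF.
Qed.

Lemma cusum_constant n p (sigma : R) (Theta : 'M[R]_(p, n)) (l r : nat) (m : 'cV[R]_p) i :
  0 < sigma -> (1 <= r)%N -> (r < l)%N -> (l + r - 1 <= n)%N ->
  (forall t : 'I_n, (l - r <= t.+1 <= l + r - 1)%N -> col t Theta = m) ->
  cusum sigma Theta l r i 0 = 0.
Proof.
move=> s0 r1 rl ln hm.
rewrite (@cusum_mean _ _ _ _ _ _ l m m)//; first by rewrite subrr mxE mulr0.
- by lia.
- by move=> t h; apply: hm; lia.
- by move=> t h; apply: hm; lia.
Qed.

End CusumLaw.

(** * The largest entries of a vector *)

Section OrderedEntries.
Context {R : realType}.

Lemma euclidean_norm_sqr p (v : 'cV[R]_p) :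
  euclidean_norm v ^+ 2 = \sum_(i < p) v i 0 ^+ 2.
Proof. by rewrite sqr_sqrtr// sumr_ge0// => i _; exact: sqr_ge0. Qed.

Section Top.
Context (p : nat) (v : 'cV[R]_p).

Let key (i : 'I_p) : R := `|v i 0|.
Let es := sort (relpre key (fun a b => b <= a)) (enum 'I_p).

Let ordered_absE : ordered_abs v = map key es.
Proof. by rewrite /ordered_abs sort_map. Qed.

Let es_perm : perm_eq es (enum 'I_p).
Proof. by rewrite perm_sort. Qed.

Let es_uniq : uniq es.
Proof. by rewrite (perm_uniq es_perm) enum_uniq. Qed.

Let es_size : size es = p.
Proof. by rewrite (perm_size es_perm) size_enum_ord. Qed.

Let es_sorted : sorted (relpre key (fun a b => b <= a)) es.
Proof. by apply: sort_sorted => i j /=; rewrite le_total. Qed.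

Let es_nth (x0 : 'I_p) i j : (i <= j < p)%N -> key (nth x0 es j) <= key (nth x0 es i).
Proof.
move=> /andP[ij jp].
apply: (sorted_leq_nth _ _ x0 es_sorted) => //=.
- by move=> a b c /= h1 h2; exact: le_trans h2 h1.
- by move=> a /=.
- by rewrite inE es_size; lia.
- by rewrite inE es_size; lia.
Qed.

Let top_sum s : (s <= p)%N -> 
  \sum_(i < s) nth 0 (ordered_abs v) i ^+ 2 = \sum_(i <- take s es) v i 0 ^+ 2.
Proof.
move=> sp; case: (posnP p) => [p0|p0].
  have s0 : s = 0%N by lia.
  by rewrite s0 big_ord0 take0 big_nil.
pose x0 : 'I_p := Ordinal p0.
rewrite (big_nth x0) size_takel ?es_size// big_mkord; apply: eq_bigr => i _.
rewrite ordered_absE (nth_map x0) ?es_size ?(leq_trans (ltn_ord i))//.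
by rewrite nth_take// /key real_normK ?num_real.
Qed.

Lemma top_sum_attained s : (s <= p)%N -> exists2 J : {set 'I_p}, #|J| = s &
  \sum_(i < s) nth 0 (ordered_abs v) i ^+ 2 = \sum_(i in J) v i 0 ^+ 2.
Proof.
move=> sp; exists [set i in take s es]%SET.
  by rewrite cardsE (card_uniqP _) ?take_uniq// size_takel ?es_size.
rewrite top_sum// big_uniq ?take_uniq//=.
by apply: eq_bigl => i; rewrite inE.
Qed.

(** Outside the set K of the largest entries, squares are at most the smallest one
m^2 in K, and the two set differences have the same size. *)
Lemma top_sum_max (J : {set 'I_p}) :
  \sum_(i in J) v i 0 ^+ 2 <= \sum_(i < #|J|) nth 0 (ordered_abs v) i ^+ 2.
Proof.
have Jp : (#|J| <= p)%N by rewrite -[leqRHS]card_ord max_card.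
rewrite top_sum// big_uniq ?take_uniq//=.
set K := [set i in take #|J| es]%SET.
have KJ : #|K| = #|J| by rewrite cardsE (card_uniqP _) ?take_uniq// size_takel ?es_size.
rewrite [leRHS](eq_bigl (fun i => i \in K)); last by move=> i; rewrite inE.
have [J0|J0] := posnP #|J|.
  by rewrite (cards0_eq J0) big_set0 sumr_ge0// => i _; exact: sqr_ge0.
have p0 : (0 < p)%N by lia.
pose x0 : 'I_p := Ordinal p0.
pose m := key (nth x0 es #|J|.-1).
have Km i : i \in K -> m ^+ 2 <= v i 0 ^+ 2.
  rewrite inE => iK; rewrite -(real_normK (num_real (v i 0))) lerXn2r ?nnegrE ?normr_ge0//.
  have hi : (index i (take #|J| es) < #|J|)%N.
    by rewrite -{2}(size_takel (s := es) (n0 := #|J|)) ?es_size// index_mem.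
  rewrite -[X in `|v X 0|](nth_index x0 iK) nth_take//.
  by apply: es_nth; rewrite -ltnS (ltn_predK J0) hi (leq_trans _ Jp)// ltn_predL.
have Km' i : i \notin K -> v i 0 ^+ 2 <= m ^+ 2.
  rewrite inE => iK; rewrite -(real_normK (num_real (v i 0))) lerXn2r ?nnegrE ?normr_ge0//.
  have ies : i \in es by rewrite (perm_mem es_perm) mem_enum.
  rewrite -[X in `|v X 0|](nth_index x0 ies).
  apply: es_nth.
  have ip : (index i es < p)%N by rewrite -[ltnRHS]es_size index_mem.
  rewrite ip andbT; rewrite leqNgt; apply/negP => h; move/negP: iK; apply.
  rewrite -(nth_index x0 ies) -(@nth_take #|J|); last by lia.
  by rewrite mem_nth// size_takel ?es_size//; lia.
rewrite (big_setID K) [leRHS](big_setID J) /= finset.setIC lerD2l.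
apply: (@le_trans _ _ (\sum_(i in J :\: K) m ^+ 2)).
  by apply: ler_sum => i; rewrite inE => /andP[iK _]; exact: Km'.
apply: (@le_trans _ _ (\sum_(i in K :\: J) m ^+ 2)); last first.
  by apply: ler_sum => i; rewrite inE => /andP[_ iK]; exact: Km.
have E : #|J :\: K| = #|K :\: J|.
  by apply/eqP; rewrite -(eqn_add2l #|J :&: K|) cardsID finset.setIC cardsID KJ.
by rewrite !sumr_const E.
Qed.

End Top.
End OrderedEntries.

(** * The tests as events *)

Section Tests.
Context {R : realType} d (T : measurableType d) (P : probability T R).
Notation N01 := (@normal_prob R 0 1).
Context (n p : nat) (sigma delta : R) (Y : T -> 'M[R]_(p, n)) (l r : nat).
Context (u : 'I_p -> R) (Z : 'I_p -> T -> R).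
Hypothesis indZ : std_gaussian P Z.
Hypothesis cusumY : forall w i, cusum sigma (Y w) l r i 0 = u i + Z i w.

Let mZ i : measurable_fun setT (Z i). Proof. by have [] := indZ. Qed.

Definition exceed_set (x : R) (i : 'I_p) : set R := [set z | x < `|u i + z|].

Lemma measurable_exceed_set x i : measurable (exceed_set x i).
Proof.
rewrite (_ : exceed_set x i = (fun z => `|u i + z|) @^-1` `]x, +oo[).
  apply: measurable_preim => //; apply: measurableT_comp => //.
  exact: measurable_funD.
by apply/seteqP; split => z /=; rewrite in_itv /= andbT.
Qed.

Lemma cusum_norm2E w : euclidean_norm (cusum sigma (Y w) l r) ^+ 2 =
  sq_norm Z [set: 'I_p]%SET u w.
Proof.
rewrite euclidean_norm_sqr /sq_norm; apply: eq_big => [i|i _]; first by rewrite inE.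
by rewrite cusumY.
Qed.

Lemma dense_testE w : dense_test sigma delta (Y w) l r <->
  p%:R + 4 * (Num.sqrt (p%:R * ln (2 * n%:R / (r%:R * delta))) +
         ln (2 * n%:R / (r%:R * delta))) < sq_norm Z [set: 'I_p]%SET u w.
Proof. by rewrite /dense_test cusum_norm2E ltrBrDl. Qed.

Lemma exceedancesE x w : (exceedances sigma (Y w) x l r)%:R =
  hit_count Z (exceed_set x) w :> R.
Proof.
rewrite /exceedances /hit_count -sum1_card natr_sum big_mkcond /=.
apply: eq_bigr => i _; rewrite inE /= cusumY indicE.
have [h|h] := boolP (x < `|u i + Z i w|); first by rewrite mem_set.
by rewrite memNset//; exact/negP.
Qed.

Definition partial_threshold (s : nat) : R :=
  4 * s%:R * ln (2 * expR 1 * p%:R / s%:R) + 4 * ln (n%:R / (r%:R * delta)).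

(** The sum of the largest squares is the largest of the sums over subsets, which
makes the test a union of events on sums of squares. *)
Lemma partial_norm_testE w : (0 < p)%N -> partial_norm_test sigma delta (Y w) l r <->
  exists2 J : {set 'I_p}, (exists2 j, (j <= trunc_log 2 p)%N & #|J| = (2 ^ j)%N) &
    partial_threshold #|J| < sq_norm Z J u w.
Proof.
move=> p0; have pw j : (j <= trunc_log 2 p)%N -> (2 ^ j <= p)%N.
  by move=> jp; apply: leq_trans (trunc_logP (isT : 1 < 2)%N p0); rewrite leq_exp2l.
have E J : sq_norm Z J u w = \sum_(i in J) cusum sigma (Y w) l r i 0 ^+ 2.
  by apply: eq_bigr => i _; rewrite cusumY.
split => [[j jp] h|[J [j jp Jj] h]].
  have [J Jj EJ] := top_sum_attained (cusum sigma (Y w) l r) (pw j jp).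
  by exists J; [exists j|rewrite E -EJ Jj].
exists j => //=; apply: lt_le_trans (_ : sq_norm Z J u w <= _); first by rewrite -Jj.
by rewrite E -Jj; exact: top_sum_max.
Qed.

Lemma measurable_dense_test : measurable [set w | dense_test sigma delta (Y w) l r].
Proof.
under eq_set => w do rewrite (propext (dense_testE w)).
by apply: measurable_gt_fun; exact: measurable_sq_norm indZ _ _.
Qed.

Lemma measurable_exceed (x c : R) :
  measurable [set w | c < (exceedances sigma (Y w) x l r)%:R].
Proof.
under eq_set => w do rewrite exceedancesE.
apply: measurable_gt_fun; apply: (measurable_hit_count indZ) => i; exact: measurable_exceed_set.
Qed.

Definition bj_event (x : nat) : set T :=
  [set w | (exceedances sigma (Y w) x%:R l r)%:R >
      binomial_quantile (bj_level n delta x r) p (2 * normal_tail x%:R)].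

Lemma measurable_berk_jones_test :
  measurable [set w | berk_jones_test sigma delta (Y w) l r].
Proof.
rewrite (_ : [set w | _] = \bigcup_(x in [set x | (1 <= x)%N]) bj_event x)//.
apply: bigcup_measurable => x _; exact: measurable_exceed.
Qed.

Lemma measurable_partial_norm_test : (0 < p)%N ->
  measurable [set w | partial_norm_test sigma delta (Y w) l r].
Proof.
move=> p0; under eq_set => w do rewrite (propext (partial_norm_testE w p0)).
pose good (J : {set 'I_p}) := exists2 j, (j <= trunc_log 2 p)%N & #|J| = (2 ^ j)%N.
rewrite (_ : [set w | _] = \bigcup_(J in [set J | good J]) [set w | partial_threshold #|J| < sq_norm Z J u w])//.
apply: fin_bigcup_measurable; first exact: finite_finset.
by move=> J _; apply: measurable_gt_fun; exact: measurable_sq_norm indZ _ _.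
Qed.

Lemma combined_testU : [set w | combined_test sigma delta (Y w) l r] =
  [set w | dense_test sigma delta (Y w) l r] `|`
  [set w | berk_jones_test sigma delta (Y w) l r] `|`
  [set w | partial_norm_test sigma delta (Y w) l r].
Proof.
apply/seteqP; split => w /=; first by move=> [h|h|h]; [left; left|left; right|right].
by move=> [[h|h]|h]; [constructor 1|constructor 2|constructor 3].
Qed.

Lemma measurable_combined_test : (0 < p)%N ->
  measurable [set w | combined_test sigma delta (Y w) l r].
Proof.
move=> p0; rewrite combined_testU; apply: measurableU; last exact: measurable_partial_norm_test.
apply: measurableU; [exact: measurable_dense_test|exact: measurable_berk_jones_test].
Qed.

End Tests.

(** * Level of the three tests *)

Section NullBounds.
Context {R : realType} d (T : measurableType d) (P : probability T R).
Notation N01 := (@normal_prob R 0 1).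
Context (n p : nat) (sigma delta : R) (Y : T -> 'M[R]_(p, n)) (l r : nat).
Context (Z : 'I_p -> T -> R).
Hypothesis indZ : std_gaussian P Z.
Hypothesis cusumY : forall w i, cusum sigma (Y w) l r i 0 = 0 + Z i w.
Hypothesis d01 : 0 < delta < 1.
Hypothesis p0 : (0 < p)%N.
Hypothesis r1 : (1 <= r)%N.
Hypothesis rn : (2 * r <= n)%N.

Let r0 : 0 < r%:R :> R. Proof. by rewrite ltr0n. Qed.
Let n0 : 0 < n%:R :> R. Proof. by rewrite ltr0n; lia. Qed.
Let d0 : 0 < delta. Proof. by case/andP: d01. Qed.
Let rd0 : 0 < r%:R * delta. Proof. exact: mulr_gt0. Qed.
Let rn2 : 2 * r%:R <= n%:R :> R. Proof. by rewrite -(natrM _ 2) ler_nat. Qed.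
Let rdn : 2 * (r%:R * delta) <= n%:R :> R.
Proof. by apply: le_trans rn2; case/andP: d01 => _ ?; rewrite ler_pM2l// ler_piMr// ltW. Qed.

(** The threshold exceeds the Laurent-Massart threshold at level
2 log(2 n / (r delta)). *)
Lemma null_dense : (P [set w | dense_test sigma delta (Y w) l r] <=
  (expR (- (2 * ln (2 * n%:R / (r%:R * delta)))))%:E)%E.
Proof.
set L := ln _.
have L0 : 0 < L.
  by rewrite ln_gt0// ltr_pdivlMr// mul1r; have := n0; have := rdn; lra.
have := @sq_norm_laurent_massart _ _ _ _ _ _ indZ (2 * L); rewrite card_ord.
have L20 : 0 < 2 * L by lra.
move=> /(_ L20 p0) h; apply: le_trans h.
apply: le_measure; rewrite ?inE.
- exact: measurable_dense_test indZ cusumY.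
- by apply: measurable_ge_fun; exact: measurable_sq_norm indZ _ _.
move=> w /=; rewrite (propext (dense_testE _ cusumY w)) -/L => /ltW; apply: le_trans.
have -> : p%:R * (2 * L) = 2 * (p%:R * L) :> R by ring.
rewrite sqrtrM//.
have s2 : Num.sqrt 2 <= 2 :> R.
  by rewrite -ler_sqr ?nnegrE ?sqrtr_ge0// sqr_sqrtr//; lra.
have := sqrtr_ge0 (p%:R * L); nra.
Qed.

Let Lr := ln (n%:R / (r%:R * delta)).

(** For subsets of size s, the Chernoff bound of [sq_norm_upper] beats the number
(e p / s)^s of subsets by a factor 2^-s; the sizes being powers of 2, these
factors sum up to at most 1. *)
Lemma null_partial : (P [set w | partial_norm_test sigma delta (Y w) l r] <=
  (expR (- (7 / 4 * Lr)))%:E)%E.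
Proof.
pose f (s : nat) : R := expR (- (7 / 16 * partial_threshold n p delta r s)) * Num.sqrt 8 ^+ s.
pose A (J : {set 'I_p}) := [set w | partial_threshold n p delta r #|J| < sq_norm Z J (fun=> 0) w].
have mA J : measurable (A J) by apply: measurable_gt_fun; exact: measurable_sq_norm indZ _ _.
have PA J : (P (A J) <= (f #|J|)%:E)%E.
  apply: le_trans (sq_norm_upper indZ J _).
  apply: le_measure; rewrite ?inE//.
    by apply: measurable_ge_fun; exact: measurable_sq_norm indZ _ _.
  by move=> w /=; exact: ltW.
pose sJ j := [seq J : {set 'I_p} <- enum {: {set 'I_p}} | #|J| == (2 ^ j)%N].
pose B j := [set w | exists2 J, J \in sJ j & A J w].
have PB j : (P (B j) <= ('C(p, 2 ^ j)%:R * f (2 ^ j)%N)%:E)%E.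
  apply: le_trans (union_bound (b := fun=> f (2 ^ j)%N) _ _) _ => [J _|J|]; first exact: mA.
    by rewrite mem_filter => /andP[/eqP <- _]; exact: PA.
  rewrite big_const_seq count_predT iter_addr_0 lee_fin mulr_natl.
  have -> : size (sJ j) = 'C(p, 2 ^ j).
    rewrite -[X in 'C(X, _)]card_ord -card_draws -sum1_size /sJ big_filter big_enum_cond -sum1_card.
    by apply: eq_bigl => J; rewrite !inE.
  by [].
have fB j : (j < (trunc_log 2 p).+1)%N ->
   'C(p, 2 ^ j)%:R * f (2 ^ j)%N <= expR (- (7 / 4 * Lr)) * (1 / 2) ^+ j.+1.
  move=> jp; rewrite ltnS in jp.
  have sp : (2 ^ j <= p)%N.
    by apply: leq_trans (trunc_logP (isT : 1 < 2)%N p0); rewrite leq_exp2l.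
  set s := (2 ^ j)%N in sp *.
  have s0 : (0 < s)%N by rewrite expn_gt0.
  have s0' : 0 < s%:R :> R by rewrite ltr0n.
  have p0' : 0 < p%:R :> R by rewrite ltr0n.
  apply: (@le_trans _ _ (expR (- (7 / 4 * Lr)) * (1 / 2) ^+ s)); last first.
    rewrite ler_pM2l ?expR_gt0//; apply: ler_wiXn2l; [lra|lra|].
    by rewrite /s ltn_expl.
  have hl : 0 <= ln (p%:R / s%:R) :> R.
    by rewrite ln_ge0// ler_pdivlMr// mul1r ler_nat.
  have l2 : ln 2 <= 1 :> R by have := @le_ln1Dx R 1; rewrite (_ : 1 + 1 = 2 :> R); [move=> /(_ _) h; apply: h; lra|lra].
  have e8 : Num.sqrt 8 = expR (3 / 2 * ln 2) :> R.
    apply/eqP; rewrite -(@eqrXn2 _ 2) ?sqrtr_ge0 ?expR_ge0// sqr_sqrtr//.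
    rewrite -expRM_natl (_ : 2%:R * _ = 3%:R * ln 2 :> R); last by field.
    rewrite expRM_natl lnK ?posrE//; apply/eqP; ring.
  have e2 : 1 / 2 = expR (- ln 2) :> R by rewrite expRN lnK ?posrE// div1r.
  have le : ln (2 * expR 1 * p%:R / s%:R) = ln 2 + 1 + ln (p%:R / s%:R) :> R.
    by rewrite -mulrA lnM ?posrE ?mulr_gt0 ?expR_gt0 ?invr_gt0// lnM ?posrE ?expR_gt0// expRK.
  have hb : 'C(p, s)%:R <= expR (s%:R * (1 + ln (p%:R / s%:R))) :> R.
    by apply: bin_le_expR; rewrite s0.
  apply: (le_trans (ler_wpM2r _ hb)); first by rewrite mulr_ge0 ?expR_ge0// exprn_ge0 ?sqrtr_ge0.
  rewrite /f e8 e2 /partial_threshold le -/Lr -!expRM_natl -!expRD ler_expR.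
  have : s%:R * (ln 2 * 3 / 4) <= s%:R * (3 / 4 + 3 / 4 * ln (p%:R / s%:R)) :> R.
    rewrite ler_pM2l//; lra.
  lra.
have [N NE] : exists N, N = (trunc_log 2 p).+1 by eexists.
rewrite -NE in fB.
apply: (@le_trans _ _ (P [set w | exists2 j, j \in iota 0 N & B j w])).
  apply: le_measure; rewrite ?inE.
  - exact: measurable_partial_norm_test indZ cusumY p0.
  - by apply: measurable_exists => j _; apply: measurable_exists => J _; exact: mA.
  move=> w /=; rewrite (propext (partial_norm_testE _ cusumY w p0)) => -[J [j jp Jj] h].
  exists j; first by rewrite mem_iota NE ltnS.
  by exists J => //; rewrite mem_filter Jj eqxx mem_enum.
apply: le_trans (union_bound (b := fun j => expR (- (7 / 4 * Lr)) * (1 / 2) ^+ j.+1) _ _) _.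
- by move=> j _; apply: measurable_exists => J _; exact: mA.
- move=> j; rewrite mem_iota /= add0n => jp; apply: le_trans (PB j) _.
  by rewrite lee_fin; exact: fB.
rewrite lee_fin -mulr_sumr -[leRHS]mulr1 ler_pM2l ?expR_gt0//.
case: {fB NE} N => [|N]; first by rewrite big_nil.
rewrite -addn1 iotaD big_cat /= big_seq1 add0n.
have -> : \sum_(j <- iota 0 N) (1 / 2) ^+ j.+1 = 1 - (1 / 2) ^+ N :> R.
  elim: N => [|N IH]; first by rewrite big_nil expr0 subrr.
  rewrite -addn1 iotaD big_cat /= big_seq1 add0n IH addn1 !exprS; lra.
rewrite exprS; have : 0 <= (1 / 2) ^+ N :> R by rewrite exprn_ge0.
lra.
Qed.

Hypothesis D0 : (0 < size (locations n r))%N.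

(** From pi >= 3. *)
Lemma bj_level_bounds x : (1 <= x)%N ->
  0 < bj_level n delta x r <= 2 / 3 * (delta * r%:R / ((size (locations n r))%:R * n%:R)) * (x%:R ^+ 2)^-1.
Proof.
move=> x1; rewrite /bj_level; have x0 : 0 < x%:R :> R by rewrite ltr0n.
have D0' : 0 < (size (locations n r))%:R :> R by rewrite ltr0n.
have pi3 := @pi_ge3 R.
have pp : 0 < pi ^+ 2 :> R by rewrite exprn_gt0//; lra.
apply/andP; split; first by rewrite divr_gt0 ?mulr_gt0 ?exprn_gt0 ?pi_gt0.
rewrite (_ : 6 * delta * r%:R / _ = (6 / pi ^+ 2) * (delta * r%:R / ((size (locations n r))%:R * n%:R)) * (x%:R ^+ 2)^-1); last first.
  by field; rewrite !gt_eqF//; have := pi_gt0 R; lra.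
rewrite ler_pM2r ?invr_gt0 ?exprn_gt0// ler_pM2r ?divr_gt0 ?mulr_gt0//.
rewrite ler_pdivrMr//; nra.
Qed.

(** Without signal, the number of exceedances is binomial, and its quantile is
exceeded with the prescribed probability at most. *)
Lemma null_bj_event x : (1 <= x)%N ->
  (P (bj_event sigma delta Y l r x) <= (bj_level n delta x r)%:E)%E.
Proof.
move=> x1; have x0 : 0 <= x%:R :> R by [].
have /andP[b0 b1] := bj_level_bounds x1.
have D0' : 1 <= (size (locations n r))%:R :> R by rewrite ler1n.
have b01 : 0 <= bj_level n delta x r < 1.
  rewrite ltW//=; apply: le_lt_trans b1 _.
  have x2 : (x%:R ^+ 2)^-1 <= 1 :> R by rewrite invf_le1 ?exprn_gt0 ?ltr0n// exprn_ege1// ler1n.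
  have h1 : delta * r%:R / ((size (locations n r))%:R * n%:R) <= 1.
    rewrite ler_pdivrMr ?mulr_gt0//; last by lra.
    have := rdn; have := n0; nra.
  have h0 : 0 <= delta * r%:R / ((size (locations n r))%:R * n%:R).
    by rewrite divr_ge0 ?mulr_ge0// ltW.
  have x3 : 0 <= (x%:R ^+ 2)^-1 :> R by rewrite invr_ge0 sqr_ge0.
  nra.
have q01 : 0 <= 2 * normal_tail (x%:R : R) <= 1.
  by rewrite two_normal_tail_le1// mulr_ge0// normal_tail_ge0.
have := binomial_quantileP p b01 q01.
set Q := binomial_quantile _ _ _ => hQ.
pose A : set R := [set z | x%:R < `|z|].
have mA : measurable A.
  rewrite (_ : A = (fun z => `|z|) @^-1` `]x%:R, +oo[).
    by apply: measurable_preim => //; exact: measurableT_comp.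
  by apply/seteqP; split => z /=; rewrite in_itv /= andbT.
have qE : 2 * normal_tail x%:R = fine (N01 A) by rewrite two_sided0.
have := hit_count_binomial indZ Q mA; rewrite -qE card_ord => h.
apply: le_trans (_ : (fine (binomial_prob p (2 * normal_tail x%:R) [set k : nat | (Q < k%:R)%R]))%:E <= _)%E; last by rewrite lee_fin.
rewrite fineK ?fin_num_measure//.
have hA w i : (x%:R < `|cusum sigma (Y w) l r i 0|) = (Z i w \in A).
  by rewrite cusumY add0r; apply/idP/idP => [hi|/set_mem//]; exact/mem_set.
rewrite (_ : bj_event _ _ _ _ _ _ = [set w | exists2 S : {set 'I_p}, Q < #|S|%:R &
    forall i, (i \in S) = (Z i w \in A)])//.
apply/seteqP; split => w /=.
  move=> h'; exists [set i | x%:R < `|cusum sigma (Y w) l r i 0|]%SET.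
    by rewrite cardsE.
  by move=> i; rewrite inE hA.
move=> [S QS hS]; apply: lt_le_trans QS _; rewrite ler_nat /exceedances.
by apply: subset_leq_card; apply/fintype.subsetP => i; rewrite hS -hA inE.
Qed.

(** Union bound over all the integers x; the levels are summable. *)
Lemma null_bj : (P [set w | berk_jones_test sigma delta (Y w) l r] <=
  (4 / 3 * (delta * r%:R / ((size (locations n r))%:R * n%:R)))%:E)%E.
Proof.
set c := delta * r%:R / _.
have c0 : 0 <= c by rewrite divr_ge0 ?mulr_ge0// ltW.
pose F k := bj_event sigma delta Y l r k.+1.
have mF k : measurable (F k) by exact: measurable_exceed indZ cusumY _ _.
rewrite (_ : [set w | _] = \bigcup_k F k); last first.
  apply/seteqP; split => w /=.
    by move=> [[|x] // _ h]; exists x.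
  by move=> [k _ h]; exists k.+1.
apply: le_trans (generalized_Boole_inequality _ mF _) _.
  by apply: bigcup_measurable => k _.
apply: lime_le; first exact: is_cvg_nneseries.
near=> N.
apply: (@le_trans _ _ (\sum_(0 <= k < N) (2 / 3 * c * (k.+1%:R ^+ 2)^-1)%:E)%E).
  apply: lee_sum => k _; apply: le_trans (null_bj_event _) _ => //.
  by rewrite lee_fin; have /andP[] := bj_level_bounds (isT : (1 <= k.+1)%N).
rewrite sumEFin lee_fin -mulr_sumr.
have := @sum_inv_squares R N; have : 0 <= 2 / 3 * c by rewrite mulr_ge0.
nra.
Unshelve. all: by end_near.
Qed.

End NullBounds.

(** * Power of the three tests *)

Section Power.
Context {R : realType} d (T : measurableType d) (P : probability T R).
Notation N01 := (@normal_prob R 0 1).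
Context (n p : nat) (sigma delta : R) (Y : T -> 'M[R]_(p, n)) (l r : nat).
Context (u : 'I_p -> R) (Z : 'I_p -> T -> R) (L : R).
Hypothesis indZ : std_gaussian P Z.
Hypothesis cusumY : forall w i, cusum sigma (Y w) l r i 0 = u i + Z i w.
Hypothesis d01 : 0 < delta < 1.
Hypothesis p0 : (0 < p)%N.
Hypothesis r1 : (1 <= r)%N.
Hypothesis rn : (2 * r <= n)%N.
Hypothesis L0 : 1 / 2 <= L.
Hypothesis LLr : L <= ln (n%:R / (r%:R * delta)) <= 4 * L.
Hypothesis L2r : ln (2 * n%:R / (r%:R * delta)) <= 5 * L.

Let r0 : 0 < r%:R :> R. Proof. by rewrite ltr0n. Qed.
Let n0 : 0 < n%:R :> R. Proof. by rewrite ltr0n; lia. Qed.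
Let d0 : 0 < delta. Proof. by case/andP: d01. Qed.
Let p0' : 0 < p%:R :> R. Proof. by rewrite ltr0n. Qed.
Let Lp : 0 < L. Proof. by have := L0; lra. Qed.

Let prob_le (A B : set T) (b : R) : measurable A -> measurable B -> A `<=` B ->
  (P B <= b%:E)%E -> (P A <= b%:E)%E.
Proof. by move=> mA mB AB; apply: le_trans; apply: le_measure; rewrite ?inE. Qed.

(** The exponent is sqrt(L / p) / 2, or 1 / 2 when p <= L: the quadratic term
2 lam^2 p then costs at most L / 2, and the linear gain from the energy is at
least L. *)
Lemma dense_power :
  23 * (Num.sqrt (p%:R * L) + L) <= (\sum_i u i ^+ 2) / 2 ->
  (P [set w | ~ dense_test sigma delta (Y w) l r] <= (expR (- L))%:E)%E.
Proof.
move=> hu; pose L2 := ln (2 * n%:R / (r%:R * delta)).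
have L2r' : L2 <= 5 * L := L2r.
pose A := p%:R + 4 * (Num.sqrt (p%:R * L2) + L2).
pose U := \sum_i u i ^+ 2.
have gen lam : 0 < lam <= 1 / 2 -> 2 * lam ^+ 2 * p%:R <= L / 2 ->
    L <= 2 * lam * (Num.sqrt (p%:R * L) + L) ->
    (P [set w | ~ dense_test sigma delta (Y w) l r] <= (expR (- L))%:E)%E.
  move=> hlam h1 h2.
  have mD : measurable [set w | ~ dense_test sigma delta (Y w) l r].
    exact: measurableC (measurable_dense_test delta indZ cusumY).
  apply: (@prob_le _ [set w | sq_norm Z [set: 'I_p]%SET u w <= A]) => //.
  - by apply: measurable_le_fun; exact: measurable_sq_norm indZ _ _.
  - by move=> w /=; rewrite (propext (dense_testE _ cusumY w)) -/L2 => /negP; rewrite -leNgt.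
  apply: le_trans (sq_norm_lower indZ _ _ _ hlam) _; rewrite lee_fin ler_expR cardsT card_ord.
  rewrite (eq_bigl xpredT); last by move=> i; rewrite inE.
  have sL : Num.sqrt (p%:R * L2) <= 3 * Num.sqrt (p%:R * L).
    have -> : 3 * Num.sqrt (p%:R * L) = Num.sqrt (9 * (p%:R * L)).
      rewrite [RHS]sqrtrM// (_ : 9 = 3 ^+ 2 :> R); last by ring.
      by rewrite sqrtr_sqr ger0_norm.
    apply: ler_wsqrtr.
    have := ler_wpM2l (ltW p0') L2r'; have := mulr_gt0 p0' Lp; lra.
  have sq0 := sqrtr_ge0 (p%:R * L).
  have /andP[l0 _] := hlam.
  have : lam * A + p%:R * (- lam + 2 * lam ^+ 2) <= lam * (20 * (Num.sqrt (p%:R * L) + L)) + L / 2.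
    have : lam * (4 * (Num.sqrt (p%:R * L2) + L2)) <= lam * (20 * (Num.sqrt (p%:R * L) + L)).
      rewrite ler_pM2l//; lra.
    rewrite /A; lra.
  have : lam * (23 * (Num.sqrt (p%:R * L) + L)) <= lam * (U / 2) by rewrite ler_pM2l.
  rewrite -/U; lra.
have [pL|Lp'] := leP p%:R L.
  apply: (gen (1 / 2)); [lra|lra|].
  have := sqrtr_ge0 (p%:R * L); lra.
pose a : R := Num.sqrt p%:R; pose b : R := Num.sqrt L.
have a0 : 0 < a by rewrite sqrtr_gt0; exact: p0'.
have b0 : 0 < b by rewrite sqrtr_gt0; exact: Lp.
have aE : a ^+ 2 = p%:R by rewrite sqr_sqrtr.
have bE : b ^+ 2 = L by rewrite sqr_sqrtr// ltW.
have ab : b <= a by rewrite /a /b ler_sqrt// ltW.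
have h1 : b / a <= 1 by rewrite ler_pdivrMr// mul1r.
have h2 : 0 < b / a by rewrite divr_gt0.
apply: (gen (1 / 2 * (b / a))); first lra.
  rewrite -aE -bE le_eqVlt; apply/orP; left; apply/eqP; field.
  by rewrite gt_eqF.
rewrite (sqrtrM _ (ltW p0')) -/a -/b -bE.
rewrite (_ : 2 * _ * _ = b ^+ 2 + b / a * b ^+ 2); last by field; rewrite gt_eqF.
by rewrite lerDl mulr_ge0 ?sqr_ge0// ltW.
Qed.

Let take_subset (A : {set 'I_p}) k : (k <= #|A|)%N ->
  exists2 B : {set 'I_p}, B \subset A & #|B| = k.
Proof.
move=> kA; exists [set i in take k (enum A)]%SET.
  by apply/fintype.subsetP => i; rewrite inE => /mem_take; rewrite mem_enum.
by rewrite cardsE (card_uniqP _) ?take_uniq ?enum_uniq// size_takel// -cardE.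
Qed.

(** The sparsities tested are powers of 2: a set J of size between 2^j and
2^(j + 1) is covered by two sets of size 2^j, one of which carries at least half
of its energy. *)
Lemma half_energy (J : {set 'I_p}) : (0 < #|J|)%N ->
  exists2 J' : {set 'I_p}, (exists2 j, (j <= trunc_log 2 p)%N &
      #|J'| = (2 ^ j)%N /\ (2 ^ j <= #|J| < 2 * 2 ^ j)%N) &
    (\sum_(i in J) u i ^+ 2) / 2 <= \sum_(i in J') u i ^+ 2.
Proof.
move=> J0.
have Jp : (#|J| <= p)%N by rewrite -[leqRHS]card_ord max_card.
pose j := trunc_log 2 #|J|.
have j1 : (2 ^ j <= #|J|)%N by exact: trunc_logP.
have j2 : (#|J| < 2 * 2 ^ j)%N by rewrite -expnS; exact: trunc_log_ltn.
have jp : (j <= trunc_log 2 p)%N by exact: leq_trunc_log.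
have ext (A : {set 'I_p}) : (#|A| <= 2 ^ j)%N -> exists2 B : {set 'I_p}, A \subset B & #|B| = (2 ^ j)%N.
  move=> hA; have cA : (2 ^ j - #|A| <= #|~: A|)%N.
    by rewrite leq_subLR cardsC card_ord (leq_trans j1).
  have [B BA cB] := take_subset cA.
  exists (A :|: B); first exact: finset.subsetUl.
  have -> : #|A :|: B| = (#|A| + #|B|)%N.
    rewrite cardsU (_ : A :&: B = finset.set0) ?cards0 ?subn0//.
    apply/setP => i; rewrite !inE; apply/negbTE/negP => /andP[iA iB].
    by have := fintype.subsetP BA i iB; rewrite inE iA.
  by rewrite cB subnKC.
have [J1 J1J cJ1] : exists2 B : {set 'I_p}, B \subset J & #|B| = (2 ^ j)%N.
  exact: take_subset.
have c2 : (#|J :\: J1| <= 2 ^ j)%N.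
  by rewrite cardsD (finset.setIidPr J1J) cJ1 leq_subLR addnn -mul2n ltnW.
have [J2 J2J cJ2] := ext _ c2.
have E : \sum_(i in J) u i ^+ 2 = \sum_(i in J1) u i ^+ 2 + \sum_(i in J :\: J1) u i ^+ 2.
  by rewrite (big_setID J1) /= (finset.setIidPr J1J).
have E2 : \sum_(i in J :\: J1) u i ^+ 2 <= \sum_(i in J2) u i ^+ 2.
  rewrite [leRHS](big_setID (J :\: J1)) /= (finset.setIidPr J2J) lerDl sumr_ge0// => i _.
  exact: sqr_ge0.
have [h|h] := leP (\sum_(i in J :\: J1) u i ^+ 2) (\sum_(i in J1) u i ^+ 2).
  exists J1; last by lra.
  by exists j; rewrite // cJ1 j1 j2.
exists J2; last by lra.
by exists j; rewrite // cJ2 j1 j2.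
Qed.

(** [sq_norm_lower] with exponent 1 / 2 on the set given by [half_energy]. *)
Lemma partial_power (J : {set 'I_p}) : (0 < #|J|)%N ->
  32 * (#|J|%:R * ln (2 * expR 1 * p%:R / #|J|%:R)) + 72 * L <= \sum_(i in J) u i ^+ 2 ->
  (P [set w | ~ partial_norm_test sigma delta (Y w) l r] <= (expR (- L))%:E)%E.
Proof.
move=> J0 hJ; have [J' [j jp [cJ' /andP[j1 j2]]] hJ'] := half_energy J0.
pose thr := partial_threshold n p delta r #|J'|.
apply: (@prob_le _ [set w | sq_norm Z J' u w <= thr]).
- exact: measurableC (measurable_partial_norm_test delta indZ cusumY p0).
- by apply: measurable_le_fun; exact: measurable_sq_norm indZ _ _.
- move=> w /= h; rewrite leNgt; apply/negP => h'; apply: h.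
  by rewrite (propext (partial_norm_testE _ cusumY w p0)); exists J' => //; exists j.
have hlam : 0 < (1 / 2 : R) <= 1 / 2 by lra.
apply: le_trans (sq_norm_lower indZ _ _ _ hlam) _; rewrite lee_fin ler_expR.
have m0 : 0 < #|J|%:R :> R by rewrite ltr0n.
have s0 : 0 < #|J'|%:R :> R by rewrite cJ' ltr0n expn_gt0.
have Jp : #|J|%:R <= p%:R :> R by rewrite ler_nat -[leqRHS]card_ord max_card.
have sm : #|J'|%:R <= #|J|%:R :> R by rewrite cJ' ler_nat.
have ms : #|J|%:R <= 2 * #|J'|%:R :> R by rewrite cJ' -(natrM _ 2) ler_nat ltnW.
have e1 : 1 <= expR 1 :> R by rewrite -[leLHS]expR0 ler_expR.
have l2 : ln 2 <= ln (2 * expR 1 * p%:R / #|J|%:R) :> R.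
  rewrite ler_ln ?posrE ?divr_gt0 ?mulr_gt0 ?expR_gt0//.
  rewrite ler_pdivlMr//; have := p0'; nra.
have le : ln (2 * expR 1 * p%:R / #|J'|%:R) <= 2 * ln (2 * expR 1 * p%:R / #|J|%:R) :> R.
  apply: (@le_trans _ _ (ln (2 * (2 * expR 1 * p%:R / #|J|%:R)))).
    rewrite ler_ln ?posrE ?divr_gt0 ?mulr_gt0 ?invr_gt0 ?expR_gt0//.
    have pe : 0 < 2 * expR 1 * p%:R :> R by rewrite !mulr_gt0 ?expR_gt0.
    rewrite [leRHS]mulrCA ler_pM2l// ler_pdivlMr// mulrC ler_pdivrMr//.
  rewrite lnM ?posrE ?divr_gt0 ?mulr_gt0 ?expR_gt0//; lra.
have ln2 := @ln2_ge R.
have /andP[_ LL] := LLr.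
have : #|J'|%:R * ln (2 * expR 1 * p%:R / #|J'|%:R) <=
    #|J|%:R * (2 * ln (2 * expR 1 * p%:R / #|J|%:R)) :> R.
  apply: ler_pM => //.
  apply: ln_ge0; rewrite ler_pdivlMr// mul1r; have := p0'; nra.
rewrite /thr /partial_threshold; move: hJ hJ' LL.
lra.
Qed.

(** Every coordinate contributes at least its null probability, and the coordinates
with a mean above 2 x contribute 1 / 10 more. *)
Lemma hit_count_mean x : (1 <= x)%N ->
  p%:R * (2 * normal_tail x%:R) + #|[set i | 2 * x%:R <= `|u i|]%SET|%:R / 10 <=
  \sum_i fine (N01 (exceed_set u x%:R i)).
Proof.
move=> x1; have x1' : 1 <= x%:R :> R by rewrite ler1n.
rewrite -[X in X%:R * (2 * _)]card_ord -sum1_card -sum1_card !natr_sum !mulr_suml.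
rewrite [X in _ + X]big_mkcond /= -big_split /=; apply: ler_sum => i _.
rewrite inE mul1r; case: ifP => h; last by rewrite addr0; apply: two_sided_mono; lra.
by rewrite mul1r -div1r; apply: two_sided_shift.
Qed.

Hypothesis Dr : ((size (locations n r)) * r <= 2 * n)%N.
Hypothesis D0 : (0 < size (locations n r))%N.

(** This dominates, up to constants, the standard deviation of the number of
exceedances of x and the logarithm of the level of the test at x. *)
Definition bj_requirement (x : R) : R :=
  5 * 10 ^+ 3 * (x * Num.sqrt (p%:R * L) * expR (- (x ^+ 2 / 4)) + L * x).

(** Let M be the logarithm of the inverse level, which is at most 22 L x.  The
quantile is at most p q + 3 sqrt(p q M) + 3 M, while the number of exceedances
is at least S - 3 sqrt(S M) - 3 M with probability 1 - exp(- M), where the mean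
S exceeds p q by a tenth of the number of coordinates above 2 x. *)
Lemma bj_power x : (1 <= x)%N ->
  bj_requirement x%:R <= #|[set i | 2 * x%:R <= `|u i|]%SET|%:R ->
  (P [set w | ~ berk_jones_test sigma delta (Y w) l r] <= (expR (- L))%:E)%E.
Proof.
move=> x1 hx; have x1' : 1 <= x%:R :> R by rewrite ler1n.
have xp : 0 < x%:R :> R by lra.
have /andP[b0 b1] := bj_level_bounds d01 p0 r1 rn D0 x1.
set dx := bj_level n delta x r in b0 b1.
have D0' : 1 <= (size (locations n r))%:R :> R by rewrite ler1n.
have rdp : 0 < r%:R * delta by exact: mulr_gt0 r0 d0.
have nrd : 0 < n%:R / (r%:R * delta) by rewrite divr_gt0//; exact: n0.
have /andP[LL1 LL2] := LLr.
pose M := - ln dx.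
have dxE : expR (- M) = dx by rewrite opprK lnK.
have LM : L <= M.
  apply: le_trans LL1 _; rewrite /M -lnV ?posrE// ler_ln ?posrE ?invr_gt0//.
  rewrite -[leLHS]invrK lef_pV2 ?posrE ?invr_gt0// invf_div.
  apply: le_trans b1 _.
  have xi : (x%:R ^+ 2)^-1 <= 1 :> R by rewrite invf_le1 ?exprn_gt0// exprn_ege1.
  have xi0 : 0 < (x%:R ^+ 2)^-1 :> R by rewrite invr_gt0 exprn_gt0.
  have Di : (size (locations n r))%:R^-1 <= 1 :> R by rewrite invf_le1//; lra.
  rewrite (_ : delta * r%:R / _ = (r%:R * delta / n%:R) * (size (locations n r))%:R^-1); last first.
    by field; rewrite !gt_eqF//; lra.
  have w0 : 0 < r%:R * delta / n%:R by rewrite divr_gt0//; exact: n0.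
  set w := r%:R * delta / n%:R in w0 *; set e := _^-1 in Di *.
  have : w * e <= w by rewrite ler_piMr// ltW.
  have : 0 <= w * e by rewrite mulr_ge0 ?ltW// /e invr_gt0; lra.
  move: xi xi0; set v := _^-1 => v1 v0 h1 h2; nra.
have M0 : 0 < M by apply: lt_le_trans LM; exact: Lp.
have ML : M <= 22 * L * x%:R.
  have h : dx^-1 <= 6 * x%:R ^+ 2 * (n%:R / (r%:R * delta)) ^+ 2.
    have pi4 : pi < 4 :> R by have := @pihalf_lt2 R; lra.
    have pi2 := @pi_ge2 R.
    have Dr' : (size (locations n r))%:R * r%:R <= 2 * n%:R :> R.
      by rewrite -(natrM _ 2) -natrM ler_nat.
    rewrite /dx /bj_level invf_div ler_pdivrMr ?mulr_gt0//.
    rewrite (_ : 6 * _ * _ * _ = (36 * x%:R ^+ 2 * n%:R / delta) * (n%:R / r%:R)); last first.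
      by field; rewrite !gt_eqF.
    apply: (@le_trans _ _ (16 * x%:R ^+ 2 * n%:R * (2 * (n%:R / r%:R)))).
      have hD : (size (locations n r))%:R <= 2 * (n%:R / r%:R) :> R.
        by rewrite mulrA ler_pdivlMr.
      rewrite (_ : pi ^+ 2 * _ * _ * _ = (pi ^+ 2 * x%:R ^+ 2 * n%:R) * (size (locations n r))%:R); last by ring.
      have pi16 : pi ^+ 2 <= 16 :> R by nra.
      have h1 : pi ^+ 2 * x%:R ^+ 2 * n%:R <= 16 * x%:R ^+ 2 * n%:R :> R.
        rewrite (ler_pM2r n0) (ler_pM2r (exprn_gt0 2 xp)); exact: pi16.
      have h0 : 0 <= pi ^+ 2 * x%:R ^+ 2 * n%:R :> R by apply: mulr_ge0 => //; apply: mulr_ge0; exact: sqr_ge0.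
      by apply: ler_pM.
    have dd : 1 <= delta^-1 by rewrite invf_ge1//; case/andP: d01 => _ /ltW.
    have nr0 : 0 < n%:R / r%:R :> R by rewrite divr_gt0//; exact: n0.
    have xn0 : 0 < x%:R ^+ 2 * n%:R * (n%:R / r%:R) :> R := mulr_gt0 (mulr_gt0 (exprn_gt0 2 xp) n0) nr0.
    rewrite (_ : 16 * _ * _ * _ = 32 * (x%:R ^+ 2 * n%:R * (n%:R / r%:R))); last by ring.
    rewrite (_ : 36 * _ * _ * _ * _ = (36 * delta^-1) * (x%:R ^+ 2 * n%:R * (n%:R / r%:R))); last by ring.
    rewrite ler_pM2r//; lra.
  rewrite /M -lnV ?posrE//.
  apply: (@le_trans _ _ (ln (6 * x%:R ^+ 2 * (n%:R / (r%:R * delta)) ^+ 2))).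
    rewrite ler_ln ?posrE ?invr_gt0//.
    by apply: mulr_gt0; [apply: mulr_gt0 => //|]; exact: exprn_gt0.
  have lw2 (a b : R) : 0 < a -> 0 < b -> ln (6 * a ^+ 2 * b ^+ 2) = ln 6 + 2 * ln a + 2 * ln b.
    move=> a0 b0'; have a2 : 0 < 6 * a ^+ 2 by apply: mulr_gt0 => //; exact: exprn_gt0.
    have a2' : 0 < a ^+ 2 by exact: exprn_gt0.
    have b2' : 0 < b ^+ 2 by exact: exprn_gt0.
    have six : 0 < 6 :> R by [].
    rewrite (lnM a2 b2') (lnM six a2') (lnXn 2 a0) (lnXn 2 b0').
    by rewrite -[_ *+ 2]mulr_natl -[X in _ + X]mulr_natl.
  rewrite (lw2 _ _ xp nrd).
  have h6 : ln 6 <= 5 :> R.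
    by have := @le_ln1Dx R 5 ltac:(lra); rewrite (_ : 1 + 5 = 6 :> R); [|lra].
  have hx1 : ln x%:R <= x%:R :> R by rewrite ltW// ln_sublinear.
  have Lx1 : L <= L * x%:R by rewrite ler_peMr// ltW.
  have Lx2 : x%:R <= 2 * (L * x%:R) by rewrite mulrA ler_peMl//; have := L0; lra.
  have := L0; lra.
pose q : R := 2 * normal_tail x%:R.
have q0 : 0 <= q by rewrite mulr_ge0 ?normal_tail_ge0.
have q1 : q <= 1 by apply: two_normal_tail_le1; lra.
have qe : q <= 2 * expR (- (x%:R ^+ 2 / 2)).
  by rewrite ler_pM2l//; apply: normal_tail_chernoff; lra.
have q01 : 0 <= q <= 1 by rewrite q0.
pose S := \sum_i fine (N01 (exceed_set u x%:R i)).
pose D := #|[set i | 2 * x%:R <= `|u i|]%SET|%:R / 10 : R.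
have SD : p%:R * q + D <= S by exact: hit_count_mean.
have dx01 : 0 <= dx < 1.
  rewrite ltW//= -dxE expR_lt1; lra.
have hQ : binomial_quantile dx p q <= p%:R * q + 3 * Num.sqrt (p%:R * q * M) + 3 * M.
  by apply: (binomial_quantile_le dx01); rewrite -dxE; apply: binomial_chernoff.
have key : p%:R * q + 3 * Num.sqrt (p%:R * q * M) + 3 * M <= S - 3 * Num.sqrt (S * M) - 3 * M.
  pose s : R := Num.sqrt (p%:R * L); pose e : R := expR (- (x%:R ^+ 2 / 4)).
  have s0 : 0 <= s by exact: sqrtr_ge0.
  have e0 : 0 < e by exact: expR_gt0.
  have hD : 500 * (x%:R * s * e + L * x%:R) <= D.
    by rewrite /D ler_pdivlMr//; move: hx; rewrite /bj_requirement -/s -/e; lra.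
  have ha : Num.sqrt (p%:R * q * M) <= 7 * (x%:R * s * e).
    have -> : 7 * (x%:R * s * e) = Num.sqrt ((7 * (x%:R * s * e)) ^+ 2).
      by rewrite sqrtr_sqr ger0_norm// !mulr_ge0 ?(ltW e0).
    apply: ler_wsqrtr.
    have e2 : e ^+ 2 = expR (- (x%:R ^+ 2 / 2)).
      by rewrite /e -expRM_natl; congr expR; lra.
    have s2 : s ^+ 2 = p%:R * L by rewrite sqr_sqrtr// mulr_ge0// ltW.
    rewrite (_ : _ ^+ 2 = 49 * x%:R ^+ 2 * s ^+ 2 * e ^+ 2); last by ring.
    rewrite s2 e2; set E := expR _ in qe *.
    have E0 : 0 < E by exact: expR_gt0.
    have h1 : q * M <= 2 * E * (22 * L * x%:R).
      by apply: ler_pM => //; exact: ltW.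
    have h2 : p%:R * (q * M) <= p%:R * (2 * E * (22 * L * x%:R)) by rewrite ler_pM2l//; exact: p0'.
    have h3 : 0 < p%:R * (E * L) by rewrite !mulr_gt0.
    have h4 : p%:R * (E * L) * (44 * x%:R) <= p%:R * (E * L) * (49 * x%:R ^+ 2).
      rewrite ler_pM2l//; nra.
    lra.
  pose a := Num.sqrt (p%:R * q * M); have a0 : 0 <= a by exact: sqrtr_ge0.
  have hDM : 12 * a + 21 * M <= D.
    have : 0 <= x%:R * s * e by rewrite !mulr_ge0 ?(ltW e0).
    have : 0 < L * x%:R by rewrite mulr_gt0//; exact: Lp.
    move: hD ha ML; rewrite -/a; lra.
  pose D' := S - p%:R * q.
  have DD : D <= D' by rewrite /D'; lra.
  have D'0 : 0 <= D' by apply: le_trans DD; lra.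
  pose b := Num.sqrt (D' * M); have b0' : 0 <= b by exact: sqrtr_ge0.
  have b2 : b ^+ 2 = D' * M by rewrite sqr_sqrtr// mulr_ge0// ltW.
  have a2 : a ^+ 2 = p%:R * q * M by rewrite sqr_sqrtr//; apply: mulr_ge0; [exact: mulr_ge0|exact: ltW].
  have hS : Num.sqrt (S * M) <= a + b.
    rewrite -[leRHS]ger0_norm ?addr_ge0// -sqrtr_sqr; apply: ler_wsqrtr.
    rewrite sqrrD a2 b2 (_ : S = p%:R * q + D'); last by rewrite /D'; ring.
    have : 0 <= a * b by rewrite mulr_ge0.
    lra.
  have hb : 3 * b <= D' / 2 + 9 / 2 * M.
    rewrite -[leLHS]ger0_norm ?mulr_ge0// -[leRHS]ger0_norm; last by rewrite addr_ge0//; lra.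
    rewrite -!sqrtr_sqr; apply: ler_wsqrtr; rewrite exprMn b2.
    have := sqr_ge0 (D' / 2 - 9 / 2 * M); lra.
  rewrite -/a (_ : S = p%:R * q + D') in hS *; last by rewrite /D'; ring.
  lra.
apply: (@prob_le _ [set w | hit_count Z (exceed_set u x%:R) w <= S - 3 * Num.sqrt (S * M) - 3 * M]).
- exact: measurableC (measurable_berk_jones_test delta indZ cusumY).
- apply: measurable_le_fun; apply: (measurable_hit_count indZ) => i; exact: measurable_exceed_set.
- move=> w /= h; rewrite leNgt; apply/negP => h'; apply: h; exists x => //.
  rewrite (exceedancesE cusumY); apply: le_lt_trans h'.
  exact: le_trans hQ key.
apply: le_trans (hit_count_lower indZ _ M0 erefl) _ => [i|]; first exact: measurable_exceed_set.
by rewrite lee_fin ler_expR lerN2.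
Qed.

End Power.

(** * Power of the combined test *)

Section Levels.
Context {R : realType}.

(** Layer-cake decomposition of v^2 over the integer levels x for 2 x, with the
levels below x0 put into a single term. *)
Lemma level_sum (v : R) (x0 N : nat) : 0 <= v -> (x0 <= N)%N -> v < 2 * N%:R ->
  v ^+ 2 <= 4 * x0%:R ^+ 2 + \sum_(x0 <= x < N) (8 * (x%:R : R) + 4) * (2 * (x%:R : R) <= v)%R%:R.
Proof.
move=> v0; elim: N => [|N IH] xN vN; first by move: vN; rewrite mulr0; lra.
have [E|xN'] := eqVneq x0 N.+1.
  by rewrite E big_geq// addr0; rewrite -natr1 in vN *; have := ler0n R N; nra.
have {}xN' : (x0 <= N)%N by lia.
rewrite big_nat_recr //=.
have [vN'|vN'] := ltP v (2 * N%:R).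
  by rewrite mulr0 addr0; exact: IH.
rewrite mulr1.
have -> : \sum_(x0 <= x < N) (8 * (x%:R : R) + 4) * (2 * (x%:R : R) <= v)%R%:R = 4 * N%:R ^+ 2 - 4 * x0%:R ^+ 2 :> R.
  rewrite big_nat_cond (eq_bigr (fun x : nat => 4 * x.+1%:R ^+ 2 - 4 * x%:R ^+ 2)); last first.
    move=> x /andP[/andP[_ xlt] _]; have -> : (2 * x%:R <= v)%R.
      by apply: le_trans vN'; rewrite ler_pM2l// ler_nat ltnW.
    by rewrite mulr1 -natr1; ring.
  by rewrite -big_nat_cond telescope_sumr.
rewrite -natr1 in vN; have := ler0n R N; nra.
Qed.

(** Half of the exponent is used to dominate the series by that of 1 / x^2, the
other half is taken at x0. *)
Lemma gauss_series (x0 N : nat) : (1 <= x0)%N ->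
  \sum_(x0 <= x < N) x%:R ^+ 2 * expR (- (x%:R ^+ 2 / 4)) <=
  256 * expR (- (x0%:R ^+ 2 / 8)) :> R.
Proof.
move=> x1.
have term x : (x0 <= x)%N -> x%:R ^+ 2 * expR (- (x%:R ^+ 2 / 4)) <=
    128 * expR (- (x0%:R ^+ 2 / 8)) * (x%:R ^+ 2)^-1 :> R.
  move=> xx; have xp : 0 < x%:R :> R by rewrite ltr0n; lia.
  rewrite (_ : - (x%:R ^+ 2 / 4) = - (x%:R ^+ 2 / 8) + - (x%:R ^+ 2 / 8)); last by lra.
  rewrite expRD.
  have h1 : expR (- (x%:R ^+ 2 / 8)) <= expR (- (x0%:R ^+ 2 / 8)) :> R.
    rewrite ler_expR lerN2 ler_pM2r// ler_pXn2r ?nnegrE ?ler_nat//.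
  have h2 : x%:R ^+ 2 * expR (- (x%:R ^+ 2 / 8)) <= 128 * (x%:R ^+ 2)^-1 :> R.
    have := @expR_ge1Dxn R (x%:R ^+ 2 / 8) 1 ltac:(by rewrite divr_ge0 ?sqr_ge0).
    rewrite expRN (_ : 2`! = 2)%N// => h.
    have z0 : 0 < x%:R ^+ 2 :> R by rewrite exprn_gt0.
    rewrite ler_pdivrMr ?expR_gt0// mulrAC ler_pdivlMr//.
    have := h; nra.
  have e0 := expR_gt0 (- (x0%:R ^+ 2 / 8) : R).
  have z1 : 0 <= x%:R ^+ 2 * expR (- (x%:R ^+ 2 / 8)) :> R by rewrite mulr_ge0 ?sqr_ge0 ?expR_ge0.
  rewrite mulrA; apply: (le_trans (ler_pM z1 (expR_ge0 _) h2 h1)).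
  by rewrite le_eqVlt; apply/orP; left; apply/eqP; ring.
apply: (@le_trans _ _ (\sum_(x0 <= x < N) 128 * expR (- (x0%:R ^+ 2 / 8)) * (x%:R ^+ 2)^-1)).
  rewrite big_nat_cond [leRHS]big_nat_cond; apply: ler_sum => x /andP[/andP[xx _] _].
  exact: term.
rewrite -mulr_sumr.
have hs : \sum_(x0 <= x < N) (x%:R ^+ 2)^-1 <= 2 :> R.
  apply: (@le_trans _ _ (\sum_(1 <= x < N.+1) (x%:R ^+ 2)^-1)).
    have [xN|Nx] := leqP x0 N; last by rewrite big_geq ?sumr_ge0// ?(ltnW Nx)// => i _; rewrite invr_ge0 sqr_ge0.
    rewrite [leRHS](big_cat_nat (n := x0)) //=; last by lia.
    rewrite -[leLHS]add0r; apply: lerD.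
      by apply: sumr_ge0 => i _; rewrite invr_ge0 sqr_ge0.
    by rewrite big_nat_recr //= lerDl invr_ge0 sqr_ge0.
  by rewrite big_add1 /=; exact: sum_inv_squares.
have := expR_gt0 (- (x0%:R ^+ 2 / 8) : R); nra.
Qed.

End Levels.

Section Sparse.
Context {R : realType}.

Lemma expR1_le3 : expR 1 <= 3 :> R.
Proof.
have := @expRN1_ge R; rewrite expRN => h.
have e0 := expR_gt0 (1 : R).
by rewrite -[leLHS]invrK invf_ple ?posrE ?invr_gt0//; lra.
Qed.

(** Here y <= (2 e p / s)^(1 / 4), so that p L <= (2 e p / s)^(1 / 2) s^2, while
ell^2 is at most 16 (2 e p / s)^(1 / 2).  This is why s dominates L by any power
of the logarithm in this regime. *)
Lemma sparse_small_L (s p L y ell : R) : 0 < s -> 0 < p -> 0 < L ->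
  p * L = (y * s) ^+ 2 -> 0 < y -> ell = ln (2 * expR 1 * p / s) -> 0 <= ell ->
  ln (1 + y) < ell / 4 -> L * ell ^+ 2 <= 96 * s.
Proof.
move=> s0 p0 L0 pL y0 ellE ell0 hy.
have w0 : 0 < 2 * expR 1 * p / s by rewrite divr_gt0// !mulr_gt0// expR_gt0.
have yle : y <= expR (ell / 4).
  apply: (@le_trans _ _ (expR (ln (1 + y)))); last by rewrite ler_expR ltW.
  by rewrite lnK ?posrE; lra.
set e := expR (ell / 4) in yle *.
have e0 : 0 < e by exact: expR_gt0.
have e4 : e ^+ 4 = 2 * expR 1 * p / s.
  by rewrite /e -expRM_natl -[RHS]lnK ?posrE// -ellE; congr expR; lra.
have ele : ell <= 4 * e by have := @expR_ge1Dx R (ell / 4); rewrite -/e; lra.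
have e3 := expR1_le3.
have e4' : e ^+ 4 * s = 2 * expR 1 * p by rewrite e4 divfK ?gt_eqF.
have ell2 : ell ^+ 2 <= 16 * e ^+ 2 by nra.
have y2 : y ^+ 2 <= e ^+ 2 by rewrite ler_sqr ?nnegrE ?(ltW y0) ?(ltW e0).
have e2 : 0 < e ^+ 2 by rewrite exprn_gt0.
(* p L ell^2 <= y^2 s^2 16 e^2 <= 16 e^4 s^2 = 32 exp(1) p s *)
have h1 : p * L * ell ^+ 2 <= 16 * (e ^+ 4 * s) * s.
  rewrite pL exprMn.
  have h2 : y ^+ 2 * s ^+ 2 * ell ^+ 2 <= e ^+ 2 * s ^+ 2 * (16 * e ^+ 2).
    apply: ler_pM => //; first by rewrite mulr_ge0 ?sqr_ge0.
    - exact: sqr_ge0.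
    - by rewrite ler_pM2r// exprn_gt0.
  apply: le_trans h2 _; rewrite le_eqVlt; apply/orP; left; apply/eqP; ring.
rewrite e4' in h1.
rewrite -(ler_pM2l p0).
have h3 : 0 < p * s by rewrite mulr_gt0.
have : expR 1 * (p * s) <= 3 * (p * s) by rewrite ler_pM2r.
lra.
Qed.

End Sparse.

Section CombinedPower.
Context {R : realType} d (T : measurableType d) (P : probability T R).
Context (n p : nat) (sigma delta : R) (Y : T -> 'M[R]_(p, n)) (l r : nat).
Context (u : 'I_p -> R) (Z : 'I_p -> T -> R) (L : R).
Hypothesis indZ : std_gaussian P Z.
Hypothesis cusumY : forall w i, cusum sigma (Y w) l r i 0 = u i + Z i w.
Hypothesis d01 : 0 < delta < 1.
Hypothesis p0 : (0 < p)%N.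
Hypothesis r1 : (1 <= r)%N.
Hypothesis rn : (2 * r <= n)%N.
Hypothesis L0 : 1 / 2 <= L.
Hypothesis LLr : L <= ln (n%:R / (r%:R * delta)) <= 4 * L.
Hypothesis L2r : ln (2 * n%:R / (r%:R * delta)) <= 5 * L.
Hypothesis Dr : ((size (locations n r)) * r <= 2 * n)%N.
Hypothesis D0 : (0 < size (locations n r))%N.

Let s := #|[set i | u i != 0]%SET|.
Hypothesis s0 : (0 < s)%N.
Let y : R := Num.sqrt p%:R / s%:R * Num.sqrt L.
Let K : R := 2 * 10 ^+ 9.
Hypothesis energy : K * (s%:R * ln (1 + y) + L) <= \sum_i u i ^+ 2.

Let sp : 0 < s%:R :> R. Proof. by rewrite ltr0n. Qed.
Let pp : 0 < p%:R :> R. Proof. by rewrite ltr0n. Qed.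
Let Lp : 0 < L. Proof. by have := L0; lra. Qed.
Let yp : 0 < y. Proof. by rewrite /y mulr_gt0 ?divr_gt0 ?sqrtr_gt0. Qed.
Let pL : Num.sqrt (p%:R * L) = y * s%:R.
Proof. by rewrite sqrtrM// /y; field; rewrite gt_eqF. Qed.
Let sle : s%:R <= p%:R :> R.
Proof. by rewrite ler_nat -[leqRHS]card_ord max_card. Qed.
Let ell : R := ln (2 * expR 1 * p%:R / s%:R).

Let notT := [set w | ~ combined_test sigma delta (Y w) l r].

Let by_test (A : set T) : measurable A ->
  (forall w, A w -> combined_test sigma delta (Y w) l r) ->
  (P (~` A) <= (expR (- L))%:E)%E -> (P notT <= (expR (- L))%:E)%E.
Proof.
move=> mA hA; apply: le_trans; apply: le_measure; rewrite ?inE.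
- exact: measurableC (measurable_combined_test delta indZ cusumY p0).
- exact: measurableC.
- by move=> w h1 h2; apply: h1; exact: hA.
Qed.

Let by_partial : (P [set w | ~ partial_norm_test sigma delta (Y w) l r] <= (expR (- L))%:E)%E ->
  (P notT <= (expR (- L))%:E)%E.
Proof.
apply: (by_test (measurable_partial_norm_test delta indZ cusumY p0)) => w.
by constructor 3.
Qed.

Let ln_half : 1 < y -> 1 / 2 <= ln (1 + y).
Proof.
move=> y1; apply: le_trans (@ln2_ge R) _.
by rewrite ler_ln ?posrE//; lra.
Qed.

Let ell1 : 1 <= ell.
Proof.
rewrite -[leLHS]expRK ler_ln ?posrE ?divr_gt0 ?mulr_gt0 ?expR_gt0//.
rewrite ler_pdivlMr//.
have := ler_wpM2l (expR_ge0 (1 : R)) sle; have := mulr_gt0 (expR_gt0 (1 : R)) pp; lra.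
Qed.

Let supp_energy (J : {set 'I_p}) : (forall i, u i != 0 -> i \in J) ->
  \sum_i u i ^+ 2 = \sum_(i in J) u i ^+ 2.
Proof.
move=> hJ; rewrite [RHS]big_mkcond /=; apply: eq_bigr => i _.
case: ifP => // iJ; have [->|/hJ] := eqVneq (u i) 0; first by rewrite expr0n.
by rewrite iJ.
Qed.

(** Here log(1 + y) >= y / 2, so the energy exceeds a multiple of sqrt(p L) + L. *)
Let dense_case : y <= 1 -> (P notT <= (expR (- L))%:E)%E.
Proof.
move=> y1; apply: (by_test (measurable_dense_test delta indZ cusumY)) => [w|].
  by constructor 1.
apply: (dense_power indZ cusumY) => //.
have h : y / 2 <= ln (1 + y).
  have := @ln_ge R (1 + y) ltac:(have := yp; lra).
  have : y / 2 <= 1 - (1 + y)^-1.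
    rewrite (_ : 1 - (1 + y)^-1 = y / (1 + y)); last by field; have := yp; lra.
    by rewrite ler_pM2l// lef_pV2 ?posrE//; have := yp; lra.
  lra.
have h2 : s%:R * (y / 2) <= s%:R * ln (1 + y) by rewrite ler_pM2l.
have := energy; rewrite pL /K; have := Lp.
have : 0 < y * s%:R by exact: mulr_gt0.
lra.
Qed.

Let sparse_case : 1 < y -> ell / 4 <= ln (1 + y) -> (P notT <= (expR (- L))%:E)%E.
Proof.
move=> y1 hl; apply: by_partial; apply: (partial_power indZ cusumY p0 LLr (J := [set i | u i != 0]%SET)) => //.
rewrite -/s -/ell -supp_energy; last by move=> i; rewrite inE.
have h2 : s%:R * (ell / 4) <= s%:R * ln (1 + y) by rewrite ler_pM2l.
have : 0 < s%:R * ell by rewrite mulr_gt0//; have := ell1; lra.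
have := energy; rewrite /K; have := Lp; lra.
Qed.

Let X : R := 8 * Num.sqrt ell.
Let JX := [set i | X <= `|u i|]%SET.

(** Coordinates above X have squares at least 64 ell.  Replacing s by the smaller
size m of [JX] in the logarithm costs m log(s / m) <= s. *)
Let big_case : 64 * s%:R + 144 * L <= \sum_(i in JX) u i ^+ 2 -> (P notT <= (expR (- L))%:E)%E.
Proof.
move=> hE.
have ell0 : 0 < ell by have := ell1; lra.
have X0 : 0 < X by rewrite /X mulr_gt0// sqrtr_gt0.
have X2 : X ^+ 2 = 64 * ell.
  by rewrite /X exprMn sqr_sqrtr ?ltW//; ring.
have m0 : (0 < #|JX|)%N.
  rewrite lt0n cards_eq0; apply/eqP => J0; move: hE; rewrite J0 big_set0.
  have := sp; have := Lp; lra.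
have mp : 0 < #|JX|%:R :> R by rewrite ltr0n.
have ms : #|JX|%:R <= s%:R :> R.
  rewrite ler_nat; apply: subset_leq_card; apply/fintype.subsetP => i; rewrite !inE => h.
  by rewrite -normr_gt0; apply: lt_le_trans h.
have mX : #|JX|%:R * (64 * ell) <= \sum_(i in JX) u i ^+ 2.
  rewrite -X2 mulr_natl -sumr_const; apply: ler_sum => i; rewrite inE => h.
  by rewrite -[leRHS]real_normK ?num_real// ler_sqr ?nnegrE// ltW.
apply: by_partial; apply: (partial_power indZ cusumY p0 LLr (J := JX)) => //.
have -> : ln (2 * expR 1 * p%:R / #|JX|%:R) = ell + ln (s%:R / #|JX|%:R).
  rewrite -lnM ?posrE ?divr_gt0 ?mulr_gt0 ?expR_gt0//; congr ln; field.
  by rewrite !gt_eqF.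
have hs : #|JX|%:R * ln (s%:R / #|JX|%:R) <= s%:R :> R.
  have := ln_sublinear (divr_gt0 sp mp); rewrite ltr_pdivlMr// => h.
  by have := ltW h; lra.
lra.
Qed.

Let level_count (x : nat) := #|[set i | 2 * x%:R <= `|u i|]%SET|.

(** Coordinates in the support but below X, by [level_sum]. *)
Let rest_bound (x0 N : nat) : (1 <= x0 <= N)%N -> X <= 2 * N%:R ->
  \sum_(i in ~: JX) u i ^+ 2 <= 4 * x0%:R ^+ 2 * s%:R +
    \sum_(x0 <= x < N) (8 * x%:R + 4) * (level_count x)%:R.
Proof.
move=> x1N XN.
apply: (@le_trans _ _ (\sum_i (4 * x0%:R ^+ 2 * (u i != 0)%:R +
   \sum_(x0 <= x < N) (8 * x%:R + 4) * (2 * x%:R <= `|u i|)%R%:R))).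
  rewrite big_mkcond /=; apply: ler_sum => i _.
  have S0 : 0 <= \sum_(x0 <= x < N) (8 * x%:R + 4) * (2 * x%:R <= `|u i|)%R%:R :> R.
    by apply: sumr_ge0 => x _; rewrite mulr_ge0// addr_ge0// mulr_ge0.
  have A0 : 0 <= 4 * x0%:R ^+ 2 * (u i != 0)%:R :> R by rewrite !mulr_ge0 ?sqr_ge0.
  case: ifP => iJ; last by rewrite addr_ge0.
  have [ui|ui] := boolP (u i == 0).
    have -> : u i ^+ 2 = 0 by rewrite (eqP ui) expr0n.
    by rewrite mulr0 add0r.
  rewrite mulr1 -[leLHS]real_normK ?num_real//; apply: level_sum => //; first by case/andP: x1N.
  by move: iJ; rewrite !inE -ltNge => h; apply: lt_le_trans h XN.
rewrite big_split /= -mulr_sumr -natr_sum; apply: lerD.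
  by rewrite (_ : (\sum_i (u i != 0)%R)%N = s)// /s -sum1_card [RHS]big_mkcond /=;
    apply: eq_bigr => i _; rewrite inE; case: (u i != 0).
rewrite exchange_big /= le_eqVlt; apply/orP; left; apply/eqP; apply: eq_bigr => x _.
rewrite -mulr_sumr -natr_sum; congr (_ * _%:R).
by rewrite /level_count -sum1_card [RHS]big_mkcond /=; apply: eq_bigr => i _; rewrite inE; case: (_ <= _).
Qed.

(** If the number of coordinates above 2 x were below the requirement at every
level x, the energy below X would be at most a multiple of s log(1 + y): the
levels below x0 ~ sqrt(8 log(1 + y)) contribute that much, the Gaussian terms
above x0 are at most sqrt(p L) exp(- log(1 + y)) <= s up to a constant, and the
remaining terms at most L ell^2, which [sparse_small_L] bounds. *)
Let level_case : 1 < y -> ln (1 + y) < ell / 4 ->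
  \sum_(i in JX) u i ^+ 2 < 64 * s%:R + 144 * L ->
  exists2 x, (1 <= x)%N & bj_requirement p L x%:R <= (level_count x)%:R.
Proof.
move=> y1 hl hE; apply: contrapT => hno.
have small x : (1 <= x)%N -> (level_count x)%:R <= bj_requirement p L x%:R.
  by move=> x1; rewrite leNgt; apply/negP => h; apply: hno; exists x => //; exact: ltW.
set t := ln (1 + y) in hl *.
have t2 : 1 / 2 <= t by exact: ln_half.
have ell0 : 0 < ell by have := ell1; lra.
pose x0 := (Num.trunc (Num.sqrt (8 * t))).+1.
have x01 : (1 <= x0)%N by [].
have t8 : 0 <= 8 * t by lra.
have sq8 : Num.sqrt (8 * t) ^+ 2 = 8 * t by rewrite sqr_sqrtr.
have /andP[x0l x0r] := truncn_itv (sqrtr_ge0 (8 * t)).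
have x0l' : x0%:R <= Num.sqrt (8 * t) + 1 by rewrite /x0 -natr1 lerD2r.
have x0sq : x0%:R ^+ 2 <= 20 * t.
  have x00 : 0 <= x0%:R :> R by [].
  have := sqr_ge0 (Num.sqrt (8 * t) - 1); have := sqrtr_ge0 (8 * t); nra.
have x0sq' : 8 * t <= x0%:R ^+ 2.
  by rewrite -sq8 ler_sqr ?nnegrE ?sqrtr_ge0// ltW.
pose N0 := (Num.trunc (4 * Num.sqrt ell)).+1.
have se : Num.sqrt ell ^+ 2 = ell by rewrite sqr_sqrtr// ltW.
have se1 : 1 <= Num.sqrt ell.
  by rewrite -[leLHS]sqrtr1 ler_wsqrtr// ell1.
have /andP[N0l N0r] := @truncn_itv R (4 * Num.sqrt ell) ltac:(lra).
pose N := maxn N0 x0.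
have XN : X <= 2 * N%:R.
  have : N0%:R <= N%:R :> R by rewrite ler_nat leq_maxl.
  move: N0r; rewrite -/N0 /X; lra.
have N5 : N%:R <= 5 * Num.sqrt ell.
  have h1 : N0%:R <= 5 * Num.sqrt ell by rewrite /N0 -natr1; lra.
  have h2 : x0%:R <= 5 * Num.sqrt ell.
    have h5 : 0 <= 5 * Num.sqrt ell by lra.
    rewrite -ler_sqr ?nnegrE// exprMn se; lra.
  by rewrite /N /maxn; case: ifP.
have xN : (1 <= x0 <= N)%N by rewrite x01 leq_maxr.
have rest := rest_bound xN XN.
have LE : L * ell ^+ 2 <= 96 * s%:R.
  apply: (sparse_small_L sp pp Lp _ yp erefl (ltW ell0) hl).
  by rewrite -pL sqr_sqrtr// mulr_ge0// ltW.
pose q := y * s%:R.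
have q0 : 0 < q by exact: mulr_gt0.
have sumb : \sum_(x0 <= x < N) (8 * x%:R + 4) * (level_count x)%:R <=
    6 * 10 ^+ 4 * (\sum_(x0 <= x < N) (q * (x%:R ^+ 2 * expR (- (x%:R ^+ 2 / 4))) + L * x%:R ^+ 2)).
  rewrite mulr_sumr big_nat_cond [leRHS]big_nat_cond; apply: ler_sum => x /andP[/andP[xx _] _].
  have x1 : (1 <= x)%N by apply: leq_trans xx.
  have x1' : 1 <= x%:R :> R by rewrite ler1n.
  apply: (@le_trans _ _ (12 * x%:R * bj_requirement p L x%:R)).
    have c1 : 8 * x%:R + 4 <= 12 * x%:R :> R by lra.
    have c0 : 0 <= 8 * x%:R + 4 :> R by lra.
    exact: ler_pM c0 (ler0n _ _) c1 (small x x1).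
  by rewrite /bj_requirement pL -/q le_eqVlt; apply/orP; left; apply/eqP; ring.
have h1 : \sum_(x0 <= x < N) (q * (x%:R ^+ 2 * expR (- (x%:R ^+ 2 / 4)))) <= 256 * s%:R.
  rewrite -mulr_sumr.
  have g := @gauss_series R x0 N x01.
  have e : expR (- (x0%:R ^+ 2 / 8)) <= y^-1.
    apply: (@le_trans _ _ (expR (- t))); first by rewrite ler_expR; lra.
    rewrite expRN /t lnK ?posrE; last by lra.
    by rewrite lef_pV2 ?posrE//; lra.
  apply: le_trans (ler_wpM2l (ltW q0) g) _.
  have : q * (256 * expR (- (x0%:R ^+ 2 / 8))) <= q * (256 * y^-1).
    by rewrite ler_pM2l// ler_pM2l.
  move/le_trans; apply; rewrite /q le_eqVlt; apply/orP; left; apply/eqP; field.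
  by rewrite gt_eqF.
have h2 : \sum_(x0 <= x < N) L * x%:R ^+ 2 <= 12 * 10 ^+ 3 * s%:R.
  apply: (@le_trans _ _ (L * (N%:R * N%:R ^+ 2))).
    rewrite -mulr_sumr ler_pM2l//.
    apply: (@le_trans _ _ (\sum_(x0 <= x < N) N%:R ^+ 2)).
      rewrite big_nat_cond [leRHS]big_nat_cond; apply: ler_sum => x /andP[/andP[_ xx] _].
      by rewrite ler_sqr ?nnegrE// ler_nat ltnW.
    rewrite sumr_const_nat -[leLHS]mulr_natl ler_wpM2r ?sqr_ge0// ler_nat leq_subr //.
  have N2 : N%:R ^+ 2 <= 25 * ell.
    have N00 : 0 <= N%:R :> R by [].
    have h5 : 0 <= 5 * Num.sqrt ell by lra.
    have : N%:R ^+ 2 <= (5 * Num.sqrt ell) ^+ 2 by rewrite ler_sqr ?nnegrE.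
    rewrite exprMn se; lra.
  have N1 : N%:R <= 5 * ell by apply: le_trans N5 _; rewrite -{2}se; nra.
  have N3 : N%:R * N%:R ^+ 2 <= (5 * ell) * (25 * ell) by apply: ler_pM => //; exact: sqr_ge0.
  have : L * (N%:R * N%:R ^+ 2) <= L * ((5 * ell) * (25 * ell)) by rewrite ler_pM2l.
  lra.
rewrite big_split /= in sumb.
have tot : \sum_i u i ^+ 2 = \sum_(i in JX) u i ^+ 2 + \sum_(i in ~: JX) u i ^+ 2.
  by rewrite (bigID (mem JX)) /=; congr (_ + _); apply: eq_bigl => i; rewrite !inE.
have h3 : 4 * x0%:R ^+ 2 * s%:R <= 80 * (s%:R * t) by have := sp; nra.
have h4 : s%:R <= 2 * (s%:R * t) by have := sp; nra.
have := energy; rewrite tot -/t /K; have := Lp; have := sp; lra.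
Qed.

Lemma combined_power : (P notT <= (expR (- L))%:E)%E.
Proof.
have [y1|y1] := leP y 1; first exact: dense_case.
have [h|h] := leP (ell / 4) (ln (1 + y)); first exact: sparse_case.
have [hE|hE] := leP (64 * s%:R + 144 * L) (\sum_(i in JX) u i ^+ 2).
  exact: big_case.
have [x x1 hx] := level_case y1 h hE.
apply: (by_test (measurable_berk_jones_test delta indZ cusumY)) => [w|].
  by constructor 2.
exact: (bj_power indZ cusumY d01 p0 r1 rn L0 LLr L2r Dr D0 x1).
Qed.

End CombinedPower.

(** * The dyadic grid *)

Section Grid.
Implicit Types n r l j : nat.

Lemma scale_le n j : (0 < n)%N -> (j < scale_count n)%N -> (2 * 2 ^ j <= n)%N.
Proof.
move=> n0 jn; rewrite -expnS.
by apply: leq_trans (trunc_logP (isT : 1 < 2)%N n0); rewrite leq_exp2l.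
Qed.

Lemma pow2_half j : (2 ^ j.+1 %/ 2 = 2 ^ j)%N.
Proof. by rewrite expnS mulKn. Qed.

Lemma locations_range n j l : (0 < n)%N -> (j < scale_count n)%N ->
  l \in locations n (2 ^ j) -> (2 ^ j < l /\ l + 2 ^ j - 1 <= n)%N.
Proof.
move=> n0 jn; have rn := scale_le n0 jn; rewrite /locations.
case: j jn rn => [|j] jn rn; first by rewrite expn0 /= mem_index_iota; lia.
rewrite ifF; last by apply/negbTE; rewrite expnS; have := expn_gt0 2 j; lia.
rewrite mem_undup mem_rcons inE => /orP[/eqP ->|]; first by lia.
rewrite pow2_half => /mapP[m]; rewrite mem_index_iota => /andP[m2 mn] ->.
have r0 : (0 < 2 ^ j)%N by rewrite expn_gt0.
have hm : ((m + 2) * 2 ^ j.+1 <= 2 * n)%N.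
  have : (m + 2 <= (2 * n) %/ 2 ^ j.+1)%N by lia.
  by rewrite leq_divRL ?expn_gt0.
rewrite expnS in hm rn *; nia.
Qed.

Lemma locations_size n j : (2 <= n)%N -> (j < scale_count n)%N ->
  ((size (locations n (2 ^ j))) * 2 ^ j <= 2 * n)%N /\ (0 < size (locations n (2 ^ j)))%N.
Proof.
move=> n2 jn; have n0 : (0 < n)%N by lia.
have rn := scale_le n0 jn; rewrite /locations.
case: j jn rn => [|j] jn rn; first by rewrite expn0 /= size_iota; lia.
rewrite ifF; last by apply/negbTE; rewrite expnS; have := expn_gt0 2 j; lia.
split; last first.
  rewrite lt0n size_eq0; apply/eqP => h.
  have : (n - 2 ^ j.+1 + 1)%N \in undup (rcons [seq (m * (2 ^ j.+1 %/ 2) + 1)%N | m <- index_iota 2 ((2 * n) %/ 2 ^ j.+1 - 1)] (n - 2 ^ j.+1 + 1)%N).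
    by rewrite mem_undup mem_rcons mem_head.
  by rewrite h.
apply: (@leq_trans ((2 * n) %/ 2 ^ j.+1 * 2 ^ j.+1)); last exact: leq_trunc_div.
rewrite leq_mul2r; apply/orP; right; apply: leq_trans (size_undup _) _.
rewrite size_rcons size_map size_iota.
have : (2 <= (2 * n) %/ 2 ^ j.+1)%N by rewrite leq_divRL ?expn_gt0//; lia.
lia.
Qed.

(** Locations of scale 2^(j + 1) are spaced by 2^j. *)
Lemma locations_near n j t : (0 < n)%N -> (j.+1 < scale_count n)%N ->
  (2 * 2 ^ j.+1 + 1 <= t)%N -> (t + 2 * 2 ^ j.+1 <= n.+1)%N ->
  exists2 l, l \in locations n (2 ^ j.+1) & (l <= t < l + 2 ^ j)%N.
Proof.
move=> n0 jn t1 t2; have r0 : (0 < 2 ^ j)%N by rewrite expn_gt0.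
pose m := ((t - 1) %/ 2 ^ j)%N.
have m1 : (m * 2 ^ j <= t - 1)%N by exact: leq_trunc_div.
have m2 : (t - 1 < (m + 1) * 2 ^ j)%N by rewrite addn1; exact: ltn_ceil.
exists (m * 2 ^ j + 1)%N; last by lia.
rewrite /locations ifF; last by apply/negbTE; rewrite expnS; lia.
rewrite mem_undup mem_rcons inE; apply/orP; right; rewrite pow2_half.
apply/mapP; exists m => //; rewrite mem_index_iota.
have h1 : (2 <= m)%N by rewrite /m leq_divRL//; rewrite expnS in t1; lia.
have h2 : (m + 2 <= (2 * n) %/ 2 ^ j.+1)%N.
  rewrite leq_divRL ?expn_gt0// expnS; rewrite expnS in t2; nia.
lia.
Qed.

End Grid.

(** * Components of the covered set *)

Section Intervals.
Context {R : realType}.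
Implicit Types (C U : set R).

Lemma closed_inf C : C !=set0 -> has_lbound C -> closed C -> C (inf C).
Proof.
move=> C0 Cl clC; apply: clC => B /nbhs_ballP[e /= e0 eB].
have [x Cx xe] := inf_adherent e0 (conj C0 Cl).
exists x; split=> //; apply: eB; rewrite /ball/=.
rewrite distrC ger0_norm ?subr_ge0; last exact: inf_lbound.
by rewrite ltrBlDl.
Qed.

Lemma closed_sup C : C !=set0 -> has_ubound C -> closed C -> C (sup C).
Proof. by move=> C0 Cu clC; apply: clC; apply: closure_sup. Qed.

Lemma component_itv U lo hi x : closed U -> U `<=` `[lo, hi] -> U x ->
  let C := connected_component U x in
  [/\ lo <= inf C, sup C <= hi &
      forall y, C y <-> inf C <= y <= sup C].
Proof.
move=> clU Ub Ux C.
have CU : C `<=` U by exact: connected_component_sub.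
have Cx : C x by exact: connected_component_refl.
have C0 : C !=set0 by exists x.
have clC : closed C by exact: component_closed.
have Cl : lbound C lo by move=> y /CU/Ub; rewrite /= in_itv/= => /andP[].
have Cu : ubound C hi by move=> y /CU/Ub; rewrite /= in_itv/= => /andP[].
split; first exact: lb_le_inf.
  exact: ge_sup.
move=> y; split=> [Cy|yb].
  by rewrite inf_lbound//=; [apply: sup_ubound => //; exists hi|exists lo].
have /connected_intervalP : connected C by exact: component_connected.
apply; [apply: closed_inf => //; by exists lo|apply: closed_sup => //; by exists hi|exact: yb].
Qed.

End Intervals.

Section Geometry.
Context {R : realType} (n p : nat) (sigma delta : R) (Y : 'M[R]_(p, n)).
Hypothesis n0 : (0 < n)%N.

Notation J := (scale_count n).
Notation fires i l := (combined_test sigma delta Y l (2 ^ i)).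
Notation U := (covered sigma delta Y).
Notation picked i l := (selected sigma delta Y (2 ^ i) (U i) l).

Lemma coveredP j x : U j x <->
  exists i l, [/\ (i < j)%N, picked i l & window l (2 ^ i) x].
Proof.
elim: j => [|j IH] /=; first by split=> // -[i [l []]].
split=> [[/IH[i [l [ij pl wl]]]|[l pl wl]]|].
- by exists i, l; split=> //; exact: leqW.
- by exists j, l.
move=> [i [l [ij pl wl]]]; move: ij; rewrite ltnS leq_eqVlt => /orP[/eqP ij|ij].
  by subst i; right; exists l.
by left; apply/IH; exists i, l.
Qed.

(** The freedom in Q is used to close parts of the covered set. *)
Lemma closed_windows j (Q : nat -> set nat) :
  closed [set x : R | exists i l,
    [/\ (i < j)%N, l \in locations n (2 ^ i), Q i l & window l (2 ^ i) x]].
Proof.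
rewrite (_ : [set x | _] = \bigcup_(i in `I_j)
    \bigcup_(l in [set` locations n (2 ^ i)] `&` Q i) window l (2 ^ i)).
  apply: closed_bigcup => [|i _]; first exact: finite_II.
  apply: closed_bigcup => [|l _]; last exact: interval_closed.
  by apply: finite_setIl; exact: finite_seq.
apply/seteqP; split=> x /=.
  by move=> [i [l [ij lD Ql wx]]]; exists i => //; exists l.
by move=> [i ij [l [lD Ql] wx]]; exists i, l.
Qed.

Lemma covered_closed j : closed (U j).
Proof.
rewrite (_ : U j = [set x : R | exists i l,
    [/\ (i < j)%N, l \in locations n (2 ^ i), picked i l & window l (2 ^ i) x]]).
  exact: (@closed_windows j (fun i => selected sigma delta Y (2 ^ i) (U i))).
apply/seteqP; split=> x; rewrite coveredP => -[i [l]].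
  by move=> [ij pl wx]; exists i, l; split=> //; case: pl.
by move=> [ij _ pl wx]; exists i, l.
Qed.

(** A window is only selected if it misses the smaller scales. *)
Lemma picked_disjoint i i' l l' (x : R) : (i < i')%N -> picked i l -> picked i' l' ->
  window l (2 ^ i) x -> window l' (2 ^ i') x -> False.
Proof.
move=> ii' pl [_ _ dj] wx wx'.
have : (window l' (2 ^ i') `&` U i') x by split=> //; apply/coveredP; exists i, l.
by rewrite dj.
Qed.

Lemma windowE l r (x : R) : window l r x <-> l%:R - r%:R + 1 <= x <= l%:R + r%:R - 1.
Proof. by rewrite /window /= in_itv. Qed.

Lemma covered_sub : U J `<=` `[2, n%:R].
Proof.
move=> x /coveredP[i [l [ij [lD _ _] /windowE wx]]].
have [h1 h2] := locations_range n0 ij lD.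
rewrite /= in_itv/=.
have : (l + 2 ^ i)%:R <= (n + 1)%:R :> R by rewrite ler_nat; lia.
have : (2 ^ i + 1)%:R <= l%:R :> R by rewrite ler_nat; lia.
rewrite !natrD => ? ?; lra.
Qed.

Lemma component_of x : U J x ->
  let C := connected_component (U J) x in
  [/\ 2 <= inf C, sup C <= n%:R & forall y, C y <-> inf C <= y <= sup C].
Proof.
move=> Ux; apply: component_itv => //; first exact: covered_closed.
exact: covered_sub.
Qed.

Section NoSpurious.
Variables (cp : set nat).
Hypothesis nofalse : forall i l, (i < J)%N -> l \in locations n (2 ^ i) ->
  fires i l -> exists2 c : nat, cp c & window l (2 ^ i) (c%:R : R).

(** A component contains a whole selected window. *)
Lemma component_change x : U J x ->
  exists2 c : nat, cp c & connected_component (U J) x c%:R.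
Proof.
move=> Ux; have /coveredP[i [l [ij pl wx]]] := Ux.
have [lD Tl _] := pl; have [c cc wc] := nofalse ij lD Tl.
exists c => //; apply: (@connected_component_max _ _ (window l (2 ^ i))) => //.
  by move=> y wy; apply/coveredP; exists i, l.
exact: segment_connected.
Qed.

(** A is the union of the selected windows of scale i' that contain t, and B the
union of all the others.  Both are closed and they are disjoint: windows of
different scales never meet, and a window of scale i' that misses t contains
another change-point, too far away.  So the component of t lies in A. *)
Lemma localization i l (t : nat) : (i < J)%N -> l \in locations n (2 ^ i) ->
  fires i l -> window l (2 ^ i) (t%:R : R) ->
  (forall c : nat, cp c -> `|c%:R - t%:R| <= 4 * ((2 ^ i)%:R - 1) :> R -> c = t) ->
  exists2 C, estimated_components sigma delta Y C &
    `|midpoint C - t%:R| <= (2 ^ i)%:R - 1.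
Proof.
move=> iJ lD Tl wt iso.
have iso' (i' : nat) (c : nat) : (i' <= i)%N -> cp c ->
    `|c%:R - t%:R| <= 4 * ((2 ^ i')%:R - 1) :> R -> c = t.
  move=> ii' cc h; apply: iso => //; apply: le_trans h _.
  by rewrite ler_pM2l// lerD2r ler_nat leq_exp2l.
(* the window that has been selected around t, at scale i or below *)
have [i' [l' [ii' pl' wt']]] : exists i' l',
    [/\ (i' <= i)%N, picked i' l' & window l' (2 ^ i') (t%:R : R)].
  have [dj|/set0P] := eqVneq (window l (2 ^ i) `&` U i) set0.
    by exists i, l.
  move=> [x [/windowE wx /coveredP[i' [l' [ii' pl' /windowE wx']]]]].
  have [lD' Tl' _] := pl'.
  have [c cc /windowE wc] := nofalse (ltn_trans ii' iJ) lD' Tl'.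
  have h : (2 * 2 ^ i')%:R <= (2 ^ i)%:R :> R by rewrite ler_nat -expnS leq_exp2l.
  have h1 : 1 <= (2 ^ i')%:R :> R by rewrite ler1n expn_gt0.
  move: wt => /windowE wt; rewrite natrM in h.
  have ct : c = t.
    by apply: iso => //; rewrite ler_norml; apply/andP; split; lra.
  exists i', l'; split=> //; first exact: ltnW.
  by apply/windowE; rewrite -ct.
pose A := [set x : R | exists j m, [/\ (j < J)%N, m \in locations n (2 ^ j),
   [/\ picked j m, j = i' & window m (2 ^ i') (t%:R : R)] & window m (2 ^ j) x]].
pose B := [set x : R | exists j m, [/\ (j < J)%N, m \in locations n (2 ^ j),
   picked j m /\ ~ (j = i' /\ window m (2 ^ i') (t%:R : R)) & window m (2 ^ j) x]].
have clA : closed A.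
  exact: (@closed_windows J (fun j m =>
    [/\ picked j m, j = i' & window m (2 ^ i') (t%:R : R)])).
have clB : closed B.
  exact: (@closed_windows J (fun j m =>
    picked j m /\ ~ (j = i' /\ window m (2 ^ i') (t%:R : R)))).
have i'J : (i' < J)%N by exact: leq_ltn_trans iJ.
have AB : A `&` B = set0.
  apply/seteqP; split=> // x [[k [m [_ _ [pm ki wm] wx]]]]; subst k.
  move=> [j [m' [jJ mD' [pm' nm'] wx']]].
  have [jlt|jgt|ji] := ltngtP j i'.
  - exact: (picked_disjoint jlt pm' pm wx').
  - exact: (picked_disjoint jgt pm pm' wx).
  subst j; apply: nm'; split=> //.
  have [_ Tm' _] := pm'.
  have [c cc wc] := nofalse jJ mD' Tm'.
  suff ct : c = t by rewrite -ct.
  apply: (iso' i') => //; rewrite ler_norml.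
  move/windowE : wm => wm; move/windowE : wx => wx; move/windowE : wx' => wx'.
  by move/windowE : wc => wc; apply/andP; split; lra.
have sep : separated A B by split; rewrite -?((closure_id _).1 clA) -?((closure_id _).1 clB).
have UAB : U J `<=` A `|` B.
  move=> x /coveredP[j [m [jJ pm wx]]].
  have mD : m \in locations n (2 ^ j) by case: pm.
  have [[ji wm]|h] := pselect (j = i' /\ window m (2 ^ i') (t%:R : R)).
    by left; exists j, m.
  by right; exists j, m.
have At : A t%:R.
  by exists i', l'; split=> //; case: pl'.
have Ut : U J t%:R by apply/coveredP; exists i', l'.
have CA : connected_component (U J) t%:R `<=` A.
  have [//|CB] : connected_component (U J) t%:R `<=` A \/
                 connected_component (U J) t%:R `<=` B.
    apply: (connected_subset sep); last exact: component_connected.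
    exact: subset_trans (@connected_component_sub _ _ _) UAB.
  have Bt : B t%:R by apply: CB; exact: connected_component_refl.
  by exfalso; have : (A `&` B) t%:R by []; rewrite AB.
have Asub x : A x -> `|x - t%:R| <= 2 * ((2 ^ i')%:R - 1).
  move=> [k [m [_ _ [_ ki /windowE wm] /windowE wx]]]; subst k.
  by rewrite ler_norml; apply/andP; split; lra.
exists (connected_component (U J) t%:R).
  by exists t%:R.
have [_ _ itvC] := component_of Ut.
set C := connected_component (U J) t%:R in CA itvC *.
have Ct : inf C <= t%:R <= sup C by apply/itvC; exact: connected_component_refl.
have Ci : C (inf C) by apply/itvC; rewrite lexx/=; lra.
have Cs : C (sup C) by apply/itvC; rewrite lexx andbT; lra.
have := Asub _ (CA _ Ci); have := Asub _ (CA _ Cs); rewrite !ler_norml.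
have : (2 ^ i')%:R <= (2 ^ i)%:R :> R by rewrite ler_nat leq_exp2l.
by rewrite /midpoint => ? ? ?; apply/andP; split; lra.
Qed.

End NoSpurious.
End Geometry.

(** * Change-points and spurious components *)

Section ChangePoints.
Context {R : realType} (n p : nat).
Variables (Theta : 'M[R]_(p, n)) (K : nat) (tau : nat -> nat) (mu : nat -> 'cV[R]_p).
Hypothesis cpt : change_points Theta K tau mu.

Definition change_set : set nat := [set c | exists2 k, (1 <= k <= K)%N & c = tau k].

Lemma tau_mono i j : (i <= j)%N -> (j <= K.+1)%N -> (tau i <= tau j)%N.
Proof.
have [_ _ inc _ _] := cpt.
elim: j => [|j IH]; first by rewrite leqn0 => /eqP ->.
rewrite leq_eqVlt => /orP[/eqP -> //|ij] jK.
by apply: leq_trans (IH ij (ltnW jK)) (ltnW (inc _ _)).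
Qed.

Lemma spacing_gap k c : (1 <= k <= K)%N -> change_set c -> c != tau k ->
  (tau k + spacing tau k <= c)%N || (c + spacing tau k <= tau k)%N.
Proof.
move=> /andP[k1 kK] [j /andP[j1 jK] ->] jk; rewrite /spacing.
have [_ _ inc _ _] := cpt.
have h1 := inc k kK.
have [jlt|jgt|je] := ltngtP j k; last by rewrite je eqxx in jk.
  have h2 : (tau j <= tau k.-1)%N by apply: tau_mono; lia.
  have := inc k.-1 ltac:(lia); rewrite prednK// => h3; apply/orP; right; lia.
have h2 : (tau k.+1 <= tau j)%N by apply: tau_mono; lia.
by apply/orP; left; lia.
Qed.

(** If the component reaches a change-point beyond the cell of tau_k, its other end
must be on the other side of tau_k for the midpoint to be in the cell. *)
Lemma no_spurious_of sigma delta (Y : 'M[R]_(p, n)) : (0 < n)%N ->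
  (forall i l, (i < scale_count n)%N -> l \in locations n (2 ^ i) ->
    combined_test sigma delta Y l (2 ^ i) ->
    exists2 c : nat, change_set c & window l (2 ^ i) (c%:R : R)) ->
  no_spurious n K tau (estimated_components sigma delta Y).
Proof.
move=> n0 nofalse; rewrite /no_spurious.
have [tau0 tauK inc _ _] := cpt.
case: ifPn => [/eqP K0|K1].
  apply/seteqP; split=> // C [x Ux _].
  have [c [k kK _] _] := component_change nofalse Ux.
  by move: kK; rewrite K0; lia.
have key x : covered sigma delta Y (scale_count n) x ->
    let C := connected_component (covered sigma delta Y (scale_count n)) x in
    exists2 j, (1 <= j <= K)%N & 2 <= inf C <= (tau j)%:R /\ (tau j)%:R <= sup C <= n%:R.
  move=> Ux C; have [h2 hn itv] := component_of n0 Ux.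
  have [c [j jK ->] Cc] := component_change nofalse Ux.
  exists j => //; move/itv: Cc => /andP[c1 c2].
  by rewrite h2 c1 c2 hn.
split; last first.
  move=> _ [x Ux <-]; have [j /andP[j1 jK] [/andP[a2 aj] /andP[jb bn]]] := key _ Ux.
  have h1 : (tau 1)%:R <= (tau j)%:R :> R by rewrite ler_nat; apply: tau_mono; lia.
  have h2 : (tau j)%:R <= (tau K)%:R :> R by rewrite ler_nat; apply: tau_mono; lia.
  by rewrite in_itv/= /midpoint; apply/andP; split; lra.
move=> k /andP[k1 kK].
(* the component contains tau_k as soon as its midpoint is in the cell *)
suff key2 x : covered sigma delta Y (scale_count n) x ->
    midpoint (connected_component (covered sigma delta Y (scale_count n)) x) \in
      `[(tau k)%:R - ((tau k)%:R - (tau k.-1)%:R) / 2,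
             (tau k)%:R + ((tau k.+1)%:R - (tau k)%:R) / 2] ->
    connected_component (covered sigma delta Y (scale_count n)) x (tau k)%:R.
  move=> _ _ [[x Ux <-] /(key2 _ Ux) hx] [[y Uy <-] /(key2 _ Uy) hy].
  by rewrite (same_connected_component hx) (same_connected_component hy).
move=> Ux; have [j /andP[j1 jK] [/andP[a2 aj] /andP[jb bn]]] := key _ Ux.
have [_ _ itv] := component_of n0 Ux.
rewrite in_itv/= /midpoint => /andP[m1 m2]; apply/itv.
have [jlt|jgt|je] := ltngtP j k; last by rewrite -je aj.
  have h2 : (tau j)%:R <= (tau k.-1)%:R :> R by rewrite ler_nat; apply: tau_mono; lia.
  have h3 : (tau k.-1)%:R <= (tau k)%:R :> R by rewrite ler_nat; apply: tau_mono; lia.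
  by apply/andP; split; lra.
have h2 : (tau k.+1)%:R <= (tau j)%:R :> R by rewrite ler_nat; apply: tau_mono; lia.
have h3 : (tau k)%:R <= (tau k.+1)%:R :> R by rewrite ler_nat; apply: tau_mono; lia.
by apply/andP; split; lra.
Qed.

(** A spacing is at most the length of the segment on its left. *)
Lemma spacing_sum : (\sum_(1 <= k < K.+1) spacing tau k <= n)%N.
Proof.
have [tau0 tauK inc _ _] := cpt.
have h : (1 + \sum_(1 <= k < K.+1) spacing tau k <= tau K)%N.
  have : (K <= K)%N by [].
  elim: {-2}K => [|k IH] kK; first by rewrite big_geq// tau0.
  rewrite big_nat_recr//= addnA; have := IH (ltnW kK).
  have := inc k (ltnW kK); rewrite /spacing/=; lia.
have := inc K (leqnn _); rewrite tauK; lia.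
Qed.

Lemma spacing_range k : (1 <= k <= K)%N ->
  (0 < spacing tau k)%N /\ (1 + spacing tau k <= tau k)%N /\
  (tau k + spacing tau k <= n.+1)%N.
Proof.
move=> /andP[k1 kK]; have [tau0 tauK inc _ _] := cpt.
have h1 := inc k kK; have := inc k.-1 ltac:(lia); rewrite prednK// => h2.
have h3 : (tau 0 <= tau k.-1)%N by apply: tau_mono; lia.
have h4 : (tau k.+1 <= tau K.+1)%N by apply: tau_mono; lia.
rewrite /spacing; lia.
Qed.

End ChangePoints.

(** * False alarms over the grid *)

Section Numeric.
Context {R : realType}.

Lemma geometric_bound (q c : R) J : 0 <= q -> q * c + q <= c ->  0 <= c ->
  \sum_(j < J) q ^+ (J - j) <= c.
Proof.
move=> q0 qc c0; elim: J => [|J IH]; first by rewrite big_ord0.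
rewrite big_ord_recr /= subSnn expr1; apply: le_trans qc; rewrite lerD2r.
apply: le_trans (ler_wpM2l q0 IH); rewrite mulr_sumr; apply: ler_sum => j _.
by rewrite -exprS subSn// ltnW.
Qed.

Lemma expR_ln2_le : expR (- (3 / 4 * ln 2)) <= 3 / 5 :> R.
Proof.
have q0 : (0 : R) <= 3 / 5 by lra.
rewrite -(@ler_pXn2r _ 4) ?nnegrE ?expR_ge0//.
rewrite -expRM_natl.
rewrite mulrN mulrA (_ : 4%:R * (3 / 4) = 3%:R :> R); last by field.
rewrite expRN expRM_natl lnK ?posrE//.
rewrite (_ : 2 ^+ 3 = 8); last by rewrite -natrX.
by rewrite (_ : (3 / 5) ^+ 4 = 81 / 625); [lra|field].
Qed.

End Numeric.

Section FalseAlarm.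
Context {R : realType} d (T : measurableType d) (P : probability T R).
Context (n p : nat) (sigma delta : R) (Theta : 'M[R]_(p, n)).
Variables (K : nat) (tau : nat -> nat) (mu : nat -> 'cV[R]_p).
Variable eps : 'I_p -> 'I_n -> {RV P >-> R}.
Hypothesis n2 : (2 <= n)%N.
Hypothesis p0 : (1 <= p)%N.
Hypothesis s0 : 0 < sigma.
Hypothesis d01 : 0 < delta < 1.
Hypothesis cpt : change_points Theta K tau mu.
Hypothesis noise : gaussian_noise sigma eps.

Notation Y := (observation Theta eps).
Notation J := (scale_count n).
Notation hit i l := (exists2 c : nat, change_set K tau c & window l (2 ^ i) (c%:R : R)).

Let n0 : (0 < n)%N. Proof. by lia. Qed.

Lemma segment_of x : (1 <= x <= n)%N -> exists2 k, (k <= K)%N & (tau k <= x < tau k.+1)%N.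
Proof.
have [tau0 tauK _ _ _] := cpt => /andP[x1 xn].
suff H m : (m <= K.+1)%N -> (x < tau m)%N -> exists2 k, (k <= K)%N & (tau k <= x < tau k.+1)%N.
  by apply: (H K.+1) => //; rewrite tauK; lia.
elim: m => [|m IH] mK xm; first by move: xm; rewrite tau0; lia.
have [h|h] := ltnP x (tau m); first by apply: IH => //; exact: ltnW.
by exists m => //; rewrite h.
Qed.

Lemma mean_constant i l : (i < J)%N -> l \in locations n (2 ^ i) -> ~ hit i l ->
  exists m, forall t : 'I_n, (l - 2 ^ i <= t.+1 <= l + 2 ^ i - 1)%N -> col t Theta = m.
Proof.
move=> iJ lD nohit; have [h1 h2] := locations_range n0 iJ lD.
have r1 : (0 < 2 ^ i)%N by rewrite expn_gt0.
have [k kK /andP[k1 k2]] := @segment_of (l - 2 ^ i) ltac:(lia).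
have [tau0 tauK _ const _] := cpt.
exists (mu k) => t /andP[t1 t2]; apply: const => //.
apply/andP; split; first by lia.
have [kK'|kK'] := ltnP k K; last first.
  have -> : k = K by lia.
  by rewrite tauK; exact: ltn_ord.
rewrite ltnNge; apply/negP => h; apply: nohit; exists (tau k.+1).
  by exists k.+1.
apply/windowE.
have : (l + 1)%:R <= (tau k.+1 + 2 ^ i)%:R :> R by rewrite ler_nat; lia.
have : (tau k.+1 + 1)%:R <= (l + 2 ^ i)%:R :> R by rewrite ler_nat; lia.
rewrite !natrD => ? ?; apply/andP; split; lra.
Qed.

Lemma measurable_fires i l : (i < J)%N -> l \in locations n (2 ^ i) ->
  measurable [set w | combined_test sigma delta (Y w) l (2 ^ i)].
Proof.
move=> iJ lD; have [h1 h2] := locations_range n0 iJ lD.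
have r1 : (0 < 2 ^ i)%N by rewrite expn_gt0.
have G := std_gaussian_cusum_noise s0 noise r1 h1 h2.
apply: (measurable_combined_test delta (u := fun k => cusum sigma Theta l (2 ^ i) k 0) G) => //.
by move=> w k; exact: cusum_observation.
Qed.

(** The sum of the levels of the dense, Berk-Jones and partial norm tests. *)
Definition alarm_bound (i : nat) : R :=
  expR (- (2 * ln (2 * n%:R / ((2 ^ i)%:R * delta)))) +
  4 / 3 * (delta * (2 ^ i)%:R / ((size (locations n (2 ^ i)))%:R * n%:R)) +
  expR (- (7 / 4 * ln (n%:R / ((2 ^ i)%:R * delta)))).

Lemma alarm_bound_ge0 i : 0 <= alarm_bound i.
Proof.
have d0 : 0 <= delta by case/andP: d01 => /ltW.
by rewrite !addr_ge0 ?expR_ge0// mulr_ge0// ?divr_ge0 ?mulr_ge0.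
Qed.

Lemma false_alarm i l : (i < J)%N -> l \in locations n (2 ^ i) -> ~ hit i l ->
  (P [set w | combined_test sigma delta (Y w) l (2 ^ i)] <= (alarm_bound i)%:E)%E.
Proof.
move=> iJ lD nohit; have [h1 h2] := locations_range n0 iJ lD.
have r1 : (0 < 2 ^ i)%N by rewrite expn_gt0.
have rn := scale_le n0 iJ.
have [_ D0] := locations_size n2 iJ.
have [m hm] := mean_constant iJ lD nohit.
have G := std_gaussian_cusum_noise s0 noise r1 h1 h2.
have cY w k : cusum sigma (Y w) l (2 ^ i) k 0 = 0 + cusum_noise sigma eps l (2 ^ i) k w.
  by rewrite cusum_observation// (cusum_constant k s0 r1 h1 h2 hm).
rewrite combined_testU.
have md := measurable_dense_test delta G cY.
have mb := measurable_berk_jones_test delta G cY.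
have mp := measurable_partial_norm_test delta G cY p0.
apply: le_trans (measureU2 _ _ _) _ => //; first exact: measurableU.
rewrite /alarm_bound EFinD; apply: leeD; last exact: (null_partial delta G cY p0).
apply: le_trans (measureU2 _ _ _) _ => //.
rewrite EFinD; apply: leeD; first exact: (null_dense G cY).
exact: (null_bj G cY).
Qed.

(** With r = 2^i, both r / n and the power 3 / 4 of it decay geometrically in
J - i, since n >= 2^J. *)
Lemma alarm_scale i : (i < J)%N ->
  (size (locations n (2 ^ i)))%:R * alarm_bound i <=
  delta * (11 / 6 * (1 / 2) ^+ (J - i) + 2 * (3 / 5) ^+ (J - i)).
Proof.
move=> iJ; rewrite /alarm_bound.
have [Dr D0] := locations_size n2 iJ.
have rn := scale_le n0 iJ.
set r := (2 ^ i)%N in Dr rn *; set D := size _ in Dr D0 *.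
have [d0 d1] := andP d01.
have r0 : 0 < r%:R :> R by rewrite ltr0n expn_gt0.
have nn : 0 < n%:R :> R by rewrite ltr0n.
have DD : 0 < D%:R :> R by rewrite ltr0n.
have DrR : D%:R * r%:R <= 2 * n%:R :> R by rewrite -!natrM ler_nat.
have q1 : r%:R / n%:R <= (1 / 2) ^+ (J - i) :> R.
  rewrite ler_pdivrMr// mul1r exprVn ler_pdivlMl ?exprn_gt0//.
  rewrite -natrX -natrM ler_nat -expnD subnK; last exact: ltnW.
  exact: trunc_logP.
have y0 : 0 < n%:R / (r%:R * delta) by rewrite divr_gt0// mulr_gt0.
have y20 : 0 < 2 * n%:R / (r%:R * delta) by rewrite divr_gt0// mulr_gt0.
have e1 : D%:R * expR (- (2 * ln (2 * n%:R / (r%:R * delta)))) <=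
    delta * (1 / 2 * (r%:R / n%:R)).
  rewrite expRN expRM_natl lnK ?posrE// -exprVn invf_div expr2.
  apply: le_trans (_ : 2 * n%:R / r%:R * (r%:R * delta / (2 * n%:R) * (r%:R * delta / (2 * n%:R))) <= _).
    by apply: ler_wpM2r; [rewrite -expr2 sqr_ge0|rewrite ler_pdivlMr].
  rewrite (_ : 2 * n%:R / r%:R * _ = delta * (1 / 2 * (r%:R / n%:R)) * delta); last first.
    have := gt_eqF r0; have := gt_eqF nn; move: (r%:R : R) (n%:R : R) => a b bn an.
    by field; rewrite bn an.
  have h0 : 0 <= delta * (1 / 2 * (r%:R / n%:R)).
    by rewrite mulr_ge0 ?(ltW d0)// mulr_ge0// divr_ge0.
  by rewrite ler_piMr// ltW.
have e2 : D%:R * (4 / 3 * (delta * r%:R / (D%:R * n%:R))) = delta * (4 / 3 * (r%:R / n%:R)).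
  have := gt_eqF nn; have := gt_eqF DD; move: (r%:R : R) (n%:R : R) (D%:R : R) => a b c cn bn.
  by field; rewrite bn cn.
have e3 : D%:R * expR (- (7 / 4 * ln (n%:R / (r%:R * delta)))) <=
    delta * (2 * (3 / 5) ^+ (J - i)).
  set l := ln _.
  have ll : (J - i)%:R * ln 2 <= l.
    rewrite -ler_expR expRM_natl !lnK ?posrE//.
    apply: le_trans (_ : n%:R / r%:R <= _).
      rewrite ler_pdivlMr// -natrX -natrM ler_nat -expnD subnK; last exact: ltnW.
      exact: trunc_logP.
    rewrite ler_pM2l// lef_pV2 ?posrE ?mulr_gt0//.
    by rewrite ler_piMr ?ltW.
  rewrite (_ : - (7 / 4 * l) = - l + - (3 / 4 * l)); last by lra.
  rewrite expRD expRN lnK ?posrE// invf_div mulrA [X in _ <= X]mulrA.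
  have x0 : 0 <= D%:R * (r%:R * delta / n%:R).
    by rewrite mulr_ge0// divr_ge0// mulr_ge0// ltW.
  have xb : D%:R * (r%:R * delta / n%:R) <= delta * 2.
    rewrite (_ : _ * _ = delta * (D%:R * r%:R / n%:R)); last first.
      have := gt_eqF nn; move: (r%:R : R) (n%:R : R) (D%:R : R) => a b c bn.
      by field; rewrite bn.
    by rewrite ler_pM2l// ler_pdivrMr.
  apply: (ler_pM x0 (expR_ge0 _) xb).
  apply: le_trans (_ : expR (- (3 / 4 * ln 2)) ^+ (J - i) <= _).
    rewrite -expRM_natl ler_expR mulrN lerN2 mulrCA ler_pM2l//; lra.
  by apply: lerXn2r; rewrite ?nnegrE ?expR_ge0 ?expR_ln2_le//; lra.
rewrite !mulrDr e2 addrAC.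
have := ler_wpM2l (ltW d0) q1; set a := (1 / 2) ^+ _ => q2.
have -> : delta * (11 / 6 * a) + delta * (2 * (3 / 5) ^+ (J - i)) =
   1/2 * (delta * a) + (delta * (2 * (3 / 5) ^+ (J - i)) + 4/3 * (delta * a)) by lra.
lra.
Qed.

(** The geometric series have sums 1 and 3 / 2, and 11 / 6 + 2 * 3 / 2 = 29 / 6. *)
Lemma false_alarms :
  (P [set w | exists i l, [/\ (i < J)%N, l \in locations n (2 ^ i),
       combined_test sigma delta (Y w) l (2 ^ i) & ~ hit i l]]
   <= (29 / 6 * delta)%:E)%E.
Proof.
have [d0 d1] := andP d01.
pose s := [seq (i, l) | i <- index_iota 0 J, l <- locations n (2 ^ i)].
pose A (x : nat * nat) := [set w |
   combined_test sigma delta (Y w) x.2 (2 ^ x.1) /\ ~ hit x.1 x.2].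
have sP x : x \in s -> (x.1 < J)%N /\ x.2 \in locations n (2 ^ x.1).
  by move=> /allpairsPdep[i [l [+ lD ->]]]; rewrite mem_index_iota.
have Ahit x : hit x.1 x.2 -> A x = set0 by move=> h; apply/seteqP; split=> // w [].
have Anohit x : ~ hit x.1 x.2 ->
    A x = [set w | combined_test sigma delta (Y w) x.2 (2 ^ x.1)].
  by move=> h; apply/seteqP; split=> w // [].
have mA x : x \in s -> measurable (A x).
  move=> /sP[iJ lD]; have [/Ahit ->//|/Anohit ->] := pselect (hit x.1 x.2).
  exact: measurable_fires.
have bA x : x \in s -> (P (A x) <= (alarm_bound x.1)%:E)%E.
  move=> /sP[iJ lD]; have [/Ahit ->|h] := pselect (hit x.1 x.2).
    by rewrite measure0 lee_fin alarm_bound_ge0.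
  by rewrite Anohit//; exact: false_alarm.
rewrite (_ : [set w | _] = [set w | exists2 x, x \in s & A x w]); last first.
  apply/seteqP; split=> w /=.
    move=> [i [l [iJ lD Tw h]]]; exists (i, l) => //.
    by apply/allpairsPdep; exists i, l; rewrite mem_index_iota.
  move=> [x /sP[iJ lD] [Tw h]]; by exists x.1, x.2.
apply: le_trans (union_bound mA bA) _.
rewrite lee_fin big_allpairs_dep /=.
rewrite big_mkord.
apply: le_trans (_ : \sum_(i < J) delta * (11 / 6 * (1 / 2) ^+ (J - i) + 2 * (3 / 5) ^+ (J - i)) <= _).
  apply: ler_sum => i _; apply: le_trans (alarm_scale (ltn_ord i)).
  by rewrite big_const_seq count_predT iter_addr_0 -[X in X <= _]mulr_natl.
rewrite -mulr_sumr big_split /= -!mulr_sumr mulrC ler_pM2r//.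
have := @geometric_bound R (1/2) 1 J ltac:(lra) ltac:(lra) ltac:(lra).
have := @geometric_bound R (3/5) (3/2) J ltac:(lra) ltac:(lra) ltac:(lra).
lra.
Qed.

End FalseAlarm.

(** * The smallest high-energy scale *)

Section LogLevel.
Context {R : realType} (n : nat) (delta : R).
Hypothesis n2 : (2 <= n)%N.
Hypothesis d01 : 0 < delta < 1.

Definition loglevel (r : R) : R := ln (n%:R / (r * delta)).

Let d0 : 0 < delta. Proof. by case/andP: d01. Qed.
Let nn : 0 < n%:R :> R. Proof. by rewrite ltr0n; lia. Qed.

Lemma loglevel_arg r : 0 < r -> 0 < n%:R / (r * delta).
Proof. by move=> r0; rewrite divr_gt0// mulr_gt0. Qed.

Lemma loglevel_mono r r' : 0 < r -> r <= r' -> loglevel r' <= loglevel r.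
Proof.
move=> r0 rr'; have r0' : 0 < r' by exact: lt_le_trans rr'.
rewrite ler_ln ?posrE ?loglevel_arg// ler_pM2l// lef_pV2 ?posrE ?mulr_gt0//.
by rewrite ler_pM2r.
Qed.

Lemma loglevel_ge r : 0 < r -> 2 * r <= n%:R -> ln 2 <= loglevel r.
Proof.
move=> r0 rn; rewrite ler_ln ?posrE ?loglevel_arg//.
rewrite ler_pdivlMr ?mulr_gt0// mulrA; apply: le_trans rn.
by rewrite ler_piMr ?mulr_ge0 ?(ltW r0)//; case/andP: d01 => _ /ltW.
Qed.

End LogLevel.

Section Energy.
Context {R : realType} (n p : nat) (c0 sigma delta : R) (v : 'cV[R]_p).
Hypothesis n2 : (2 <= n)%N.
Hypothesis c00 : 0 < c0.
Hypothesis s0 : 0 < sigma.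
Hypothesis d01 : 0 < delta < 1.
Notation high r := (high_energy n c0 sigma delta v r).
Notation N := (euclidean_norm v ^+ 2).

(** The energy r Delta^2 demanded at scale r. *)
Definition energy_level (r : R) : R :=
  c0 * sigma ^+ 2 *
    ((sparsity v)%:R *
       ln (1 + Num.sqrt p%:R / (sparsity v)%:R * Num.sqrt (loglevel n delta r)) +
     loglevel n delta r).

Let d0 : 0 < delta. Proof. by case/andP: d01. Qed.
Let nn : 0 < n%:R :> R. Proof. by rewrite ltr0n; lia. Qed.
Let cs : 0 < c0 * sigma ^+ 2. Proof. by rewrite mulr_gt0// exprn_gt0. Qed.
Let arg0 r : 0 < r -> 0 < n%:R / (r * delta). Proof. exact: loglevel_arg. Qed.
Let q0 : 0 <= Num.sqrt p%:R / (sparsity v)%:R :> R. Proof. by rewrite divr_ge0// sqrtr_ge0. Qed.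
Let arg1 r : 0 < 1 + Num.sqrt p%:R / (sparsity v)%:R * Num.sqrt (loglevel n delta r).
Proof. by rewrite ltr_wpDr// mulr_ge0// sqrtr_ge0. Qed.

Lemma energy_level_mono r r' : 0 < r -> r <= r' -> energy_level r' <= energy_level r.
Proof.
move=> r0 rr'; have h := loglevel_mono n2 d01 r0 rr'.
rewrite ler_pM2l//; apply: lerD => //; apply: ler_wpM2l => //.
rewrite ler_ln ?posrE// lerD2l; apply: ler_wpM2l => //.
exact: ler_wsqrtr.
Qed.

Lemma high_energy_mono r r' : 0 < r -> r <= r' -> high r -> high r'.
Proof.
move=> r0 rr' h; apply: le_trans (energy_level_mono r0 rr') _.
by apply: le_trans h _; apply: ler_wpM2r => //; exact: sqr_ge0.
Qed.

(** Small scales demand an energy bounded below, which keeps the infimum in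
[least_energy] away from 0. *)
Lemma high_energy_pos r : 0 < r -> 2 * r <= n%:R -> high r ->
  c0 * sigma ^+ 2 / 2 <= r * N.
Proof.
move=> r0 rn; apply: le_trans; rewrite ler_pM2l// -[_^-1]mul1r.
apply: le_trans ln2_ge _; apply: le_trans (loglevel_ge n2 d01 r0 rn) _; rewrite lerDr mulr_ge0// ln_ge0//.
by rewrite lerDl mulr_ge0// sqrtr_ge0.
Qed.

(** The set of high-energy scales is closed and bounded below by a positive m: past
m, it is the preimage of the nonnegative numbers under a continuous function. *)
Lemma least_energy r : 0 < r -> 2 * r <= n%:R -> high r ->
  exists x, is_least [set r : R | 0 < r /\ high r] x.
Proof.
move=> r0 rn hr; have hp := high_energy_pos r0 rn hr.
have N0 : 0 < N.
  rewrite lt0r sqr_ge0 andbT; apply/eqP => N0; move: hp; rewrite N0 mulr0.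
  by apply/negP; rewrite -ltNge divr_gt0.
pose m := Num.min (n%:R / 2) (c0 * sigma ^+ 2 / 2 / N).
have m0 : 0 < m by rewrite lt_min !divr_gt0.
have mS x : 0 < x -> high x -> m <= x.
  move=> x0 hx; rewrite /m ge_min; have [//|xn] := leP (n%:R / 2) x.
  by rewrite ler_pdivrMr// high_energy_pos//; lra.
(* clipping at m keeps the logarithm away from its singularity at 0 *)
pose g x := x * N - energy_level (Num.max x m).
have cmax x : {for x, continuous (fun x : R => Num.max x m)}.
  by apply: continuous_max; [exact: cvg_id|exact: cvg_cst].
have cl x : {for x, continuous (fun x : R => loglevel n delta (Num.max x m))}.
  apply: (@continuous_cvg _ _ _ _ _ (fun x : R => n%:R / (Num.max x m * delta)) (@ln R)).
    by apply: continuous_ln; rewrite arg0// lt_max m0 orbT.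
  apply: cvgM; first exact: cvg_cst.
  apply: cvgV; last by apply: cvgM; [exact: cmax|exact: cvg_cst].
  by rewrite gt_eqF// mulr_gt0// lt_max m0 orbT.
have cg : continuous g.
  move=> x; apply: cvgB; first by apply: cvgM; [exact: cvg_id|exact: cvg_cst].
  apply: cvgM; first exact: cvg_cst.
  apply: cvgD; last exact: cl.
  apply: cvgM; first exact: cvg_cst.
  apply: (@continuous_cvg _ _ _ _ _
    (fun x : R => 1 + Num.sqrt p%:R / (sparsity v)%:R * Num.sqrt (loglevel n delta (Num.max x m))) (@ln R)).
    exact: continuous_ln.
  apply: cvgD; first exact: cvg_cst.
  apply: cvgM; first exact: cvg_cst.
  apply: (@continuous_cvg _ _ _ _ _ (fun x : R => loglevel n delta (Num.max x m)) (@Num.sqrt R)); last exact: cl.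
  exact: sqrt_continuous.
pose S := [set x : R | m <= x] `&` g @^-1` [set y | 0 <= y].
have SE : [set r : R | 0 < r /\ high r] = S.
  apply/seteqP; split=> x /=.
    move=> [x0 hx]; have mx := mS _ x0 hx; split=> //.
    by rewrite /= /g (max_idPl mx) subr_ge0.
  move=> [mx]; rewrite /= /g (max_idPl mx) subr_ge0 => hx.
  by split=> //; exact: lt_le_trans mx.
have clS : closed S.
  apply: closedI; first exact: closed_ge.
  by apply: closed_comp => [x _|]; [exact: cg|exact: closed_ge].
have S0 : S r by rewrite -SE.
have Sl : lbound S m by move=> x [].
exists (inf S); rewrite SE; split; first by apply: closed_inf => //; [exists r|exists m].
by move=> x Sx; apply: inf_lbound => //; exists m.
Qed.

End Energy.

(** * Detection of a high-energy change-point *)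

Lemma dyadic_scale {R : realType} (x : R) m : 1 <= x -> x <= m%:R ->
  exists i, (2 ^ i)%:R <= x < (2 ^ i.+1)%:R.
Proof.
move=> x1 xm; pose Q i := (2 ^ i)%:R <= x.
have exQ : exists i, Q i by exists 0%N; rewrite /Q expn0.
have ubQ i : Q i -> (i <= m)%N.
  move=> Qi; have := le_trans Qi xm; rewrite ler_nat; apply: leq_trans.
  by apply: ltnW; exact: ltn_expl.
case: (ex_maxnP exQ ubQ) => i Qi mi; exists i; apply/andP; split; rewrite // ltNge.
by apply/negP => /mi; rewrite ltnn.
Qed.

Section Detection.
Context {R : realType} d (T : measurableType d) (P : probability T R).
Context (n p : nat) (sigma delta : R) (Theta : 'M[R]_(p, n)).
Variables (K : nat) (tau : nat -> nat) (mu : nat -> 'cV[R]_p).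
Variable eps : 'I_p -> 'I_n -> {RV P >-> R}.
Hypothesis n2 : (2 <= n)%N.
Hypothesis p0 : (1 <= p)%N.
Hypothesis s0 : 0 < sigma.
Hypothesis d01 : 0 < delta < 1.
Hypothesis cpt : change_points Theta K tau mu.
Hypothesis noise : gaussian_noise sigma eps.

Notation Y := (observation Theta eps).
Notation J := (scale_count n).

Definition energy_constant : R := 64 * (2 * 10 ^+ 9).

(** The scale is 1 if rho < 8, and otherwise the power of 2 between rho / 8 and
rho / 4.  The window is then free of other change-points, its centre is at
distance less than r / 2 from tau_k, and the logarithms at scales r and rho
differ by at most log 8. *)
Lemma detection k (rstar : R) : (1 <= k <= K)%N -> 0 < rstar ->
  rstar <= (spacing tau k)%:R ->
  high_energy n energy_constant sigma delta (jump mu k) rstar ->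
  exists i l, [/\ (i < J)%N, l \in locations n (2 ^ i),
    window l (2 ^ i) ((tau k)%:R : R),
    (4 * ((2 ^ i)%:R - 1) : R) < (spacing tau k)%:R /\ (2 ^ i)%:R - 1 < rstar / 2 &
    (P [set w | ~ combined_test sigma delta (Y w) l (2 ^ i)] <=
      ((spacing tau k)%:R * delta / n%:R)%:E)%E].
Proof.
move=> kK rs0 rsp hr; have [k1 kK'] := andP kK.
have [sp0 [sp1 sp2]] := spacing_range cpt kK.
have [d0 d1] := andP d01.
have n0 : (0 < n)%N by exact: ltnW.
have nn : 0 < n%:R :> R by rewrite ltr0n.
set sp := spacing tau k in sp0 sp1 sp2 rsp *; set t := tau k in sp1 sp2 *.
pose rho : R := Num.max rstar 1.
have rho1 : 1 <= rho by rewrite le_max lexx orbT.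
have rho0 : 0 < rho by exact: lt_le_trans rho1.
have rhosp : rho <= sp%:R by rewrite ge_max rsp ler1n.
have spn : 2 * sp%:R <= n%:R :> R by rewrite -natrM ler_nat; move: sp1 sp2; clear; lia.
have hrho : high_energy n energy_constant sigma delta (jump mu k) rho.
  by apply: (high_energy_mono n2 _ s0 d01 rs0 _ hr); rewrite ?le_max ?lexx// /energy_constant mulr_gt0// mulr_gt0// exprn_gt0.
pose L := loglevel n delta rho.
have L2 : ln 2 <= L by apply: loglevel_ge => //; lra.
have [i [l [iJ lD tl gap rb]]] : exists i l, [/\ (i < J)%N, l \in locations n (2 ^ i),
    (l <= t)%N /\ (2 * (t - l) < 2 ^ i)%N,
    ((i = 0%N /\ (4 * ((2 ^ i)%:R - 1) : R) < sp%:R) \/ (4 * 2 ^ i <= sp)%N) /\ (2 ^ i)%:R - 1 < rstar / 2 &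
    (2 ^ i)%:R <= rho <= 8 * (2 ^ i)%:R].
  have [r8|r8] := ltP rho 8.
    exists 0%N, t; rewrite expn0; split.
    - by rewrite /scale_count trunc_log_gt0.
    - by rewrite /locations eqxx mem_index_iota; move: sp0 sp1 sp2; clear; lia.
    - by rewrite leqnn subnn.
    - by split; [left; split=> //|]; rewrite subrr ?mulr0 ?ltr0n ?divr_gt0.
    - by rewrite rho1/= mulr1 ltW.
  have rhoE : rho = rstar by move: r8; rewrite /rho; case: (leP rstar 1) => // _ h; exfalso; lra.
  have [i /andP[i1 i2]] := @dyadic_scale R (rho / 4) sp ltac:(lra) ltac:(lra).
  have ispR : 4 * (2 ^ i)%:R <= sp%:R :> R by lra.
  have isp : (4 * 2 ^ i <= sp)%N by rewrite -(ler_nat R) natrM.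
  case: i i1 i2 ispR isp => [|i] i1 i2 ispR isp.
    by move: i2; rewrite expn1; lra.
  have iJ : (i.+1 < J)%N.
    by apply: trunc_log_max => //; rewrite expnS; move: isp sp1 sp2; clear; lia.
  have [l lD tl] := @locations_near n i t n0 iJ ltac:(move: isp sp1; clear; lia) ltac:(move: isp sp2; clear; lia).
  exists i.+1, l; split=> //.
  - by rewrite expnS; move: tl; clear; lia.
  - by split; [right|rewrite -rhoE; lra].
  - by rewrite expnS natrM in i2; apply/andP; split; lra.
have [gap1 rhalf] := gap; have [lt tl2] := tl; have [rb1 rb2] := andP rb.
have r1 : (0 < 2 ^ i)%N by rewrite expn_gt0.
have r0 : 0 < (2 ^ i)%:R :> R by rewrite ltr0n.
have [h1 h2] := locations_range n0 iJ lD.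
have [Dr D0] := locations_size n2 iJ.
have rn := scale_le n0 iJ.
exists i, l; split=> //.
- apply/windowE.
  have : l%:R <= t%:R :> R by rewrite ler_nat.
  have : (t + 1)%:R <= (l + 2 ^ i)%:R :> R by rewrite ler_nat; move: tl2 r1 lt; clear; lia.
  have : 1 <= (2 ^ i)%:R :> R by rewrite ler1n.
  by rewrite !natrD => ? ? ?; apply/andP; split; lra.
- split=> //; case: gap1 => [[_ //]|]; rewrite -(ler_nat R) natrM => h.
  by lra.
have G := std_gaussian_cusum_noise s0 noise r1 h1 h2.
set Z := cusum_noise _ _ _ _ in G.
pose u (j : 'I_p) := cusum sigma Theta l (2 ^ i) j 0.
have cY w j : cusum sigma (Y w) l (2 ^ i) j 0 = u j + Z j w by exact: cusum_observation.
have [_ _ inc const neq] := cpt.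
have gapn : (t - (l - 2 ^ i) <= sp)%N /\ (l + 2 ^ i - t <= sp)%N.
  case: gap1 => [[i00 _]|h]; last by move: h tl2 lt h1; clear; split; lia.
  by move: tl2 lt h1 sp0; rewrite i00 expn0; clear; split; lia.
have spE : (sp <= tau k.+1 - t)%N /\ (sp <= t - tau k.-1)%N.
  by rewrite /sp /spacing geq_minl geq_minr.
pose a := Num.sqrt ((2 ^ i)%:R / 2) * (1 - (t - l)%:R / (2 ^ i)%:R) / sigma.
have uE j : u j = a * jump mu k j 0.
  rewrite /u (@cusum_mean _ _ _ _ _ _ _ t (mu k.-1) (mu k))//; first by move: tl2 lt; clear; lia.
    move=> x /andP[x1 x2]; apply: const; first by move: kK'; clear; lia.
    by rewrite prednK//; move: spE gapn x1 x2 h1; clear => -[? ?] [? ?] *; apply/andP; split; lia.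
  move=> x /andP[x1 x2]; apply: const => //.
  move: spE gapn x1 x2 h1; clear => -[? ?] [? ?] *; apply/andP; split; lia.
have frac : 1 / 2 <= 1 - (t - l)%:R / (2 ^ i)%:R :> R.
  have : (t - l)%:R / (2 ^ i)%:R <= 1 / 2 :> R.
    rewrite ler_pdivrMr//.
    have : (2 * (t - l))%:R <= (2 ^ i)%:R :> R by rewrite ler_nat ltnW.
    by rewrite natrM; lra.
  lra.
have a2 : (2 ^ i)%:R / (8 * sigma ^+ 2) <= a ^+ 2.
  rewrite /a exprMn exprMn sqr_sqrtr ?divr_ge0// exprVn.
  rewrite invfM mulrA ler_pM2r ?invr_gt0 ?exprn_gt0//.
  have : (1 / 2) ^+ 2 <= (1 - (t - l)%:R / (2 ^ i)%:R) ^+ 2 :> R.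
    by apply: lerXn2r; rewrite ?nnegrE//; lra.
  move=> /(ler_wpM2l (ltW r0)); rewrite (_ : (1 / 2) ^+ 2 = 1 / 4); last by field.
  by lra.
have a0 : a != 0.
  by rewrite -sqrf_eq0 gt_eqF//; apply: lt_le_trans a2; rewrite divr_gt0// mulr_gt0// exprn_gt0.
have sE : #|[set j | u j != 0]%SET| = sparsity (jump mu k).
  rewrite /sparsity; apply: eq_card => j; rewrite finset.inE uE mulf_eq0 (negbTE a0).
  by rewrite inE.
have sp_pos : (0 < sparsity (jump mu k))%N.
  rewrite lt0n; apply/negP => /eqP s00.
  have := neq k kK; apply/negP; rewrite negbK -subr_eq0; apply/eqP/colP => j.
  rewrite [in RHS]mxE; apply/eqP/negPn/negP => hj.
  by have := card0_eq s00 j; rewrite inE/= hj.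
have EL : expR (- L) = rho * delta / n%:R.
  rewrite /L /loglevel expRN lnK ?posrE ?invf_div//.
  by rewrite divr_gt0// mulr_gt0.
apply: le_trans (combined_power (L := L) G cY d01 p0 r1 rn _ _ _ Dr D0 _ _) _.
- exact: le_trans ln2_ge L2.
- apply/andP; split.
    by apply: (loglevel_mono n2 d01 r0 rb1).
  apply: (@le_trans _ _ (ln (8 * (n%:R / (rho * delta))))).
    rewrite ler_ln ?posrE ?mulr_gt0 ?invr_gt0 ?mulr_gt0//.
    rewrite mulrCA ler_pM2l// -[8]invrK -invfM lef_pV2 ?posrE ?mulr_gt0//.
    by rewrite mulrA ler_pM2r// ler_pdivrMl.
  have l8 : ln 8 = 3%:R * ln 2 :> R.
    by rewrite (_ : 8 = 2 ^+ 3) ?lnXn ?mulr_natl// -natrX.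
  rewrite lnM ?posrE// ?divr_gt0 ?mulr_gt0// -/(loglevel n delta rho) -/L l8.
  by lra.
- apply: (@le_trans _ _ (ln (16 * (n%:R / (rho * delta))))).
    rewrite ler_ln ?posrE ?mulr_gt0 ?invr_gt0 ?mulr_gt0//.
    rewrite -mulrA (_ : 16 = 2 * 8); last by rewrite -natrM.
    rewrite -(mulrA 2) ler_pM2l// mulrCA ler_pM2l// -[8]invrK -invfM.
    rewrite lef_pV2 ?posrE ?mulr_gt0//.
    by rewrite mulrA ler_pM2r// ler_pdivrMl.
  have l16 : ln 16 = 4%:R * ln 2 :> R.
    by rewrite (_ : 16 = 2 ^+ 4) ?lnXn ?mulr_natl// -natrX.
  rewrite lnM ?posrE// ?divr_gt0 ?mulr_gt0// -/(loglevel n delta rho) -/L l16.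
  by lra.
- by rewrite sE.
- rewrite sE (eq_bigr (fun j => a ^+ 2 * jump mu k j 0 ^+ 2)); last first.
    by move=> j _; rewrite uE exprMn.
  rewrite -mulr_sumr -euclidean_norm_sqr.
  set N := euclidean_norm _ ^+ 2.
  have N0 : 0 <= N by exact: sqr_ge0.
  apply: le_trans (ler_wpM2r N0 a2).
  move: hrho; rewrite /high_energy -/(loglevel n delta rho) -/L -/N /energy_constant.
  set E := (_ + L) => hE.
  rewrite [X in _ <= X]mulrAC ler_pdivlMr ?mulr_gt0 ?exprn_gt0//.
  have := ler_wpM2r N0 rb2.
  set c := 2 * 10 ^+ 9 in hE *; set q := sigma ^+ 2 in hE *.
  have -> : c * E * (8 * q) = 8^-1 * (64 * c * q * E) by field.
  lra.
rewrite lee_fin EL ler_pM2r ?invr_gt0// ler_pM2r//.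
Qed.

End Detection.

(** * The estimator *)

(** A set that is determined by finitely many events belongs to the finite algebra
that they generate. *)
Lemma measurable_determined d (T : measurableType d) (I : eqType) (s : seq I)
    (A : I -> set T) (G : set T) :
  (forall i, i \in s -> measurable (A i)) ->
  (forall w w', (forall i, i \in s -> A i w <-> A i w') -> G w -> G w') ->
  measurable G.
Proof.
elim: s G => [|x s IH] G mA det.
  have [->|/set0P[w Gw]] := eqVneq G set0; first exact: measurable0.
  rewrite (_ : G = setT); first exact: measurableT.
  by apply/seteqP; split=> // w' _; apply: det Gw.
pose G1 (b : Prop) := [set w | exists w', [/\ (A x w' <-> b),
   forall i, i \in s -> A i w' <-> A i w & G w']].
have mG1 b : measurable (G1 b).
  apply: IH => [i si|w w' ww' [v [vb vw Gv]]].
    by apply: mA; rewrite inE si orbT.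
  exists v; split=> // i si; apply: iff_trans (vw i si) (ww' i si).
have mAx : measurable (A x) by apply: mA; rewrite mem_head.
rewrite (_ : G = (A x `&` G1 True) `|` (~` A x `&` G1 False)).
  by apply: measurableU; apply: measurableI => //; exact: measurableC.
apply/seteqP; split=> w /=.
  move=> Gw; have [Aw|Aw] := pselect (A x w); [left|right]; split=> //.
    by exists w; split=> //; split.
  by exists w; split=> //; split.
move=> [[Aw [w' [bw ww' Gw']]]|[Aw [w' [bw ww' Gw']]]]; apply: det Gw' => i;
  rewrite inE => /orP[/eqP ->|]; try exact: ww'.
  by split=> // _; apply/bw.
by split=> [/bw|].
Qed.

Lemma estimated_components_ext {R : realType} n p (sigma delta : R) (Y Y' : 'M[R]_(p, n)) :
  (forall i l, (i < scale_count n)%N -> l \in locations n (2 ^ i) ->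
     combined_test sigma delta Y l (2 ^ i) <-> combined_test sigma delta Y' l (2 ^ i)) ->
  estimated_components sigma delta Y = estimated_components sigma delta Y'.
Proof.
move=> h; suff E j : (j <= scale_count n)%N ->
    covered sigma delta Y j = covered sigma delta Y' j.
  by rewrite /estimated_components E.
elim: j => [//|j IH] jJ /=; rewrite (IH (ltnW jJ)).
suff -> : selected sigma delta Y (2 ^ j) (covered sigma delta Y' j) =
    selected sigma delta Y' (2 ^ j) (covered sigma delta Y' j) by [].
apply/seteqP; split=> l [lD Tl dj].
  by split; [exact: lD|exact: (h j l jJ lD).1 Tl|exact: dj].
by split; [exact: lD|exact: (h j l jJ lD).2 Tl|exact: dj].
Qed.

Theorem corollary2 (R : realType) :
  exists2 c0 : R, 0 < c0 &
  forall (n p : nat) (sigma delta : R) (Theta : 'M[R]_(p, n))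
    (K : nat) (tau : nat -> nat) (mu : nat -> 'cV[R]_p)
    (d : measure_display) (T : measurableType d) (P : probability T R)
    (eps : 'I_p -> 'I_n -> {RV P >-> R}),
  (2 <= n)%N -> (1 <= p)%N -> 0 < sigma -> 0 < delta < 1 ->
  change_points Theta K tau mu ->
  gaussian_noise sigma eps ->
  let good : set T :=
    [set w |
      let Cs := estimated_components sigma delta (observation Theta eps w) in
      no_spurious n K tau Cs /\
      forall k : nat, (1 <= k <= K)%N ->
        high_energy n c0 sigma delta (jump mu k) (spacing tau k)%:R ->
        exists2 rstar : R,
          is_least [set r : R | 0 < r /\
                                high_energy n c0 sigma delta (jump mu k) r]
                   rstar &
          (localization_error Cs (tau k) < (rstar / 2)%:E)%E /\
          rstar / 2 <= (spacing tau k)%:R / 2] in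
  ((1 - 6 * delta)%:E < P good)%E.
Proof.
have c00 : 0 < energy_constant :> R by rewrite /energy_constant !mulr_gt0// exprn_gt0.
exists energy_constant => // n p sigma delta Theta K tau mu d T P eps n2 p0 s0 d01 cpt noise.
set c0 := energy_constant in c00 *.
lazymatch goal with |- is_true (let good := ?G in _) => pose good := G end.
change (((1 - 6 * delta)%:E < P good)%E).
pose Y := observation Theta eps; pose J := scale_count n.
have [d0 d1] := andP d01.
have nn : 0 < n%:R :> R by rewrite ltr0n; lia.
pose fires (x : nat * nat) := [set w | combined_test sigma delta (Y w) x.2 (2 ^ x.1)].
pose s := [seq (i, l) | i <- index_iota 0 J, l <- locations n (2 ^ i)].
have sP i l : ((i, l) \in s) <-> (i < J)%N /\ l \in locations n (2 ^ i).
  split=> [/allpairsPdep[i' [l' [+ lD [-> ->]]]]|[iJ lD]]; first by rewrite mem_index_iota.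
  by apply/allpairsPdep; exists i, l; rewrite mem_index_iota.
have mfires x : x \in s -> measurable (fires x).
  by case: x => i l /sP[iJ lD]; exact: (@measurable_fires _ _ _ P n p sigma delta Theta eps).
have mgood : measurable good.
  apply: (measurable_determined mfires) => w w' ww'; rewrite /good /=.
  have E : estimated_components sigma delta (Y w) = estimated_components sigma delta (Y w').
    apply: estimated_components_ext => i l iJ lD.
    exact: (ww' (i, l) ((sP i l).2 (conj iJ lD))).
  by rewrite -/(Y w) -/(Y w') E.
pose alarm := [set w | exists i l, [/\ (i < J)%N, l \in locations n (2 ^ i),
    combined_test sigma delta (Y w) l (2 ^ i) &
    ~ (exists2 c : nat, change_set K tau c & window l (2 ^ i) (c%:R : R))]].
have malarm : measurable alarm.
  apply: (measurable_determined mfires) => w w' ww' [i [l [iJ lD Tw h]]].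
  exists i, l; split; [exact: iJ|exact: lD| |exact: h].
  exact: (ww' (i, l) ((sP i l).2 (conj iJ lD))).1 Tw.
pose high k := high_energy n c0 sigma delta (jump mu k) (spacing tau k)%:R.
(* f k is the grid point whose test is to detect tau_k *)
have /choice[f fP] k : exists x : nat * nat, (1 <= k <= K)%N -> high k ->
    x \in s /\ exists rstar, [/\
      is_least [set r : R | 0 < r /\ high_energy n c0 sigma delta (jump mu k) r] rstar,
      rstar <= (spacing tau k)%:R,
      window x.2 (2 ^ x.1) ((tau k)%:R : R),
      (4 * ((2 ^ x.1)%:R - 1) : R) < (spacing tau k)%:R /\ (2 ^ x.1)%:R - 1 < rstar / 2 &
      (P (~` fires x) <= ((spacing tau k)%:R * delta / n%:R)%:E)%E].
  have [[kK hk]|nk] := pselect ((1 <= k <= K)%N /\ high k); last first.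
    by exists (0%N, 0%N) => kK hk; case: nk.
  have [sp0 [sp1 sp2]] := spacing_range cpt kK.
  have sp0R : 0 < (spacing tau k)%:R :> R by rewrite ltr0n.
  have spn : 2 * (spacing tau k)%:R <= n%:R :> R.
    by rewrite -natrM ler_nat; move: sp1 sp2; clear; lia.
  have [rstar least] := least_energy n2 c00 s0 d01 sp0R spn hk.
  have rsp : rstar <= (spacing tau k)%:R by have [_] := least; apply.
  have [[rs0 hr] _] := least.
  have [i [l [iJ lD wt gap Pil]]] :=
    detection n2 p0 s0 d01 cpt noise kK rs0 rsp hr.
  by exists (i, l) => _ _; split; [exact/sP|exists rstar].
pose miss k := [set w | high k /\ ~ fires (f k) w].
have kP k : k \in index_iota 1 K.+1 -> (1 <= k <= K)%N by rewrite mem_index_iota.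
have missE k : high k -> miss k = ~` fires (f k).
  by move=> hk; apply/seteqP; split=> w // [].
have miss0 k : ~ high k -> miss k = set0 by move=> hk; apply/seteqP; split=> w // [].
have mmiss k : k \in index_iota 1 K.+1 -> measurable (miss k).
  move=> /kP kK; have [hk|/miss0 ->//] := pselect (high k); rewrite missE//.
  by apply: measurableC; apply: mfires; have [] := fP k kK hk.
have Pmiss k : k \in index_iota 1 K.+1 ->
    (P (miss k) <= ((spacing tau k)%:R * delta / n%:R)%:E)%E.
  move=> /kP kK; have [hk|/miss0 ->] := pselect (high k); last first.
    by rewrite measure0 lee_fin divr_ge0// mulr_ge0// ltW.
  by rewrite missE//; have [_ [rstar []]] := fP k kK hk.
pose missed := [set w | exists2 k, k \in index_iota 1 K.+1 & miss k w].
have mmissed : measurable missed.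
  rewrite (_ : missed = \bigcup_(k in [set` index_iota 1 K.+1]) miss k)//.
  by apply: fin_bigcup_measurable => //; exact: finite_seq.
have Pmissed : (P missed <= delta%:E)%E.
  apply: le_trans (union_bound mmiss Pmiss) _; rewrite lee_fin.
  rewrite -mulr_suml -mulr_suml -natr_sum ler_pdivrMr// mulrC ler_pM2l// ler_nat.
  exact: spacing_sum cpt.
have sub : ~` good `<=` alarm `|` missed.
  move=> w ngood; apply: contrapT => /not_orP[nalarm nmissed]; apply: ngood.
  have nofalse i l : (i < J)%N -> l \in locations n (2 ^ i) ->
      combined_test sigma delta (Y w) l (2 ^ i) ->
      exists2 c : nat, change_set K tau c & window l (2 ^ i) (c%:R : R).
    by move=> iJ lD Tl; apply: contrapT => h; apply: nalarm; exists i, l.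
  split; first exact: (no_spurious_of cpt (ltnW n2) nofalse).
  move=> k kK hk; have [fs [rstar [least rsp wt [gap rhalf] _]]] := fP k kK hk.
  exists rstar => //; split; last by rewrite ler_pM2r.
  have Tf : combined_test sigma delta (Y w) (f k).2 (2 ^ (f k).1).
    apply: contrapT => nT; apply: nmissed; exists k; last by split.
    by rewrite mem_index_iota.
  have [iJ lD] : ((f k).1 < J)%N /\ (f k).2 \in locations n (2 ^ (f k).1).
    by apply/sP; rewrite -surjective_pairing.
  have iso c : change_set K tau c ->
      `|c%:R - (tau k)%:R| <= 4 * ((2 ^ (f k).1)%:R - 1) :> R -> c = tau k.
    move=> cc h; apply/eqP; apply: contraTT h => ck; rewrite -ltNge.
    apply: lt_le_trans gap _; rewrite ler_normr.
    have /orP[h|h] := spacing_gap cpt kK cc ck; move: h; rewrite -(ler_nat R) natrD => h.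
      by apply/orP; left; rewrite lerBrDl.
    by apply/orP; right; rewrite opprB lerBrDl.
  have [C hC mC] := localization (ltnW n2) nofalse iJ lD Tf wt iso.
  apply: (@le_lt_trans _ _ (`|midpoint C - (tau k)%:R|)%:E).
    by apply: ereal_inf_lbound; exists C.
  by rewrite lte_fin; apply: le_lt_trans mC rhalf.
have Pbad : (P (~` good) <= (35 / 6 * delta)%:E)%E.
  apply: (@le_trans _ _ (P (alarm `|` missed))).
    by apply: le_measure => //; rewrite inE; [exact: measurableC|exact: measurableU].
  apply: le_trans (measureU2 _ malarm mmissed) _.
  rewrite (_ : 35 / 6 * delta = 29 / 6 * delta + delta); last by field.
  rewrite EFinD; apply: leeD => //.
  exact: (@false_alarms _ _ _ P n p sigma delta Theta K tau mu eps).
have Pfin : P good \is a fin_num by exact: fin_num_measure.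
move: Pbad; rewrite probability_setC// -(fineK Pfin) -EFinB lee_fin lte_fin.
by lra.
Qed.
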